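(* Let $\Gamma\subset SL(2,\mathbb{C})$ be a finite subgroup of order $N$. For any complex number $\tau\neq0$ and any integer $n\ge0$ one has an isomorphism $$(\mathcal{C}\!\mathcal{M}_{nN})^\Gamma_{n\mathbf{v}^0}=\mathfrak{M}^\Gamma_\zeta(n\mathbf{v}^0,\mathbf{w}^0),$$ where $\zeta=(\zeta_{\mathbb{C}},\zeta_{\mathbb{R}})$ with $\zeta_{\mathbb{C}}=(\tau,\dots,\tau)$ and $\zeta_{\mathbb{R}}\in\mathbb{R}^d$ arbitrary.
   Context: Let $L=\mathbb{C}^2$ be the tautological representation of $\Gamma$ with a $\Gamma$-invariant Hermitian inner product and the standard ($\Gamma$-invariant) symplectic form, $e_1,e_2$ an orthonormal symplectic basis of $L$, and $R_0,\dots,R_{d-1}$ the irreducible representations of $\Gamma$ ($R_0$ trivial); $\mathbf{v}^0=(\dim R_0,\dots,\dim R_{d-1})$ (the class of the regular representation), $\mathbf{w}^0=(1,0,\dots,0)$ (the class of the trivial representation). Quiver variety (affine Dynkin graph of $\Gamma$). For unitary representations $V=\bigoplus_kV_k\otimes R_k$, $W=\bigoplus_kW_k\otimes R_k$ of $\Gamma$ with classes $\mathbf{v}=(\dim V_k)_k$, $\mathbf{w}=(\dim W_k)_k$, and $\zeta=(\zeta_{\mathbb{C}},\zeta_{\mathbb{R}})\in\mathbb{C}^d\times\mathbb{R}^d$, $\mathfrak{M}^\Gamma_\zeta(\mathbf{v},\mathbf{w})$ is the set of triples $(B,i,j)\in\mathrm{Hom}_\Gamma(V\otimes L,V)\oplus\mathrm{Hom}_\Gamma(W,V)\oplus\mathrm{Hom}_\Gamma(V,W)$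 satisfying $[B,B]+ij=-\zeta_{\mathbb{C}}$ and $[B,B^\dagger]+ii^\dagger-j^\dagger j=-\zeta_{\mathbb{R}}$, modulo the group $U_\Gamma(V)$ of $\Gamma$-equivariant unitary automorphisms of $V$. Here, with $B_a=B(\,\cdot\otimes e_a)\in\mathrm{End}(V)$, $[B,B]:=B_1B_2-B_2B_1$ and $[B,B^\dagger]:=\sum_a(B_aB_a^\dagger-B_a^\dagger B_a)$, and $\zeta_{\mathbb{C}}$, $\zeta_{\mathbb{R}}$ act on $V_k\otimes R_k$ as multiplication by $\zeta^k_{\mathbb{C}}$, $\zeta^k_{\mathbb{R}}$. It carries the complex structure for which $(B,i,j)$ are holomorphic coordinates (a hyper-Kähler quotient). Calogero–Moser space. $\mathcal{C}\!\mathcal{M}_m$ is this quiver variety for the trivial group with $V=\mathbb{C}^m$, $W=\mathbb{C}$ and $\zeta_{\mathbb{C}}=\tau\neq0$; equivalently $\mathcal{C}\!\mathcal{M}_m=\{(B_1,B_2,i,j)\mid B_1,B_2\in\mathrm{End}(\mathbb{C}^m),\ i\in\mathbb{C}^m,\ j\in(\mathbb{C}^m)^*,\ [B_1,B_2]+ij=-\tau\,\mathrm{Id}\}/GL_m(\mathbb{C})$. Group action. $\gamma\in\Gamma$ acts on $\mathcal{C}\!\mathcal{M}_m$ by $(B,i,j)\mapsto(B\cdot(1\otimes\gamma),i,j)$ with $B:\mathbb{C}^m\otimes L\to\mathbb{C}^m$. For a $\Gamma$-fixed point represented by $(B,i,j)$ there are unique $g_\gamma\in GL_m(\mathbb{C})$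 with $g_\gamma B(g_\gamma^{-1}\otimes1)=B(1\otimes\gamma)$, $g_\gamma i=i$, $jg_\gamma^{-1}=j$, and $\gamma\mapsto g_\gamma$ is a representation of $\Gamma$ on $\mathbb{C}^m$. $(\mathcal{C}\!\mathcal{M}_{nN})^\Gamma_{n\mathbf{v}^0}$ is the locus of $\Gamma$-fixed points in $\mathcal{C}\!\mathcal{M}_{nN}$ at which this representation is isomorphic to $n$ copies of the regular representation. *)

(* Defs.v *)
(* MathComp / MathComp-Analysis world. *)
From HB Require Import structures.
From mathcomp Require Import all_boot all_order all_algebra all_fingroup.
From mathcomp Require Import mxrepresentation character.
From mathcomp Require Import complex mxtens.
From mathcomp Require Import boolp classical_sets functions reals.
From mathcomp Require Import topology normedtype derive.

Set Implicit Arguments.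
Unset Strict Implicit.
Unset Printing Implicit Defensive.

Import Order.TTheory GRing.Theory Num.Theory.
Import numFieldNormedType.Exports.

Local Open Scope classical_set_scope.
Local Open Scope ring_scope.
Local Open Scope sesquilinear_scope.

(* The complex numbers, packed so that the topology which the library puts on
   an arbitrary numFieldType is found by inference. *)
Definition cplx (R : realType) : numClosedFieldType := R[i]%C.

(* A set with a topology and, for each open subset, a class of functions called
   holomorphic there.  A complex manifold, or a reduced complex space, is
   determined by these data, and biholomorphic maps are exactly their
   isomorphisms [hiso].  Only points of [hcarrier], and only the values of a
   function on the open subset under consideration, are meaningful. *)
Record hspace (C : numFieldType) := HSpace {
  hpt : Type;
  hcarrier : set hpt;
  hopen : set hpt -> Prop;
  hholo : set hpt -> (hpt -> C) -> Prop
}.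
Arguments hpt {C} X : rename.
Arguments hcarrier {C} X : rename.
Arguments hopen {C} X U : rename.
Arguments hholo {C} X U f : rename.

Section HolomorphicSpaces.
Context {C : numFieldType}.

Definition haffine (E : normedModType C) : hspace C :=
  @HSpace C E setT (fun U => open U)
    (fun U f => forall x, U x -> differentiable (f : E -> C^o) x).

(* Holomorphic on a subset: locally the restriction of a holomorphic function
   of the surrounding space. *)
Definition hsub (X : hspace C) (A : set (hpt X)) : hspace C :=
  @HSpace C (hpt X) (hcarrier X `&` A)
    (fun U => exists2 V, hopen X V & U = V `&` A)
    (fun U f => forall x, U x ->
       exists V g, [/\ hopen X V, V x, hholo X V g
                     & forall y, V y -> U y -> f y = g y]).

(* Quotient by the equivalence relation whose classes are the sets [cl x];
   a point of the quotient is such a class. *)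
Definition hquot (X : hspace C) (cl : hpt X -> set (hpt X)) : hspace C :=
  @HSpace C (set (hpt X)) (cl @` hcarrier X)
    (fun U => U `<=` cl @` hcarrier X /\ hopen X (hcarrier X `&` cl @^-1` U))
    (fun U f => hholo X (hcarrier X `&` cl @^-1` U) (f \o cl)).

Definition hiso (X Y : hspace C) : Prop :=
  exists phi : hpt X -> hpt Y,
    [/\ set_bij (hcarrier X) (hcarrier Y) phi,
        forall V, V `<=` hcarrier Y ->
          (hopen Y V <-> hopen X (hcarrier X `&` phi @^-1` V))
      & forall V f, hopen Y V ->
          (hholo Y V f <-> hholo X (hcarrier X `&` phi @^-1` V) (f \o phi))].

End HolomorphicSpaces.

Section QuiverData.
Context {C : numClosedFieldType}.

(* The ambient space of ((B_1, B_2), i, j) with V = C^m and W = C^w, where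
   B_a = B (- (x) e_a) for a chosen basis e_1, e_2 of L. *)
Definition qdata (m w : nat) : Type :=
  ('M[C]_m * 'M[C]_m * 'M[C]_(m, w) * 'M[C]_(w, m))%type.

Context {m w : nat}.
Implicit Type x : qdata m w.

Definition qB1 x : 'M[C]_m := x.1.1.1.
Definition qB2 x : 'M[C]_m := x.1.1.2.
Definition qi x : 'M[C]_(m, w) := x.1.2.
Definition qj x : 'M[C]_(w, m) := x.2.

Definition mu_C x : 'M[C]_m :=
  qB1 x *m qB2 x - qB2 x *m qB1 x + qi x *m qj x.

Definition mu_R x : 'M[C]_m :=
  (qB1 x *m (qB1 x)^t* - (qB1 x)^t* *m qB1 x)
  + (qB2 x *m (qB2 x)^t* - (qB2 x)^t* *m qB2 x)
  + qi x *m (qi x)^t* - (qj x)^t* *m qj x.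

Definition gauge (g : 'M[C]_m) x : qdata m w :=
  (g *m qB1 x *m invmx g, g *m qB2 x *m invmx g, g *m qi x, qj x *m invmx g).

Definition orbit_of (A : set 'M[C]_m) x : set (qdata m w) :=
  [set gauge g x | g in A].

(* The columns of [e] are e_1, e_2 (in the standard coordinates of L = C^2);
   this is the endomorphism B (- (x) l) of V. *)
Definition Bat (e : 'M[C]_2) x (l : 'cV[C]_2) : 'M[C]_m :=
  let c := invmx e *m l in c 0 0 *: qB1 x + c 1 0 *: qB2 x.

(* (B, i, j) |-> (B (1 (x) s), i, j) for s in GL(L). *)
Definition actL (e s : 'M[C]_2) x : qdata m w :=
  (Bat e x (s *m col 0 e), Bat e x (s *m col 1 e), qi x, qj x).

End QuiverData.
Arguments qdata : clear implicits.

Section Spaces.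
Context {R : realType} {gT : finGroupType} {G : {group gT}}.
Local Notation C := (cplx R).

Definition calogero_moser (m : nat) (tau : C) : hspace C :=
  hquot (X := hsub (X := haffine (qdata C m 1))
                   [set x : qdata C m 1 | mu_C x = - tau%:M])
        (orbit_of [set g | g \in unitmx]).

(* The locus of Gamma-fixed points at which the representation
   gamma |-> g_gamma is isomorphic to n copies of the regular one. *)
Definition cm_fixed_regular (L : mx_representation C G 2) (e : 'M[C]_2)
    (m n : nat) (tau : C) : hspace C :=
  hsub (X := calogero_moser m tau)
    [set p : set (qdata C m 1) |
       (forall s, s \in G -> actL e (L s) @` p = p) /\
       exists (x : qdata C m 1) (rho : mx_representation C G m),
         [/\ p x, forall s, s \in G -> gauge (rho s) x = actL e (L s) x
           & mx_rsim rho (muln_grepr (Representation (regular_repr C G)) n)]].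

(* A complete irredundant list R_0, ..., R_d of the irreducible
   representations, in unitary form, with R_0 trivial. *)
Definition irr_list (d : nat) (irr : 'I_d.+1 -> representation C G) : Prop :=
  [/\ forall k, mx_irreducible (irr k),
      forall k l, mx_rsim (irr k) (irr l) -> k = l,
      forall rho : representation C G,
        mx_irreducible rho -> exists k, mx_rsim rho (irr k),
      forall k s, s \in G -> irr k s \is unitarymx
    & rdegree (irr ord0) = 1%N /\ forall s, s \in G -> irr ord0 s = 1%:M].

Section QuiverVariety.
Context {d : nat}.
Variable irr : 'I_d.+1 -> representation C G.

Definition class_dim (v : 'I_d.+1 -> nat) : nat :=
  (\sum_k v k * rdegree (irr k))%N.

(* The unitary representation (+)_k V_k (x) R_k with V_k = C^(v k). *)
Definition class_rep (v : 'I_d.+1 -> nat) (s : gT) : 'M[C]_(class_dim v) :=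
  \mxdiag_k ((1%:M : 'M[C]_(v k)) *t irr k s).

(* z acting on V_k (x) R_k as multiplication by z k. *)
Definition class_scalar (v : 'I_d.+1 -> nat) (z : 'I_d.+1 -> C) :
    'M[C]_(class_dim v) :=
  \mxdiag_k ((z k)%:M : 'M[C]_(v k * rdegree (irr k))).

(* (B, i, j) lies in
   Hom_Gamma(V (x) L, V) (+) Hom_Gamma(W, V) (+) Hom_Gamma(V, W). *)
Definition equivariant (L : mx_representation C G 2) (e : 'M[C]_2)
    (v w : 'I_d.+1 -> nat) (x : qdata C (class_dim v) (class_dim w)) : Prop :=
  forall s, s \in G ->
    [/\ forall l, Bat e x (L s *m l) *m class_rep v s
                  = class_rep v s *m Bat e x l,
        qi x *m class_rep w s = class_rep v s *m qi x
      & qj x *m class_rep v s = class_rep w s *m qj x].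

(* The complex structure of the hyper-Kaehler quotient for which (B, i, j) are
   holomorphic coordinates: a function on the quotient is holomorphic when its
   pullback to the common level set is locally the restriction of a holomorphic
   function of (B, i, j).  (By unitary invariance, the complex-linear
   differential of such an extension kills the whole complexified orbit
   directions, so it is a differential of type (1, 0) on the quotient.) *)
Definition quiver_variety (L : mx_representation C G 2) (e : 'M[C]_2)
    (v w : 'I_d.+1 -> nat) (zC : 'I_d.+1 -> C) (zR : 'I_d.+1 -> R) :
    hspace C :=
  hquot (X := hsub (X := haffine (qdata C (class_dim v) (class_dim w)))
                   [set x : qdata C (class_dim v) (class_dim w) |
                     [/\ equivariant L e x,
                         mu_C x = - class_scalar v zC
                       & mu_R x = - class_scalar v (fun k => (zR k)%:C%C)]])
        (orbit_of [set u | u \is unitarymx /\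
           forall s, s \in G -> u *m class_rep v s = class_rep v s *m u]).

End QuiverVariety.

(* [h] is the Gram matrix, in the standard coordinates of L, of a
   Gamma-invariant Hermitian inner product. *)
Definition invariant_hermitian (L : mx_representation C G 2) (h : 'M[C]_2) :
    Prop :=
  [/\ h^t* = h,
      forall l : 'cV[C]_2, l != 0 -> 0 < (l^t* *m h *m l) 0 0
    & forall s, s \in G -> (L s)^t* *m h *m L s = h].

(* The columns of [e] are orthonormal for [h], and e_1, e_2 is a symplectic
   basis for the standard form (l, l') |-> det (l | l'). *)
Definition orthonormal_symplectic (h e : 'M[C]_2) : Prop :=
  e^t* *m h *m e = 1%:M /\ \det e = 1.

End Spaces.

(* Main.v *)
(* At a fixed point the representation [g] makes (B, i, j) equivariant; when it
   is [n] times the regular one, coordinates can be chosen in which it is the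
   unitary representation on (+)_k C^(n dim R_k) (x) R_k.  So the fixed locus is
   the set of equivariant solutions of [mu_C = - tau], up to the invertible
   elements of the commutant, and it has to be compared with the equivariant
   solutions of [mu_C = - tau], [mu_R = - zeta_R] up to unitary ones.

   Bijectivity is the Kempf-Ness correspondence.  Summing the diagonal of [mu_C]
   over a set [S] of coordinates leaves only products of entries joining [S] to its
   complement or to W, so when (B, i, j) is bounded one of these is bounded below.
   Hence |g (B, i, j)|^2 + sum_k zeta_k log |det g_k|^2 is proper on an orbit; its
   minima are the solutions of [mu_R = - zeta_R], and they form one unitary orbit.
   The same estimate, made quantitative, gives the continuity of the correspondence
   in both directions.

   For holomorphy, the differential of [mu_C] is onto at a level point, so Newton's
   method retracts a neighbourhood onto the fixed part of its level set.  A
   holomorphic function on the quiver variety is carried by the correspondence to a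
   real differentiable function there; on the real level set its differential
   is complex linear, being that of a holomorphic extension, and unitary invariance
   carries this over to the complexified orbit directions.  Composing with the normal
   form that turns finitely many words B_a ... B_b i into the standard basis, then
   with the average over the group and the retraction, extends it holomorphically
   to a neighbourhood of the orbit. *)
Require Import Defs.
From HB Require Import structures.
From mathcomp Require Import all_boot all_order all_algebra all_fingroup.
From mathcomp Require Import mxrepresentation character pgroup.
From mathcomp Require Import complex mxtens.
From mathcomp Require Import boolp classical_sets functions reals.
From mathcomp Require Import topology normedtype derive.
From mathcomp Require Import sequences exp landau prodnormedzmodule interval_inference.
From mathcomp Require Import ring lra.

Set Implicit Arguments.
Unset Strict Implicit.
Unset Printing Implicit Defensive.

Import Order.TTheory GRing.Theory Num.Theory.
Local Open Scope ring_scope.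
Local Open Scope sesquilinear_scope.

(** The obstacle is that the map between the two quotients moves a point by the positive part of
    some [g], and no holomorphic formula gives this part. Near 1 it is only shown to be Lipschitz
    ([polar_lip]). This is enough: the differential of an invariant function kills the whole
    commutant, the skew-Hermitian directions by unitary invariance and all others by complex
    linearity, so that a first-order error in the positive part contributes nothing.

    Implicit functions are avoided because [mu_C] is quadratic: differences of its values are given
    exactly by its polarisation, and Newton's method together with the differentiability of the
    retraction reduces to norm estimates.

    A function on a subspace of the Calogero-Moser space is holomorphic only if it extends locally
    to open sets of that space, where orbits need not be fixed by the group. Hence the normal form:
    it is invariant under all of [GL_m], and it sends the fixed orbits into the fixed subspace, on
    which the extension has to agree with the given function. *)

Section RealEmbedding.
Context {R : realType}.
Local Notation C := (cplx R).

(** Norms of [C] take their values in [C]; [rc], [rp], [nm] and [sqn] move them to [R], where all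
    estimates are made. The first two become opaque after this section, so that later arguments rest
    on the rules proved here. *)
Definition rc (a : R) : C := a%:C%C.
Definition rp (z : C) : R := complex.Re z.

Fact rc_is_nmod_morphism : nmod_morphism rc.
Proof.
by split=> [|a b]; [exact: (rmorph0 (real_complex R))|exact: (rmorphD (real_complex R))].
Qed.

Fact rc_is_monoid_morphism : monoid_morphism rc.
Proof.
by split=> [|a b]; [exact: (rmorph1 (real_complex R))|exact: (rmorphM (real_complex R))].
Qed.

HB.instance Definition _ := GRing.isNmodMorphism.Build R C rc rc_is_nmod_morphism.
HB.instance Definition _ := GRing.isMonoidMorphism.Build R C rc rc_is_monoid_morphism.

Lemma rc_le a b : (rc a <= rc b) = (a <= b). Proof. exact: lecR. Qed.
Lemma rc_lt a b : (rc a < rc b) = (a < b). Proof. exact: ltcR. Qed.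
Lemma rc_ge0 a : (0 <= rc a) = (0 <= a). Proof. by rewrite -[0]/(rc 0) rc_le. Qed.
Lemma rc_gt0 a : (0 < rc a) = (0 < a). Proof. by rewrite -[0]/(rc 0) rc_lt. Qed.
Lemma rc_inj : injective rc. Proof. exact: complexI. Qed.
Lemma rc_eq0 a : (rc a == 0) = (a == 0). Proof. by rewrite -(inj_eq rc_inj). Qed.
Lemma rc_conj a : (rc a)^* = rc a. Proof. exact: conjc_real. Qed.

Lemma rc_real a : rc a \is Num.real.
Proof. by rewrite realE -[0]/(rc 0) !rc_le le_total. Qed.

Lemma rp_rc a : rp (rc a) = a. Proof. by []. Qed.

Lemma rc_rp z : z \is Num.real -> rc (rp z) = z. Proof. exact: RRe_real. Qed.

Lemma rc_norm a : `|rc a| = rc `|a|.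
Proof.
have [a0|/ltW a0] := leP 0 a; first by rewrite !ger0_norm ?rc_ge0.
by rewrite !ler0_norm ?rmorphN // -[0]/(rc 0) rc_le.
Qed.

Definition nm (z : C) : R := rp `|z|.

Lemma rc_nm z : rc (nm z) = `|z|. Proof. exact/rc_rp/normr_real. Qed.

Lemma nm_ge0 z : 0 <= nm z. Proof. by rewrite -rc_ge0 rc_nm. Qed.

Definition sqn (z : C) : R := nm z ^+ 2.

Lemma rc_sqn z : rc (sqn z) = `|z| ^+ 2. Proof. by rewrite rmorphXn /= rc_nm. Qed.

Lemma sqnE z : z * z^* = rc (sqn z). Proof. by rewrite rc_sqn -normCK. Qed.

Lemma sqn_ge0 z : 0 <= sqn z. Proof. exact: sqr_ge0. Qed.

Lemma rcM a b : rc (a * b) = rc a * rc b. Proof. exact: rmorphM. Qed.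

Lemma nmM z t : nm (z * t) = nm z * nm t.
Proof. by apply: rc_inj; rewrite rcM !rc_nm normrM. Qed.

Lemma sqnM z t : sqn (z * t) = sqn z * sqn t.
Proof. by rewrite /sqn nmM exprMn. Qed.

Lemma nm_rc a : nm (rc a) = `|a|.
Proof. by apply: rc_inj; rewrite rc_nm rc_norm. Qed.

Lemma sqn_rc a : sqn (rc a) = a ^+ 2.
Proof. by rewrite /sqn nm_rc real_normK ?num_real. Qed.

Lemma sqn_conj z : sqn z^* = sqn z.
Proof. by rewrite /sqn; congr (_ ^+ 2); apply: rc_inj; rewrite !rc_nm norm_conjC. Qed.

Lemma sqn_ge k z : 0 <= k -> rc k <= `|z| -> k ^+ 2 <= sqn z.
Proof.
by move=> k0; rewrite -rc_nm rc_le => kz; apply: lerXn2r; rewrite ?nnegrE ?nm_ge0.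
Qed.

Lemma sqn_eq0 z : (sqn z == 0) = (z == 0).
Proof. by rewrite sqrf_eq0 -rc_eq0 rc_nm normr_eq0. Qed.

End RealEmbedding.
#[global] Opaque cplx rc rp.

(** * Moment maps and gauge transformations *)

Lemma invmx_mul (C : comUnitRingType) n (A B : 'M[C]_n) : A \in unitmx -> B \in unitmx ->
  invmx (A *m B) = invmx B *m invmx A.
Proof.
move=> Au Bu; have ABu : A *m B \in unitmx by rewrite unitmx_mul Au.
apply: (can_inj (mulKmx ABu)); rewrite (mulmxV ABu) mulmxA -(mulmxA A) (mulmxV Bu) mulmx1.
by rewrite (mulmxV Au).
Qed.

Section Algebra.
Context {C : numClosedFieldType}.

(* [Y] is a quotient of [(B1, B2)] killing [i]: there the commutator is [- tau],
   whose trace is nonzero unless the quotient is. *)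
Lemma coinvariant_eq0 m r w (B1 B2 : 'M[C]_m) (i : 'M_(m, w)) (j : 'M_(w, m)) (tau : C)
    (Y : 'M[C]_(r, m)) (Y' : 'M[C]_(m, r)) (b1 b2 : 'M[C]_r) : tau != 0 ->
  B1 *m B2 - B2 *m B1 + i *m j = - tau%:M -> Y *m Y' = 1%:M ->
  Y *m B1 = b1 *m Y -> Y *m B2 = b2 *m Y -> Y *m i = 0 -> r = 0%N.
Proof.
move=> tau0 muE YK D1 D2 Yi0.
have : (b1 *m b2 - b2 *m b1) = - tau%:M.
  have D : (b1 *m b2 - b2 *m b1) *m Y = Y *m (B1 *m B2 - B2 *m B1).
    by rewrite mulmxBl mulmxBr !mulmxA D1 D2 -!mulmxA D1 D2.
  have := congr1 (mulmxr Y') D; rewrite /= -[_ *m Y *m Y']mulmxA YK mulmx1 => ->.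
  have -> : B1 *m B2 - B2 *m B1 = - tau%:M - i *m j by rewrite -muE addrK.
  rewrite mulmxBr (mulmxA Y i) Yi0 mul0mx subr0 mulmxN mul_mx_scalar.
  by rewrite mulNmx -scalemxAl YK scalemx1.
move/(congr1 mxtrace); rewrite !raddfB /= mxtrace_mulC subrr raddfN /= mxtrace_scalar.
move/esym/eqP; rewrite oppr_eq0 mulrn_eq0 (negPf tau0) orbF.
by move/eqP.
Qed.

(** Factor [A] through its rank as [X *m Y]. Since [A] commutes with [B1] and [B2], the surjection
    [Y] carries them to matrices of size [\rank A], and it kills [i]; [coinvariant_eq0] leaves only
    rank 0. *)
Lemma commuting_kill_eq0 m w (B1 B2 A : 'M[C]_m) (i : 'M_(m, w)) (j : 'M_(w, m))
    (tau : C) :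
  tau != 0 -> B1 *m B2 - B2 *m B1 + i *m j = - tau%:M ->
  A *m B1 = B1 *m A -> A *m B2 = B2 *m A -> A *m i = 0 -> A = 0.
Proof.
move=> tau0 muE cB1 cB2 Ai0.
suff : \rank A = 0%N by move/eqP; rewrite mxrank_eq0 => /eqP.
move: (col_base A) (row_base A) (mulmx_base A) (col_base_full A) (row_base_free A).
move: (\rank A) => r X Y AE /mulVpmx XK /mulmxVp YK.
move: (pinvmx X) (pinvmx Y) XK YK => X' Y' XK YK.
have descend B : A *m B = B *m A -> Y *m B = X' *m B *m X *m Y.
  by move=> cB; rewrite -!mulmxA AE -cB -AE !mulmxA XK mul1mx.
have Yi0 : Y *m i = 0.
  by rewrite -[Y]mul1mx -XK -!mulmxA [X *m _]mulmxA AE Ai0 mulmx0.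
exact: coinvariant_eq0 tau0 muE YK (descend _ cB1) (descend _ cB2) Yi0.
Qed.

Lemma sum_ord2 (V : nmodType) (F : 'I_2 -> V) : \sum_i F i = F 0 + F 1.
Proof. by rewrite !big_ord_recl big_ord0 addr0; congr (_ + F _); apply: val_inj. Qed.

Section Gauge.
Context {m w : nat}.
Implicit Types (x : qdata C m w) (g : 'M[C]_m).

Lemma qdataP x y : qB1 x = qB1 y -> qB2 x = qB2 y -> qi x = qi y ->
  qj x = qj y -> x = y.
Proof.
by case: x => [[[? ?] ?] ?]; case: y => [[[? ?] ?] ?]; rewrite /qB1 /qB2 /qi /qj /=
  => -> -> -> ->.
Qed.

Lemma gauge1 x : gauge 1%:M x = x.
Proof. by apply: qdataP; rewrite /gauge /qB1 /qB2 /qi /qj /= ?invmx1 ?mul1mx ?mulmx1. Qed.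

Lemma gaugeM g h x : g \in unitmx -> h \in unitmx ->
  gauge (g *m h) x = gauge g (gauge h x).
Proof.
move=> gu hu.
by apply: qdataP; rewrite /gauge /qB1 /qB2 /qi /qj /= ?(invmx_mul gu hu) !mulmxA.
Qed.

Lemma gaugeK g x : g \in unitmx -> gauge (invmx g) (gauge g x) = x.
Proof. by move=> gu; rewrite -gaugeM ?unitmx_inv // mulVmx // gauge1. Qed.

Lemma mu_C_gauge g x : g \in unitmx ->
  mu_C (gauge g x) = g *m mu_C x *m invmx g.
Proof.
move=> gu; rewrite /mu_C /qB1 /qB2 /qi /qj /=.
rewrite mulmxDr mulmxDl mulmxBr mulmxBl !mulmxA.
by rewrite -!(mulmxA _ (invmx g) g) mulVmx // !mulmx1.
Qed.

Lemma mu_C_gauge_scalar g x a : g \in unitmx ->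
  mu_C x = a%:M -> mu_C (gauge g x) = a%:M.
Proof.
by move=> gu E; rewrite mu_C_gauge // E mul_mx_scalar -scalemxAl mulmxV // scalemx1.
Qed.

(** This is [actL] in the coordinates given by [e], in which the group will act by unitary matrices
    of determinant 1. It is a right action ([act2M]) and commutes with [gauge]. *)
Definition act2 (s : 'M[C]_2) x : qdata C m w :=
  (s 0 0 *: qB1 x + s 1 0 *: qB2 x, s 0 1 *: qB1 x + s 1 1 *: qB2 x, qi x, qj x).

Lemma actLE (e s : 'M[C]_2) x : actL e s x = act2 (invmx e *m s *m e) x.
Proof.
have E k l : (invmx e *m (s *m col k e)) l 0 = (invmx e *m s *m e) l k.
  by rewrite mulmxA colE mulmxA -colE mxE.
by rewrite /actL /Bat /act2 !E.
Qed.

Lemma act2M s t x : act2 t (act2 s x) = act2 (s *m t) x.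
Proof.
apply: qdataP; rewrite /act2 /qB1 /qB2 /qi /qj //= !mxE !sum_ord2.
all: rewrite !scalerDr !scalerDl !scalerA addrACA.
all: by rewrite !(mulrC (t _ _)).
Qed.

Lemma act21 x : act2 1%:M x = x.
Proof.
by apply: qdataP; rewrite /act2 /qB1 /qB2 //= !mxE /= scale1r scale0r ?addr0 ?add0r.
Qed.

Lemma gauge_act2 g s x : gauge g (act2 s x) = act2 s (gauge g x).
Proof.
by apply: qdataP; rewrite /act2 /gauge /qB1 /qB2 //= mulmxDr mulmxDl -!scalemxAr -!scalemxAl.
Qed.

Lemma det2 (s : 'M[C]_2) : \det s = s 0 0 * s 1 1 - s 0 1 * s 1 0.
Proof.
rewrite (expand_det_row _ 0) sum_ord2 /cofactor !det_mx11 !mxE /=.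
have -> : lift 0 0 = 1 :> 'I_2 by apply: val_inj.
have -> : lift 1 0 = 0 :> 'I_2 by apply: val_inj.
by rewrite expr0 mul1r expr1 mulN1r mulrN.
Qed.

Lemma mu_C_act2 s x : \det s = 1 -> mu_C (act2 s x) = mu_C x.
Proof.
rewrite det2 => ds; rewrite /mu_C /act2 /qB1 /qB2 /qi /qj /=.
set B1 := x.1.1.1; set B2 := x.1.1.2; congr (_ + _).
rewrite !mulmxDl !mulmxDr -!scalemxAl -!scalemxAr !scalerA.
rewrite -[RHS]scale1r -ds scalerBr !scalerBl.
apply/matrixP => a b; rewrite !mxE; ring.
Qed.

(** Infinitesimal freeness. The equations for [g] to stabilise [x] are linear in [g - 1], so it also
    gives freeness under [GL_m] ([gauge_inj]). *)
Definition free_at x := forall A : 'M[C]_m, A *m qB1 x = qB1 x *m A ->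
  A *m qB2 x = qB2 x *m A -> A *m qi x = 0 -> A = 0.

Lemma level_free tau x : tau != 0 -> mu_C x = - tau%:M -> free_at x.
Proof. by move=> tau0 E A; apply: commuting_kill_eq0 tau0 E. Qed.

Lemma gauge_inj x g h : free_at x -> g \in unitmx -> h \in unitmx ->
  gauge g x = gauge h x -> g = h.
Proof.
move=> fx gu hu gh.
have : gauge (invmx h *m g) x = x by rewrite gaugeM ?unitmx_inv // gh gaugeK.
set k := invmx h *m g => kx.
have ku : k \in unitmx by rewrite unitmx_mul unitmx_inv hu.
suff k1 : k - 1%:M = 0.
  have : h *m k = g by rewrite mulmxA mulmxV // mul1mx.
  by move/eqP: k1; rewrite subr_eq0 => /eqP ->; rewrite mulmx1.
have H B : k *m B *m invmx k = B -> k *m B = B *m k.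
  by move=> {2}<-; rewrite -!mulmxA mulVmx // mulmx1.
apply: fx; rewrite ?mulmxBl ?mulmxBr ?mul1mx ?mulmx1.
- by rewrite H // -[RHS](congr1 qB1 kx).
- by rewrite H // -[RHS](congr1 qB2 kx).
- by rewrite -[X in _ - X](congr1 qi kx) subrr.
Qed.

End Gauge.
End Algebra.

(** * Eigenvalue gaps on a complex level set *)

Section Gap.
Context {R : realType}.
Local Notation C := (cplx R).

(** Transposing exchanges the roles of [i] and [j], and swapping [B1] with [B2] keeps the sign of
    the commutator. [gap] uses this to reduce negative [theta a0] to the nonnegative case. *)
Definition qtr m (x : qdata C m 1) : qdata C m 1 :=
  ((qB2 x)^T, (qB1 x)^T, (qj x)^T, (qi x)^T).

Lemma mu_C_qtr m (x : qdata C m 1) : mu_C (qtr x) = (mu_C x)^T.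
Proof. by rewrite /mu_C /qtr /qB1 /qB2 /qi /qj /= raddfD raddfB /= !trmx_mul. Qed.

Definition qbounded m (x : qdata C m 1) (M : R) :=
  [/\ forall a b, `|qB1 x a b| <= rc M, forall a b, `|qB2 x a b| <= rc M,
      forall a, `|qi x a 0| <= rc M & forall a, `|qj x 0 a| <= rc M].

Lemma qbounded_qtr m (x : qdata C m 1) M : qbounded x M -> qbounded (qtr x) M.
Proof.
by case=> H1 H2 H3 H4; split; rewrite /qtr /qB1 /qB2 /qi /qj /= => *; rewrite mxE.
Qed.

(* Summing the diagonal entries of [mu_C x] over [S], the products of entries
   with both indices in [S] cancel. *)
Lemma cut_entry m (x : qdata C m 1) (tau : C) (M kappa : R) (S : {set 'I_m}) :
  mu_C x = - tau%:M -> qbounded x M -> 0 < kappa ->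
  rc (kappa * M * m.*2.+1%:R) < `|tau| -> S != finset.set0 ->
  (exists a b, [/\ a \in S, b \notin S
     & rc kappa <= `|qB1 x a b| \/ rc kappa <= `|qB2 x a b|]) \/
  (exists2 a, a \in S & rc kappa <= `|qi x a 0|).
Proof.
move=> muE [M1 M2 Mi Mj] k0 ltk /set0Pn[a0 a0S]; apply: contrapT => /not_orP[nB ni].
have kr : rc kappa \is Num.real by exact: rc_real.
have lt1 a b : a \in S -> b \notin S -> `|qB1 x a b| <= rc kappa.
  move=> aS bS; rewrite real_leNgt // ?normr_real //; apply/negP => /ltW H.
  by apply: nB; exists a, b; split=> //; left.
have lt2 a b : a \in S -> b \notin S -> `|qB2 x a b| <= rc kappa.
  move=> aS bS; rewrite real_leNgt // ?normr_real //; apply/negP => /ltW H.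
  by apply: nB; exists a, b; split=> //; right.
have lti a : a \in S -> `|qi x a 0| <= rc kappa.
  move=> aS; rewrite real_leNgt // ?normr_real //; apply/negP => /ltW H.
  by apply: ni; exists a.
have : \sum_(a in S) (mu_C x) a a = - tau *+ #|S|.
  rewrite muE; under eq_bigr do rewrite !mxE eqxx mulr1n.
  by rewrite sumr_const.
pose F a b := qB1 x a b * qB2 x b a - qB2 x a b * qB1 x b a.
have -> : \sum_(a in S) (mu_C x) a a =
    \sum_(a in S) (\sum_(b in ~: S) F a b + qi x a 0 * qj x 0 a).
  have E : \sum_(a in S) \sum_(b in S) F a b = 0.
    under eq_bigr do rewrite sumrB.
    rewrite sumrB [X in _ - X]exchange_big /=.
    under [X in _ - X]eq_bigr do under eq_bigr do rewrite mulrC.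
    by rewrite subrr.
  transitivity (\sum_(a in S) (\sum_b F a b + qi x a 0 * qj x 0 a)).
    apply: eq_bigr => a _; rewrite /mu_C !mxE big_ord_recl big_ord0 addr0.
    by rewrite /F sumrB.
  rewrite !big_split /=; congr (_ + _); rewrite -[RHS]add0r -[X in X + _]E -big_split /=.
  apply: eq_bigr => a _; rewrite (bigID (mem S)) /=; congr (_ + _).
  by apply: eq_bigl => b; rewrite inE.
move=> E; have : `|tau| *+ #|S| <= rc (kappa * M * m.*2.+1%:R) *+ #|S|.
  rewrite -normrN -normrMn -E; apply: le_trans (ler_norm_sum _ _ _) _.
  rewrite -sumr_const; apply: ler_sum => a aS.
  have M0 : 0 <= M by rewrite -rc_ge0; exact: le_trans (normr_ge0 _) (Mi a0).
  (* A diagonal entry contributes two products for each of at most [m] indices outside [S] and one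
     product of [i] with [j]: [2m + 1] products, each with one factor at most [kappa] and the other
     at most [M]. *)
  have -> : kappa * M * m.*2.+1%:R = (kappa * M *+ 2) *+ m + kappa * M.
    by rewrite -mulrnA mul2n -mulrSr mulr_natr.
  rewrite raddfD /=; apply: le_trans (ler_normD _ _) _; apply: lerD; last first.
    rewrite normrM rmorphM; apply: ler_pM => //; exact: lti.
  apply: le_trans (ler_norm_sum _ _ _) _.
  apply: (@le_trans _ _ (\sum_(b in ~: S) rc (kappa * M *+ 2))).
    apply: ler_sum => b; rewrite inE => bS; rewrite /F.
    apply: le_trans (ler_normB _ _) _; rewrite mulr2n raddfD /= !normrM rmorphM.
    by apply: lerD; apply: ler_pM => //; [apply: lt1 | apply: lt2].
  rewrite sumr_const -rmorphMn rc_le; apply: ler_wpMn2l; last first.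
    by rewrite -[X in (_ <= X)%N]card_ord max_card.
  by rewrite mulrn_wge0 // mulr_ge0 // ltW.
rewrite lerMn2r => /orP[/eqP c0|]; last by rewrite (lt_geF ltk).
by move: a0S; rewrite (cards0_eq c0) inE.
Qed.

(** With [D = theta a0 / m], the [m] intervals from [k D] to [(k+1) D] are disjoint. If each
    contained a value of [theta], the values would be used up, including [theta a0 = m D], which
    lies in none of them. *)
Lemma pigeonhole_gap m (theta : 'I_m -> R) a0 : exists k : 'I_m, forall a,
  (k%:R * (theta a0 / m%:R) <= theta a) -> (k.+1%:R * (theta a0 / m%:R) <= theta a).
Proof.
apply: contrapT => /forallNP H.
have {H} H (k : 'I_m) : exists a, (k%:R * (theta a0 / m%:R) <= theta a) /\
    (theta a < k.+1%:R * (theta a0 / m%:R)).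
  have /existsNP[a] := H k; rewrite not_implyE => -[h1 /negP h2].
  by exists a; rewrite ltNge.
have /choice[f fP] := H.
have m0 : (0 < m)%N by apply: leq_ltn_trans (ltn_ord a0).
have D0 : 0 < theta a0 / m%:R.
  have [h1 h2] := fP a0; have := le_lt_trans h1 h2.
  by rewrite -subr_gt0 -mulrBl -natrB // subSnn mul1r.
have fi : injective f.
  move=> k l E; have [h1 h2] := fP k; have [h3 h4] := fP l; rewrite E in h1 h2.
  apply/val_inj/eqP; rewrite eqn_leq.
  have := le_lt_trans h1 h4; have := le_lt_trans h3 h2.
  by rewrite !ltr_pM2r // !ltr_nat !ltnS => -> ->.
have [g fK gK] := injF_bij fi; have := (fP (g a0)).2; rewrite gK.
apply/negP; rewrite -leNgt mulrA ler_pdivrMr ?ltr0n // mulrC ler_pM2l ?ler_nat ?ltn_ord //.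
by have := mulr_gt0 D0 (ltr0Sn R m.-1); rewrite prednK // divfK // pnatr_eq0 -lt0n.
Qed.

(** The indices above the empty interval of [pigeonhole_gap] form a set [S] separated from its
    complement by at least [theta a0 / m]; [cut_entry] finds a sizeable entry leaving [S]. *)
Lemma gap_nonneg m (x : qdata C m 1) (tau : C) (M kappa : R) (theta : 'I_m -> R) a0 :
  mu_C x = - tau%:M -> qbounded x M -> 0 < kappa ->
  rc (kappa * M * m.*2.+1%:R) < `|tau| -> 0 <= theta a0 ->
  (exists a b, theta a0 / m%:R <= theta a - theta b /\
     (rc kappa <= `|qB1 x a b| \/ rc kappa <= `|qB2 x a b|)) \/
  (exists a, theta a0 / m%:R <= theta a /\ rc kappa <= `|qi x a 0|).
Proof.
move=> muE bx k0 ltk th0; have [k kP] := pigeonhole_gap theta a0.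
have m0 : (0 < m)%N by apply: leq_ltn_trans (ltn_ord a0).
have mE : theta a0 = m%:R * (theta a0 / m%:R).
  by rewrite mulrCA divff ?mulr1 // pnatr_eq0 -lt0n.
set D := theta a0 / m%:R in kP mE *.
have D0 : 0 <= D by rewrite divr_ge0.
pose S := [set a | k.+1%:R * D <= theta a].
have S0 : S != finset.set0.
  by apply/set0Pn; exists a0; rewrite inE mE ler_wpM2r // ler_nat.
case: (cut_entry muE bx k0 ltk S0) => [[a [b [aS bS H]]]|[a aS H]]; [left|right].
  exists a, b; split=> //; rewrite !inE in aS bS.
  have : theta b < k%:R * D by rewrite ltNge; apply/negP => /kP h; rewrite h in bS.
  by move: aS; rewrite -natr1 mulrDl mul1r; lra.
exists a; split=> //; rewrite inE in aS; apply: le_trans aS.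
by rewrite ler_peMl // ler1n.
Qed.

(** The diagonal matrix with entries [exp (theta a)] scales the entries of [B], [i] and [j] by the
    exponentials of [theta a - theta b], [theta a] and [- theta a]. So some entry of size at least
    [kappa] grows by a factor of at least [exp (|theta a0| / m)]: a quantitative form of
    stability. *)
Lemma gap m (x : qdata C m 1) (tau : C) (M kappa : R) (theta : 'I_m -> R) a0 :
  mu_C x = - tau%:M -> qbounded x M -> 0 < kappa ->
  rc (kappa * M * m.*2.+1%:R) < `|tau| ->
  [\/ exists a b, `|theta a0| / m%:R <= theta a - theta b /\
        (rc kappa <= `|qB1 x a b| \/ rc kappa <= `|qB2 x a b|),
      exists a, `|theta a0| / m%:R <= theta a /\ rc kappa <= `|qi x a 0|
    | exists a, `|theta a0| / m%:R <= - theta a /\ rc kappa <= `|qj x 0 a|].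
Proof.
move=> muE bx k0 ltk; have [th0|/ltW th0] := leP 0 (theta a0).
  rewrite ger0_norm //.
  by have [] := gap_nonneg muE bx k0 ltk th0; [constructor 1|constructor 2].
rewrite ler0_norm //.
have muE' : mu_C (qtr x) = - tau%:M by rewrite mu_C_qtr muE raddfN /= tr_scalar_mx.
have th0' : 0 <= (fun a => - theta a) a0 by rewrite oppr_ge0.
have [[a [b [h1 h2]]]|[a [h1 h2]]] :=
  gap_nonneg (theta := fun a => - theta a) muE' (qbounded_qtr bx) k0 ltk th0'.
  constructor 1; exists b, a; split; first by move: h1; lra.
  by move: h2; rewrite /qtr /qB1 /qB2 /= !mxE => -[]; [right|left].
by constructor 3; exists a; split=> //; move: h2; rewrite /qtr /qi /= mxE.
Qed.

End Gap.

(** * Unitary matrices and functions of Hermitian matrices *)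

Section Adjoint.
Context {C : numClosedFieldType}.

Lemma adjmxM m n p (A : 'M[C]_(m, n)) (B : 'M[C]_(n, p)) :
  (A *m B)^t* = B^t* *m A^t*.
Proof. by rewrite trmx_mul map_mxM. Qed.

Lemma adjmxK m n (A : 'M[C]_(m, n)) : (A^t*)^t* = A.
Proof. exact: trmxCK. Qed.

Lemma adjmx1 m : (1%:M : 'M[C]_m)^t* = 1%:M.
Proof. by rewrite trmx1 map_mx1. Qed.

Lemma unitarymxE m (u : 'M[C]_m) : u \is unitarymx ->
  [/\ u *m u^t* = 1%:M, u^t* *m u = 1%:M, invmx u = u^t* & u \in unitmx].
Proof.
move=> uu; have uV := invmx_unitary uu; have uU := unitarymx_unit uu.
by split=> //; [rewrite -uV mulmxV | rewrite -uV mulVmx].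
Qed.

Lemma adjmx_unitary m (u : 'M[C]_m) : u \is unitarymx -> u^t* \is unitarymx.
Proof. by rewrite trmxC_unitary. Qed.

Lemma unitarymxI m (u : 'M[C]_m) : u^t* *m u = 1%:M -> u \is unitarymx.
Proof. by move=> h; apply/unitarymxP; apply: mulmx1C. Qed.

Lemma invmx_eq m (A B : 'M[C]_m) : A *m B = 1%:M -> A \in unitmx /\ invmx A = B.
Proof.
move=> h; have [uA _] := mulmx1_unit h; split=> //.
by rewrite -[invmx A]mulmx1 -h mulmxA mulVmx // mul1mx.
Qed.

Lemma unitary_sandwich m n p (u : 'M[C]_m) (A : 'M[C]_(n, m)) (B : 'M[C]_(m, p)) :
  u^t* *m u = 1%:M -> A *m u^t* *m (u *m B) = A *m B.
Proof. by move=> uK; rewrite -mulmxA (mulmxA _ u) uK mul1mx. Qed.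

Lemma mul_unitary_conj m (u A B : 'M[C]_m) : u *m u^t* = 1%:M ->
  (u^t* *m A *m u) *m (u^t* *m B *m u) = u^t* *m (A *m B) *m u.
Proof. by move=> uV; rewrite -!mulmxA (mulmxA u (u^t*)) uV mul1mx. Qed.

Lemma unitary_conjK m (u A : 'M[C]_m) : u *m u^t* = 1%:M ->
  u *m (u^t* *m A *m u) *m u^t* = A.
Proof. by move=> uV; rewrite !mulmxA uV mul1mx -mulmxA uV mulmx1. Qed.

Lemma unitary_conj_inj m (u A B : 'M[C]_m) : u *m u^t* = 1%:M ->
  u^t* *m A *m u = u^t* *m B *m u -> A = B.
Proof. by move=> uV E; rewrite -(unitary_conjK A uV) E unitary_conjK. Qed.

Lemma comm_adj_unitary m (u A : 'M[C]_m) : u^t* *m u = 1%:M ->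
  (u *m A *m u^t*) *m (u *m A *m u^t*)^t* - (u *m A *m u^t*)^t* *m (u *m A *m u^t*)
  = u *m (A *m A^t* - A^t* *m A) *m u^t*.
Proof.
move=> uK; rewrite !adjmxM adjmxK !(unitary_sandwich _ _ uK) mulmxBr mulmxBl.
rewrite !mulmxA -!(mulmxA _ (u^t*) u) uK !mulmx1.
by congr (_ - _); rewrite -!mulmxA.
Qed.

Lemma gram_unitary m w (u : 'M[C]_m) (i : 'M[C]_(m, w)) :
  (u *m i) *m (u *m i)^t* = u *m (i *m i^t*) *m u^t*.
Proof. by rewrite adjmxM !mulmxA. Qed.

Lemma gram_unitary' m w (u : 'M[C]_m) (j : 'M[C]_(w, m)) :
  (j *m u^t*)^t* *m (j *m u^t*) = u *m (j^t* *m j) *m u^t*.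
Proof. by rewrite adjmxM adjmxK !mulmxA. Qed.

Lemma mu_R_unitary m w (u : 'M[C]_m) (x : qdata C m w) : u \is unitarymx ->
  mu_R (gauge u x) = u *m mu_R x *m u^t*.
Proof.
move=> uu; have [_ uK uV _] := unitarymxE uu; case: x => [[[B1 B2] i] j].
rewrite /mu_R /gauge /qB1 /qB2 /qi /qj [LHS]/= uV.
rewrite (comm_adj_unitary B1 uK) (comm_adj_unitary B2 uK) gram_unitary gram_unitary'.
by rewrite /= -!mulmxDl -!mulmxDr -mulmxBl -mulmxBr.
Qed.

Lemma adjmxD m n (A B : 'M[C]_(m, n)) : (A + B)^t* = A^t* + B^t*.
Proof. by rewrite raddfD map_mxD. Qed.

Lemma adjmxN m n (A : 'M[C]_(m, n)) : (- A)^t* = - A^t*.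
Proof. by rewrite raddfN map_mxN. Qed.

Lemma adjmxZ m n (a : C) (A : 'M[C]_(m, n)) : (a *: A)^t* = a^* *: A^t*.
Proof. by rewrite linearZ map_mxZ. Qed.

Lemma mu_R_herm m w (x : qdata C m w) : (mu_R x)^t* = mu_R x.
Proof.
case: x => [[[B1 B2] i] j]; rewrite /mu_R /qB1 /qB2 /qi /qj [LHS]/=.
by rewrite !(adjmxD, adjmxN) !adjmxM !adjmxK.
Qed.

Lemma mu_R_entry m (x : qdata C m 1) a : mu_R x a a =
  \sum_b (qB1 x a b * (qB1 x a b)^* - qB1 x b a * (qB1 x b a)^*)
  + \sum_b (qB2 x a b * (qB2 x a b)^* - qB2 x b a * (qB2 x b a)^*)
  + qi x a 0 * (qi x a 0)^* - qj x 0 a * (qj x 0 a)^*.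
Proof.
case: x => [[[B1 B2] i] j]; rewrite /mu_R /qB1 /qB2 /qi /qj /= !mxE !big_ord1 !mxE.
rewrite -!sumrB [_^* * _]mulrC; congr (_ + _ + _ - _);
  by apply: eq_bigr => b _; rewrite !mxE [_^* * _]mulrC.
Qed.

Lemma mu_R_act2 m w (s : 'M[C]_2) (x : qdata C m w) : s \is unitarymx ->
  mu_R (act2 s x) = mu_R x.
Proof.
move=> /unitarymxE[ss _ _ _]; case: x => [[[B1 B2] i] j].
rewrite /mu_R /act2 /qB1 /qB2 /qi /qj /=; congr (_ + _ - _).
have E k l : s k 0 * (s l 0)^* + s k 1 * (s l 1)^* = (k == l)%:R.
  by have /matrixP/(_ k l) := ss; rewrite !mxE sum_ord2 !mxE.
have := (E 0 0, E 0 1, E 1 0, E 1 1) => /= -[[[E00 E01] E10] E11].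
rewrite !(adjmxD, adjmxZ) !mulmxDl !mulmxDr -!scalemxAl -!scalemxAr !scalerA.
move: E00 E01 E10 E11; set a := s 0 0; set b := s 0 1; set c := s 1 0; set d := s 1 1.
move: (a^*) (b^*) (c^*) (d^*) => a' b' c' d' E00 E01 E10 E11.
move: (B1^t*) (B2^t*) => B1' B2'.
transitivity ((a * a' + b * b') *: (B1 *m B1' - B1' *m B1)
  + (a * c' + b * d') *: (B1 *m B2' - B2' *m B1)
  + (c * a' + d * b') *: (B2 *m B1' - B1' *m B2)
  + (c * c' + d * d') *: (B2 *m B2' - B2' *m B2)).
  by apply/matrixP => k l; rewrite !mxE; ring.
by rewrite E00 E01 E10 E11 !scale0r !scale1r !addr0.
Qed.

Lemma det_act_conj (s e : 'M[C]_2) : \det e = 1 -> \det (invmx e *m s *m e) = \det s.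
Proof. by move=> e1; rewrite !det_mulmx det_inv e1 invr1 mul1r mulr1. Qed.

End Adjoint.

Section Unitary.
Context {R : realType}.
Local Notation C := (cplx R).

Definition fro m n (A : 'M[C]_(m, n)) : R := \sum_a \sum_b sqn (A a b).

Lemma fro_ge0 m n (A : 'M[C]_(m, n)) : 0 <= fro A.
Proof. by apply: sumr_ge0 => a _; apply: sumr_ge0 => b _; apply: sqn_ge0. Qed.

Lemma mxtrace_fro m n (A : 'M[C]_(m, n)) : \tr (A *m A^t*) = rc (fro A).
Proof.
rewrite /mxtrace /fro rmorph_sum; apply: eq_bigr => a _; rewrite mxE rmorph_sum.
by apply: eq_bigr => b _; rewrite !mxE sqnE.
Qed.

Lemma fro_unitaryl m n (u : 'M[C]_m) (A : 'M[C]_(m, n)) : u \is unitarymx ->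
  fro (u *m A) = fro A.
Proof.
move=> /unitarymxE[_ uu _ _]; apply: rc_inj; rewrite -!mxtrace_fro adjmxM.
by rewrite -mulmxA mxtrace_mulC -!mulmxA uu mulmx1.
Qed.

Lemma fro_unitaryr m n (u : 'M[C]_n) (A : 'M[C]_(m, n)) : u \is unitarymx ->
  fro (A *m u) = fro A.
Proof.
move=> /unitarymxE[uu _ _ _]; apply: rc_inj; rewrite -!mxtrace_fro adjmxM.
by rewrite -mulmxA (mulmxA u) uu mul1mx.
Qed.

Lemma unitary_entry m (u : 'M[C]_m) a b : u \is unitarymx -> `|u a b| <= 1.
Proof.
move=> /unitarymxE[uu _ _ _].
have : (u *m u^t*) a a = 1 by rewrite uu mxE eqxx.
rewrite mxE (bigD1 b) //= !mxE sqnE rc_sqn => h.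
rewrite -(ler_pXn2r (n := 2)) ?nnegrE // expr1n -h lerDl.
by apply: sumr_ge0 => c _; rewrite !mxE sqnE rc_ge0 sqn_ge0.
Qed.

Lemma mulmx_bound m n p (A : 'M[C]_(m, n)) (B : 'M[C]_(n, p)) (M N : C) a b :
  (forall a b, `|A a b| <= M) -> (forall a b, `|B a b| <= N) ->
  `|(A *m B) a b| <= M * N *+ n.
Proof.
move=> HA HB; rewrite mxE; apply: le_trans (ler_norm_sum _ _ _) _.
rewrite -[X in _ *+ X]card_ord -sumr_const; apply: ler_sum => c _.
by rewrite normrM ler_pM.
Qed.

Definition qn2 m w (x : qdata C m w) : R :=
  fro (qB1 x) + fro (qB2 x) + fro (qi x) + fro (qj x).

Lemma qn2_unitary m w (u : 'M[C]_m) (x : qdata C m w) : u \is unitarymx ->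
  qn2 (gauge u x) = qn2 x.
Proof.
move=> uu; have [_ _ uV _] := unitarymxE uu; have uu' := adjmx_unitary uu.
case: x => [[[B1 B2] i] j]; rewrite /qn2 /gauge /qB1 /qB2 /qi /qj /= uV.
by rewrite 3?(fro_unitaryr _ uu') !(fro_unitaryl _ uu).
Qed.

Definition rdiag m (l : 'I_m -> R) : 'M[C]_m := diag_mx (\row_a rc (l a)).

Lemma rdiagE m (l : 'I_m -> R) a b : rdiag l a b = rc (l a) *+ (a == b).
Proof. by rewrite !mxE. Qed.

Lemma mul_rdiag m n (l : 'I_m -> R) (A : 'M[C]_(m, n)) a b :
  (rdiag l *m A) a b = rc (l a) * A a b.
Proof. by rewrite mul_diag_mx !mxE. Qed.

Lemma mul_mx_rdiag m n (l : 'I_m -> R) (A : 'M[C]_(n, m)) a b :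
  (A *m rdiag l) a b = A a b * rc (l b).
Proof. by rewrite mul_mx_diag !mxE. Qed.

Lemma rdiagM m (k l : 'I_m -> R) : rdiag k *m rdiag l = rdiag (fun a => k a * l a).
Proof.
by apply/matrixP => a b; rewrite mul_rdiag !rdiagE rmorphM mulrnAr.
Qed.

Lemma rdiag1 m : rdiag (fun=> 1) = 1%:M :> 'M_m.
Proof. by apply/matrixP => a b; rewrite rdiagE mxE. Qed.

Lemma rdiag_adj m (l : 'I_m -> R) : (rdiag l)^t* = rdiag l.
Proof.
apply/matrixP => a b; rewrite [LHS]mxE [(rdiag l)^T _ _]mxE !rdiagE eq_sym.
by case: eqP => [->|_]; rewrite ?mulr1n ?mulr0n ?conjC0 //; apply: rc_conj.
Qed.

Lemma rdiag_inv m (l : 'I_m -> R) : (forall a, l a != 0) ->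
  rdiag l \in unitmx /\ invmx (rdiag l) = rdiag (fun a => (l a)^-1).
Proof.
move=> l0; apply: invmx_eq; rewrite rdiagM -rdiag1; congr rdiag.
by apply: funext => a; rewrite divff.
Qed.

(** Functional calculus: the rows of [u] form an eigenbasis, and applying [f] to the Hermitian
    matrix [hfun u l] gives [hfun u (f \o l)]. *)
Definition hfun m (u : 'M[C]_m) (l : 'I_m -> R) := u^t* *m rdiag l *m u.

Section Hfun.
Context {m : nat} (u : 'M[C]_m) (uu : u \is unitarymx).
Implicit Types k l : 'I_m -> R.

Lemma hfun_adj l : (hfun u l)^t* = hfun u l.
Proof. by rewrite /hfun !adjmxM adjmxK rdiag_adj mulmxA. Qed.

Lemma hfunM k l : hfun u k *m hfun u l = hfun u (fun a => k a * l a).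
Proof. have [uV _ _ _] := unitarymxE uu; rewrite /hfun (mul_unitary_conj _ _ uV) rdiagM; exact: erefl. Qed.

Lemma hfun1 : hfun u (fun=> 1) = 1%:M.
Proof. by have [_ uV _ _] := unitarymxE uu; rewrite /hfun rdiag1 mulmx1. Qed.

Lemma hfunD k l : hfun u k + hfun u l = hfun u (fun a => k a + l a).
Proof.
rewrite /hfun -mulmxDl -mulmxDr; congr (_ *m _ *m _).
by apply/matrixP => a b; rewrite mxE !rdiagE rmorphD mulrnDl.
Qed.

Lemma hfunN l : - hfun u l = hfun u (fun a => - l a).
Proof.
rewrite /hfun -mulNmx -mulmxN; congr (_ *m _ *m _).
by apply/matrixP => a b; rewrite mxE !rdiagE rmorphN mulNrn.
Qed.

Lemma hfun_inv l : (forall a, l a != 0) ->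
  hfun u l \in unitmx /\ invmx (hfun u l) = hfun u (fun a => (l a)^-1).
Proof.
move=> l0; apply: invmx_eq; rewrite hfunM -hfun1; congr hfun.
by apply: funext => a; rewrite divff.
Qed.

(** In the eigenbasis a matrix commuting with [hfun u l] has nonzero entries only between equal
    eigenvalues, hence between equal values of [f]. This keeps square roots inside the commutant. *)
Lemma hfun_comm (X : 'M[C]_m) l (f : R -> R) :
  X *m hfun u l = hfun u l *m X -> X *m hfun u (f \o l) = hfun u (f \o l) *m X.
Proof.
have [uV uK _ _] := unitarymxE uu.
have [Y ->] : exists Y, X = u^t* *m Y *m u.
  exists (u *m X *m u^t*); have := @unitary_conjK _ _ (u^t*) X.
  by rewrite adjmxK => ->.
rewrite /hfun 2!(mul_unitary_conj _ _ uV) => /(unitary_conj_inj uV) h.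
rewrite 2!(mul_unitary_conj _ _ uV).
suff -> : Y *m rdiag (f \o l) = rdiag (f \o l) *m Y by exact: erefl.
apply/matrixP => a b.
move/matrixP/(_ a b): h; rewrite !mul_rdiag !mul_mx_rdiag /= => /eqP.
rewrite mulrC -subr_eq0 -mulrBl mulf_eq0 => /orP[|/eqP ->]; last by rewrite mul0r mulr0.
by rewrite subr_eq0 => /eqP/rc_inj ->; rewrite mulrC.
Qed.

Lemma mxtrace_hfun l (A : 'M[C]_m) :
  \tr (hfun u l *m A) = \sum_a rc (l a) * (u *m A *m u^t*) a a.
Proof.
rewrite /hfun -!mulmxA mxtrace_mulC -!mulmxA /mxtrace.
by apply: eq_bigr => a _; rewrite mul_rdiag !mulmxA.
Qed.

Lemma det_hfun l : \det (hfun u l) = rc (\prod_a l a).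
Proof.
have [uV _ _ _] := unitarymxE uu.
rewrite /hfun !det_mulmx mulrC mulrA -det_mulmx uV det1 mul1r /rdiag det_diag.
by rewrite rmorph_prod; apply: eq_bigr => a _; rewrite mxE.
Qed.

Lemma mxtrace_hfun1 l : \tr (hfun u l) = rc (\sum_a l a).
Proof.
have [uV _ _ _] := unitarymxE uu.
rewrite -[hfun u l]mulmx1 mxtrace_hfun rmorph_sum; apply: eq_bigr => a _.
by rewrite mulmx1 uV mxE eqxx mulr1.
Qed.
End Hfun.

Lemma herm_spectral m (A : 'M[C]_m) : A^t* = A ->
  exists2 u, u \is unitarymx & exists l, A = hfun u l.
Proof.
move=> hA.
have nA : A \is normalmx by apply/normalmxP; rewrite hA.
have := orthomx_spectralP nA; rewrite invmx_unitary ?spectral_unitarymx // => AE.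
have uu := spectral_unitarymx A; set u := spectralmx A in AE uu *.
have [uV _ _ _] := unitarymxE uu.
have DE : u *m A *m u^t* = diag_mx (spectral_diag A).
  by rewrite {1}AE unitary_conjK.
exists u => //; exists (fun a => rp (spectral_diag A 0 a)).
rewrite /hfun {1}AE; congr (_ *m diag_mx _ *m _); apply/rowP => a; rewrite mxE.
apply/esym/rc_rp; apply/CrealP.
have : (u *m A *m u^t*)^t* = u *m A *m u^t* by rewrite !adjmxM adjmxK hA mulmxA.
by rewrite DE => /matrixP/(_ a a); rewrite !mxE eqxx mulr1n.
Qed.

Lemma gram_spectral m (g : 'M[C]_m) : g \in unitmx ->
  exists u l, [/\ u \is unitarymx, forall a, 0 < l a & g^t* *m g = hfun u l].
Proof.
move=> gu; have [u uu [l E]] : exists2 u, u \is unitarymx & exists l, g^t* *m g = hfun u l.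
  by apply: herm_spectral; rewrite adjmxM adjmxK.
exists u, l; split=> // a; have [uV _ _ uU] := unitarymxE uu.
have : (u *m (g^t* *m g) *m u^t*) a a = rc (l a).
  by rewrite E /hfun unitary_conjK // rdiagE eqxx.
have <- : (g *m u^t*)^t* *m (g *m u^t*) = u *m (g^t* *m g) *m u^t*.
  by rewrite adjmxM adjmxK !mulmxA.
have hU : g *m u^t* \in unitmx.
  by rewrite unitmx_mul gu /=; have [_ _ _ ->] := unitarymxE (adjmx_unitary uu).
set h := g *m u^t* in hU *; rewrite mxE => lE.
rewrite -rc_gt0 -lE lt_def; apply/andP; split; last first.
  by apply: sumr_ge0 => b _; rewrite !mxE mulrC sqnE rc_ge0 sqn_ge0.
apply/eqP => h0.
have c0 b : h b a = 0.
  have ge0 k : true -> 0 <= (h^t*) a k * h k a.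
    by rewrite !mxE mulrC sqnE rc_ge0 sqn_ge0.
  have := psumr_eq0P ge0 h0 (i := b) isT.
  by rewrite !mxE mulrC sqnE => /rc_inj/eqP; rewrite sqn_eq0 => /eqP.
have : (invmx h *m h) a a = 0 by rewrite mxE big1 // => b _; rewrite c0 mulr0.
by rewrite mulVmx // mxE eqxx => /eqP; rewrite oner_eq0.
Qed.
End Unitary.

(** * Monotonicity of the real moment map *)

Section Monotone.
Context {R : realType}.
Local Notation C := (cplx R).

(** A bounded increasing substitute for the logarithm: at [exp x] it is [tanh (x/2)]. The quadratic
    lower bound of [cayl_mono] then holds for all positive [s] and [t]; with logarithms it would
    fail as [s / t] tends to 0. *)
Definition cayl (l : R) : R := (l - 1) / (l + 1).

Lemma cayl_mono (s t : R) : 0 < s -> 0 < t ->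
  (cayl s - cayl t) ^+ 2 / 2 <= (s / t - 1) * (cayl s - cayl t).
Proof.
move=> s0 t0; rewrite -subr_ge0 /cayl.
have -> : (s / t - 1) * ((s - 1) / (s + 1) - (t - 1) / (t + 1))
    - ((s - 1) / (s + 1) - (t - 1) / (t + 1)) ^+ 2 / 2
  = 2 * (s - t) ^+ 2 * (s * t + s + 1) / (t * (s + 1) ^+ 2 * (t + 1) ^+ 2).
  by field; rewrite !gt_eqF //; lra.
have st0 := mulr_gt0 s0 t0.
by apply: divr_ge0; do ?[exact: sqr_ge0 | apply: mulr_ge0]; lra.
Qed.

Lemma cayl_monoi (s : R) : 0 < s -> cayl s ^+ 2 / 2 <= (s - 1) * cayl s.
Proof.
move=> s0; have := @cayl_mono s 1 s0 ltr01.
by rewrite {2 4}/cayl subrr mul0r subr0 divr1.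
Qed.

Lemma cayl_monoj (s : R) : 0 < s -> cayl s ^+ 2 / 2 <= (s^-1 - 1) * (- cayl s).
Proof.
move=> s0; have := @cayl_mono 1 s ltr01 s0.
by rewrite {1 3}/cayl subrr mul0r sub0r sqrrN mul1r.
Qed.

Definition mudiag m (x : qdata C m 1) (a : 'I_m) : R :=
  \sum_b (sqn (qB1 x a b) - sqn (qB1 x b a))
  + \sum_b (sqn (qB2 x a b) - sqn (qB2 x b a))
  + sqn (qi x a 0) - sqn (qj x 0 a).

Lemma mu_R_diag m (x : qdata C m 1) a : mu_R x a a = rc (mudiag x a).
Proof.
rewrite mu_R_entry /mudiag !sqnE; under eq_bigr do rewrite !sqnE -rmorphB.
under [X in _ + X + _ - _]eq_bigr do rewrite !sqnE -rmorphB.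
by rewrite -!rmorph_sum -!rmorphD -rmorphB.
Qed.

(** The squared norm of the infinitesimal action of the diagonal matrix [th] on [x]: its commutators
    with [B1], [B2], and its products with [i], [j]. *)
Definition qdev m (x : qdata C m 1) (th : 'I_m -> R) : R :=
  \sum_a \sum_b sqn (qB1 x a b) * (th a - th b) ^+ 2
  + \sum_a \sum_b sqn (qB2 x a b) * (th a - th b) ^+ 2
  + \sum_a sqn (qi x a 0) * th a ^+ 2 + \sum_a sqn (qj x 0 a) * th a ^+ 2.

Lemma sum_antisym m (th : 'I_m -> R) (X : 'I_m -> 'I_m -> R) :
  \sum_a th a * (\sum_b (X a b - X b a)) = \sum_a \sum_b X a b * (th a - th b).
Proof.
under eq_bigr do rewrite sumrB mulrBr !mulr_sumr.
rewrite sumrB [X in _ - X]exchange_big /= -sumrB; apply: eq_bigr => a _.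
by rewrite -sumrB; apply: eq_bigr => b _; ring.
Qed.

Lemma gauge_rdiagE m (x : qdata C m 1) (s : 'I_m -> R) : (forall a, 0 < s a) ->
  let y := gauge (rdiag s) x in
  [/\ forall a b, sqn (qB1 y a b) = sqn (qB1 x a b) * (s a ^+ 2 / s b ^+ 2),
      forall a b, sqn (qB2 y a b) = sqn (qB2 x a b) * (s a ^+ 2 / s b ^+ 2),
      forall a, sqn (qi y a 0) = sqn (qi x a 0) * s a ^+ 2
    & forall a, sqn (qj y 0 a) = sqn (qj x 0 a) / s a ^+ 2].
Proof.
move=> s0; have [_ sV] := @rdiag_inv R m s (fun a => lt0r_neq0 (s0 a)).
rewrite /gauge /qB1 /qB2 /qi /qj /= sV.
split=> [a b|a b|a|a]; rewrite ?mul_mx_rdiag ?mul_rdiag !sqnM !sqn_rc ?exprVn.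
- by rewrite mulrA [_ * sqn _]mulrC.
- by rewrite mulrA [_ * sqn _]mulrC.
- by rewrite mulrC.
- by [].
Qed.

(** Summation by parts ([sum_antisym]) turns the pairing with the change of the moment map into a
    sum over entries, and each term is bounded below by [cayl_mono] or one of its special cases with
    [s] or [t] equal to 1. *)
Lemma mudiag_mono m (x : qdata C m 1) (s : 'I_m -> R) : (forall a, 0 < s a) ->
  qdev x (fun a => cayl (s a ^+ 2)) / 2 <= \sum_a cayl (s a ^+ 2) * (mudiag (gauge (rdiag s) x) a - mudiag x a).
Proof.
move=> s0; pose th a := cayl (s a ^+ 2); rewrite -[X in qdev x X]/th.
have [E1 E2 Ei Ej] := gauge_rdiagE x s0.
have l0 a : 0 < s a ^+ 2 by rewrite exprn_gt0.
have -> : \sum_a cayl (s a ^+ 2) * (mudiag (gauge (rdiag s) x) a - mudiag x a) =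
    \sum_a \sum_b (sqn (qB1 x a b) * (s a ^+ 2 / s b ^+ 2 - 1)) * (th a - th b)
    + \sum_a \sum_b (sqn (qB2 x a b) * (s a ^+ 2 / s b ^+ 2 - 1)) * (th a - th b)
    + \sum_a sqn (qi x a 0) * (s a ^+ 2 - 1) * th a
    + \sum_a sqn (qj x 0 a) * ((s a ^+ 2)^-1 - 1) * (- th a).
  rewrite -!sum_antisym -!big_split /=; apply: eq_bigr => a _; rewrite -/(th a).
  have -> : mudiag (gauge (rdiag s) x) a =
      \sum_b (sqn (qB1 x a b) * (s a ^+ 2 / s b ^+ 2) - sqn (qB1 x b a) * (s b ^+ 2 / s a ^+ 2))
      + \sum_b (sqn (qB2 x a b) * (s a ^+ 2 / s b ^+ 2) - sqn (qB2 x b a) * (s b ^+ 2 / s a ^+ 2))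
      + sqn (qi x a 0) * s a ^+ 2 - sqn (qj x 0 a) / s a ^+ 2.
    rewrite /mudiag Ei Ej; congr (_ + _ + _ - _); apply: eq_bigr => b _.
      by rewrite !E1.
    by rewrite !E2.
  rewrite /mudiag.
  have split4 (X Y : 'I_m -> 'I_m -> R) : \sum_b (X a b * Y a b - X b a * Y b a) =
      \sum_b (X a b * (Y a b - 1) - X b a * (Y b a - 1)) + \sum_b (X a b - X b a).
    by rewrite -big_split; apply: eq_bigr => b _ /=; ring.
  rewrite (split4 (fun a b => sqn (qB1 x a b)) (fun a b => s a ^+ 2 / s b ^+ 2)).
  rewrite (split4 (fun a b => sqn (qB2 x a b)) (fun a b => s a ^+ 2 / s b ^+ 2)).
  ring.
rewrite /qdev !mulrDl; do 3?apply: lerD.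
- rewrite mulr_suml; apply: ler_sum => a _; rewrite mulr_suml; apply: ler_sum => b _.
  by rewrite -[X in X <= _]mulrA -[X in _ <= X]mulrA ler_wpM2l ?sqn_ge0 //; exact: cayl_mono.
- rewrite mulr_suml; apply: ler_sum => a _; rewrite mulr_suml; apply: ler_sum => b _.
  by rewrite -[X in X <= _]mulrA -[X in _ <= X]mulrA ler_wpM2l ?sqn_ge0 //; exact: cayl_mono.
- rewrite mulr_suml; apply: ler_sum => a _.
  by rewrite -[X in X <= _]mulrA -[X in _ <= X]mulrA ler_wpM2l ?sqn_ge0 //; exact: cayl_monoi.
- rewrite mulr_suml; apply: ler_sum => a _.
  by rewrite -[X in X <= _]mulrA -[X in _ <= X]mulrA ler_wpM2l ?sqn_ge0 //; exact: cayl_monoj.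
Qed.

(** Quantitative freeness of the action: one term of the sum, the entry found by [gap], already
    gives the bound. *)
Lemma qdev_lower m (x : qdata C m 1) tau (M kappa : R) (th : 'I_m -> R) a0 :
  mu_C x = - tau%:M -> qbounded x M -> 0 < kappa ->
  rc (kappa * M * m.*2.+1%:R) < `|tau| ->
  kappa ^+ 2 * (`|th a0| / m%:R) ^+ 2 <= qdev x th.
Proof.
move=> muE bx k0 ltk.
have D0 : 0 <= `|th a0| / m%:R by rewrite divr_ge0.
have T (z : C) d : rc kappa <= `|z| -> `|th a0| / m%:R <= d ->
    kappa ^+ 2 * (`|th a0| / m%:R) ^+ 2 <= sqn z * d ^+ 2.
  move=> hz hd; apply: ler_pM; rewrite ?sqr_ge0 //; first exact: sqn_ge (ltW k0) hz.
  by apply: lerXn2r; rewrite ?nnegrE // (le_trans D0).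
have G z d : 0 <= sqn z * d ^+ 2 :> R by rewrite mulr_ge0 ?sqn_ge0 ?sqr_ge0.
have S (F : 'I_m -> 'I_m -> R) a b : (forall a b, 0 <= F a b) ->
    F a b <= \sum_a \sum_b F a b.
  move=> F0; rewrite (bigD1 a) //= (bigD1 b) //= -addrA lerDl addr_ge0 //.
    by apply: sumr_ge0.
  by apply: sumr_ge0 => c _; apply: sumr_ge0.
have S1 (F : 'I_m -> R) a : (forall a, 0 <= F a) -> F a <= \sum_a F a.
  by move=> F0; rewrite (bigD1 a) //= lerDl; apply: sumr_ge0.
have p1 : 0 <= \sum_a \sum_b sqn (qB1 x a b) * (th a - th b) ^+ 2.
  by apply: sumr_ge0 => a _; apply: sumr_ge0.
have p2 : 0 <= \sum_a \sum_b sqn (qB2 x a b) * (th a - th b) ^+ 2.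
  by apply: sumr_ge0 => a _; apply: sumr_ge0.
have p3 : 0 <= \sum_a sqn (qi x a 0) * th a ^+ 2 by apply: sumr_ge0.
have p4 : 0 <= \sum_a sqn (qj x 0 a) * th a ^+ 2 by apply: sumr_ge0.
rewrite /qdev; case: (gap th a0 muE bx k0 ltk) => [[a [b [hd [h|h]]]]|[a [hd h]]|[a [hd h]]].
- have := le_trans (T _ _ h hd)
    (S (fun a b => sqn (qB1 x a b) * (th a - th b) ^+ 2) a b (fun a b => G _ _)); lra.
- have := le_trans (T _ _ h hd)
    (S (fun a b => sqn (qB2 x a b) * (th a - th b) ^+ 2) a b (fun a b => G _ _)); lra.
- have := le_trans (T _ _ h hd)
    (S1 (fun a => sqn (qi x a 0) * th a ^+ 2) a (fun a => G _ _)); lra.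
- have := T _ _ h hd; rewrite sqrrN => h'.
  have := le_trans h' (S1 (fun a => sqn (qj x 0 a) * th a ^+ 2) a (fun a => G _ _)); lra.
Qed.

Lemma nm_le (z : C) (r : R) : (nm z <= r) = (`|z| <= rc r).
Proof. by rewrite -rc_nm rc_le. Qed.

Lemma hfun_small m (u : 'M[C]_m) (l : 'I_m -> R) (r : R) : u \is unitarymx ->
  (forall a, `|l a| <= r) -> forall a b, `|hfun u l a b| <= rc (r *+ m).
Proof.
move=> uu lr a b; rewrite /hfun; apply: le_trans.
  apply: (@mulmx_bound _ _ _ _ _ _ (rc r) 1) => c d; last exact: unitary_entry.
  rewrite mul_mx_rdiag normrM rc_norm -[rc r]mul1r; apply: ler_pM; rewrite ?normr_ge0 ?rc_ge0 //.
    by apply: unitary_entry; exact: adjmx_unitary.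
  by rewrite rc_le.
by rewrite mulr1 -rmorphMn.
Qed.

Lemma mxBE m n (A B : 'M[C]_(m, n)) a b : (A - B) a b = A a b - B a b.
Proof. by rewrite !mxE. Qed.

Lemma natmul3 (t e : R) m : (t * (e *+ m *+ m)) *+ m = t * (e * m%:R ^+ 3).
Proof.
by rewrite -mulrnAr -(mulr_natr e) -(mulr_natr (e * _)) -(mulr_natr (e * _ * _)); ring.
Qed.

(** The exponent 5 arises as 3 + 2. Conjugating a matrix with entries at most [e] by a unitary costs
    [n^2], and summing its diagonal a further [n]; on the other side the gap has width [t / n],
    which enters squared. *)
Lemma quadratic_bound (k t e n : R) : 0 < k -> 0 < n -> 0 <= t -> 0 <= e ->
  k ^+ 2 * (t / n) ^+ 2 / 2 <= t * (e * n ^+ 3) -> t <= 2 * n ^+ 5 / k ^+ 2 * e.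
Proof.
move=> k0 n0 t0 e0 h; have k2 : 0 < k ^+ 2 by rewrite exprn_gt0.
have n2 : 0 < n ^+ 2 by rewrite exprn_gt0.
have [->|tn] := eqVneq t 0.
  by rewrite !mulr_ge0 ?invr_ge0 ?exprn_ge0 // ltW.
have tp : 0 < t by rewrite lt_def tn.
rewrite mulrAC ler_pdivlMr // -(ler_pM2l tp).
have -> : t * (t * k ^+ 2) = k ^+ 2 * (t / n) ^+ 2 / 2 * (2 * n ^+ 2).
  by field; rewrite gt_eqF.
have -> : t * (2 * n ^+ 5 * e) = t * (e * n ^+ 3) * (2 * n ^+ 2) by ring.
by rewrite ler_pM2r // mulr_gt0.
Qed.

(** With [c] the value of [cayl], [|c| <= 1/2] forces [s^2 <= 3]; then [s^2 - 1 = c (s^2 + 1)] is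
    divided by [s + 1 >= 1]. *)
Lemma sqrt_cayl (s : R) : 0 < s -> `|cayl (s ^+ 2)| <= 2^-1 ->
  `|s - 1| <= 4 * `|cayl (s ^+ 2)|.
Proof.
move=> s0; set c := cayl _ => ch.
have s2 : 0 < s ^+ 2 by rewrite exprn_gt0.
have cE : s ^+ 2 - 1 = c * (s ^+ 2 + 1) by rewrite /c /cayl divfK // gt_eqF //; lra.
have s3 : s ^+ 2 <= 3.
  move: ch; rewrite ler_norml => /andP[_]; rewrite /c /cayl ler_pdivrMr; lra.
have : `|s - 1| * (s + 1) = `|c| * (s ^+ 2 + 1).
  rewrite -[X in _ * X = _]ger0_norm; last by lra.
  rewrite -[X in _ = _ * X]ger0_norm; last by lra.
  by rewrite -!normrM -cE; congr `|_|; ring.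
have c0 := normr_ge0 c; have d0 := normr_ge0 (s - 1).
by nra.
Qed.

(* Quantitative uniqueness of the point of a real level set on a complexified
   orbit: this is what makes the inverse of the isomorphism continuous. *)
Lemma hfun_near1 m (x : qdata C m 1) tau (u : 'M[C]_m) (s : 'I_m -> R) (M kappa eps : R) :
  mu_C x = - tau%:M -> u \is unitarymx -> (forall a, 0 < s a) ->
  qbounded (gauge u x) M -> 0 < kappa ->
  rc (kappa * M * m.*2.+1%:R) < `|tau| ->
  (forall a b, `|(mu_R (gauge (hfun u s) x) - mu_R x) a b| <= rc eps) ->
  let K := 2 * m%:R ^+ 5 / kappa ^+ 2 in
  K * eps <= 2^-1 ->
  forall a b, `|(hfun u s - 1%:M) a b| <= rc (4 * K * eps *+ m).
Proof.
move=> muE uu s0 bx k0 ltk dR K Keps a b.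
have [uV uK _ uU] := unitarymxE uu.
have s0' a' : s a' != 0 by rewrite gt_eqF.
have [hU _] := hfun_inv uu s0'; have [dU _] := rdiag_inv s0'.
pose y := gauge u x.
have yE : mu_C y = - tau%:M by rewrite -raddfN; apply: mu_C_gauge_scalar => //; rewrite raddfN.
have gE : gauge (rdiag s) y = gauge u (gauge (hfun u s) x).
  rewrite /y -(gaugeM _ dU uU) -(gaugeM _ uU hU); congr (gauge _ x).
  by rewrite /hfun !mulmxA uV mul1mx.
pose th a := cayl (s a ^+ 2).
(* At the index where [|th|] is largest, the pairing is bounded below quadratically and above
   linearly in [|th a0|]; comparing the two bounds makes [th a0], hence all of [th], of order
   [eps]. *)
case: (@arg_maxP _ _ _ a predT (fun a => `|th a|) isT) => a0 _ a0P.
have lowb := qdev_lower th a0 yE bx k0 ltk.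
have := mudiag_mono y s0; rewrite gE -/th => upb.
have dE c : nm (rc (mudiag (gauge u (gauge (hfun u s) x)) c - mudiag y c))
    <= eps *+ m *+ m.
  rewrite nm_le rmorphB /= -!mu_R_diag 2!(mu_R_unitary _ uu).
  rewrite -(mxBE _ _ c c) -mulmxBl -mulmxBr.
  apply: le_trans; first apply: (@mulmx_bound _ _ _ _ _ _ (rc (eps *+ m)) 1).
  - move=> k l; apply: le_trans.
      by apply: (@mulmx_bound _ _ _ _ _ _ 1 (rc eps)) => // ? ?; exact: unitary_entry.
    by rewrite mul1r -rmorphMn.
  - by move=> k l; apply: unitary_entry; exact: adjmx_unitary.
  by rewrite mulr1 -rmorphMn.
have m0 : (0 < m)%N by apply: leq_ltn_trans (ltn_ord a).
have mR : 0 < m%:R :> R by rewrite ltr0n.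
have th0 := normr_ge0 (th a0).
have upb2 : \sum_c th c * (mudiag (gauge u (gauge (hfun u s) x)) c - mudiag y c)
    <= `|th a0| * (eps * m%:R ^+ 3).
  apply: (@le_trans _ _ (\sum_(c < m) `|th a0| * (eps *+ m *+ m))).
    apply: ler_sum => c _; apply: le_trans (ler_norm _) _; rewrite normrM.
    by apply: ler_pM => //; [exact: a0P | rewrite -nm_rc; exact: dE].
  by rewrite sumr_const card_ord natmul3.
have thb : `|th a0| <= K * eps.
  have h : kappa ^+ 2 * (`|th a0| / m%:R) ^+ 2 / 2 <= `|th a0| * (eps * m%:R ^+ 3).
    by apply: le_trans upb2; apply: le_trans upb; rewrite ler_pM2r // invr_gt0.
  apply: quadratic_bound h => //.
  by rewrite -rc_ge0; exact: le_trans (normr_ge0 _) (dR a a).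
have -> : hfun u s - 1%:M = hfun u (fun a => s a - 1).
  by rewrite -(hfun1 uu) hfunN hfunD.
apply: hfun_small => // c.
have thc : `|th c| <= K * eps by apply: le_trans thb; exact: a0P.
apply: le_trans (sqrt_cayl (s0 c) _) _; first exact: le_trans thc Keps.
by rewrite -mulrA ler_pM2l.
Qed.

End Monotone.

(** * Polar decomposition inside the commutant, and uniqueness up to unitary elements *)

Section Polar.
Context {R : realType}.
Local Notation C := (cplx R).

Lemma sqn_le_fro m n (A : 'M[C]_(m, n)) a b : sqn (A a b) <= fro A.
Proof.
rewrite /fro (bigD1 a) //= (bigD1 b) //= -addrA lerDl addr_ge0 //.
  by apply: sumr_ge0 => c _; exact: sqn_ge0.
by apply: sumr_ge0 => c _; apply: sumr_ge0 => d _; exact: sqn_ge0.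
Qed.

Lemma qn2_ge0 m w (x : qdata C m w) : 0 <= qn2 x.
Proof. by rewrite !addr_ge0 ?fro_ge0. Qed.

Lemma norm_le_sqn (z : C) (q : R) : sqn z <= q -> `|z| <= rc (1 + q).
Proof.
rewrite -nm_le /sqn => h; apply: le_trans (_ : 1 + nm z ^+ 2 <= _); last by rewrite lerD2l.
have := sqr_ge0 (nm z - 2^-1); nra.
Qed.

Lemma qn2_bounded m (x : qdata C m 1) : qbounded x (1 + qn2 x).
Proof.
have h1 := fro_ge0 (qB1 x); have h2 := fro_ge0 (qB2 x).
have h3 := fro_ge0 (qi x); have h4 := fro_ge0 (qj x).
split=> [a b|a b|a|a]; apply: norm_le_sqn; rewrite /qn2.
- by have := sqn_le_fro (qB1 x) a b; lra.
- by have := sqn_le_fro (qB2 x) a b; lra.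
- by have := sqn_le_fro (qi x) a 0; lra.
- by have := sqn_le_fro (qj x) 0 a; lra.
Qed.

(** Half the threshold of [cut_entry] for the entry bound [1 + q], which [qn2_bounded] derives from
    [qn2 x = q] through [|z| <= 1 + |z|^2]. *)
Definition kappa_of m (tau : C) (q : R) : R := nm tau / (2 * (1 + q) * m.*2.+1%:R).

Lemma kappa_of_gt0 m (tau : C) (q : R) : tau != 0 -> 0 <= q -> 0 < kappa_of m tau q.
Proof.
move=> t0 q0; rewrite /kappa_of divr_gt0 //.
  by rewrite -rc_gt0 rc_nm normr_gt0.
by rewrite !mulr_gt0 ?ltr0n //; lra.
Qed.

Lemma kappa_of_lt m (tau : C) (q : R) : tau != 0 -> 0 <= q ->
  rc (kappa_of m tau q * (1 + q) * m.*2.+1%:R) < `|tau|.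
Proof.
move=> t0 q0; rewrite -rc_nm rc_lt.
have tp : 0 < nm tau by rewrite -rc_gt0 rc_nm normr_gt0.
have -> : kappa_of m tau q * (1 + q) * m.*2.+1%:R = nm tau / 2.
  have q1 : 1 + q != 0 by rewrite gt_eqF //; lra.
  have m1 : m.*2.+1%:R != 0 :> R by rewrite pnatr_eq0.
  by rewrite /kappa_of; move: m1 q1; move: (m.*2.+1%:R) => k k1 q1; field; rewrite k1 q1.
lra.
Qed.

(** The commutant of the matrices [rho s]. The predicate [D] stands for membership in the group: the
    Kempf-Ness argument uses only that these matrices are unitary, so that the commutant is closed
    under adjoints. *)
Definition comms (T : Type) (D : T -> Prop) m (rho : T -> 'M[C]_m) (g : 'M[C]_m) :=
  forall s, D s -> g *m rho s = rho s *m g.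

Section Comms.
Context {T : Type} {D : T -> Prop} {m : nat} {rho : T -> 'M[C]_m}.
Hypothesis rhoU : forall s, D s -> rho s \is unitarymx.
Implicit Types g h : 'M[C]_m.

Lemma comms1 : comms D rho 1%:M.
Proof. by move=> s _; rewrite mul1mx mulmx1. Qed.

Lemma commsM g h : comms D rho g -> comms D rho h -> comms D rho (g *m h).
Proof. by move=> cg ch s Ds; rewrite -mulmxA ch // mulmxA cg // mulmxA. Qed.

Lemma commsD g h : comms D rho g -> comms D rho h -> comms D rho (g + h).
Proof. by move=> cg ch s Ds; rewrite mulmxDl mulmxDr cg // ch. Qed.

Lemma commsZ a g : comms D rho g -> comms D rho (a *: g).
Proof. by move=> cg s Ds; rewrite -scalemxAl -scalemxAr cg. Qed.

Lemma commsB g h : comms D rho g -> comms D rho h -> comms D rho (g - h).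
Proof. by move=> cg ch s Ds; rewrite mulmxBl mulmxBr cg // ch. Qed.

Lemma commsV g : g \in unitmx -> comms D rho g -> comms D rho (invmx g).
Proof.
move=> gu cg s Ds; rewrite -[LHS]mulmx1 -(mulmxV gu) !mulmxA -(mulmxA _ (rho s)).
by rewrite -cg // !mulmxA mulVmx // mul1mx.
Qed.

Lemma comms_adj g : comms D rho g -> comms D rho (g^t*).
Proof.
move=> cg s Ds; have [uV uK uI uU] := unitarymxE (rhoU Ds).
have : (rho s)^t* *m g = g *m (rho s)^t*.
  rewrite -[LHS]mulmx1 -uV !mulmxA -(mulmxA _ g) cg // !mulmxA uK mul1mx.
  exact: erefl.
by move/(congr1 (fun A : 'M_m => A^t*)); rewrite !adjmxM adjmxK.
Qed.

(** The product of [g] with its adjoint lies in the commutant, and [hfun_comm] applied to the square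
    root function keeps the positive factor there. *)
Lemma polar g : g \in unitmx -> comms D rho g ->
  exists u s, [/\ u \is unitarymx, forall a, 0 < s a,
    g^t* *m g = hfun u (fun a => s a ^+ 2) & comms D rho (hfun u s)].
Proof.
move=> gu cg; have [u [l [uu l0 gE]]] := gram_spectral gu.
have lE : (fun a => Num.sqrt (l a) ^+ 2) = l by apply: funext => a; rewrite sqr_sqrtr // ltW.
exists u, (fun a => Num.sqrt (l a)); split.
- exact: uu.
- by move=> a; rewrite sqrtr_gt0.
- by rewrite lE.
- have cP : comms D rho (hfun u l).
    by rewrite -gE; apply: commsM => //; exact: comms_adj.
  by move=> s Ds; have /esym/(hfun_comm uu Num.sqrt) -> := cP s Ds.
Qed.

Lemma polar_unitary g u (s : 'I_m -> R) : u \is unitarymx -> (forall a, 0 < s a) ->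
  g^t* *m g = hfun u (fun a => s a ^+ 2) -> g *m invmx (hfun u s) \is unitarymx.
Proof.
move=> uu s0 gE; have s0' a : s a != 0 by rewrite gt_eqF.
have [hU hV] := hfun_inv uu s0'; apply: unitarymxI.
rewrite adjmxM mulmxA -(mulmxA _ _ g) gE hV hfun_adj (hfunM uu) (hfunM uu) -(hfun1 uu).
by congr hfun; apply: funext => a; field.
Qed.

Definition knK (tau : C) (q : R) : R := 2 * m%:R ^+ 5 / kappa_of m tau q ^+ 2.

(** Write [g = w p] with [w] unitary and [p] positive, both in the commutant. As [w] commutes with
    [Z], removing it leaves the moment map at [Z]; the positive factor alone is then controlled by
    [hfun_near1]. *)
Lemma kn_near (x : qdata C m 1) (tau : C) g (Z : 'M[C]_m) (eps : R) : tau != 0 ->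
  mu_C x = - tau%:M -> g \in unitmx -> comms D rho g ->
  (forall h, comms D rho h -> h *m Z = Z *m h) ->
  mu_R (gauge g x) = Z ->
  (forall a b, `|(Z - mu_R x) a b| <= rc eps) ->
  knK tau (qn2 x) * eps <= 2^-1 ->
  exists p w, [/\ p \in unitmx, comms D rho p, g = w *m p, w \is unitarymx & comms D rho w] /\
    mu_R (gauge p x) = Z /\
    forall a b, `|(p - 1%:M) a b| <= rc (4 * knK tau (qn2 x) * eps *+ m).
Proof.
move=> t0 muE gu cg Zc gZ dZ Ke.
have [u [s [uu s0 gE cp]]] := polar gu cg.
have s0' a : s a != 0 by rewrite gt_eqF.
have [pU _] := hfun_inv uu s0'.
have wu := polar_unitary uu s0 gE.
have cw : comms D rho (g *m invmx (hfun u s)) by apply: commsM => //; exact: commsV.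
have gwp : g = g *m invmx (hfun u s) *m hfun u s by rewrite -mulmxA mulVmx // mulmx1.
move: (g *m invmx (hfun u s)) wu cw gwp => w wu cw gwp.
have [wV wK _ wU] := unitarymxE wu.
have pZ : mu_R (gauge (hfun u s) x) = Z.
  have : w *m mu_R (gauge (hfun u s) x) *m w^t* = Z.
    by rewrite -(mu_R_unitary _ wu) -(gaugeM _ wU pU) -gwp.
  move/(congr1 (fun A => w^t* *m A *m w)); rewrite -!mulmxA wK mulmx1 mulmxA wK mul1mx => ->.
  by rewrite -(Zc _ cw) mulmxA wK mul1mx.
exists (hfun u s), w; split; first by split.
split; first exact: pZ.
have q0 := qn2_ge0 (gauge u x).
have bd := qn2_bounded (gauge u x).
have kl := kappa_of_lt m t0 q0; have kp := kappa_of_gt0 m t0 q0.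
rewrite -(qn2_unitary x uu) in Ke *.
by apply: (hfun_near1 muE uu s0 bd kp kl) => // a b; rewrite pZ.
Qed.

(** The case [eps = 0] of [kn_near]: the positive factor is 1, and only the unitary one remains. *)
Lemma kn_unique (x : qdata C m 1) (tau : C) g (Z : 'M[C]_m) : tau != 0 ->
  mu_C x = - tau%:M -> g \in unitmx -> comms D rho g ->
  (forall h, comms D rho h -> h *m Z = Z *m h) ->
  mu_R x = Z -> mu_R (gauge g x) = Z -> g \is unitarymx.
Proof.
move=> t0 muE gu cg Zc xZ gZ.
have [a b||p [w [[_ _ -> wu _] [_ p1]]]] := kn_near (eps := 0) t0 muE gu cg Zc gZ.
- by rewrite xZ subrr mxE normr0 rmorph0.
- by rewrite mulr0 invr_ge0.
suff -> : p = 1%:M by rewrite mulmx1.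
apply/eqP; rewrite -subr_eq0; apply/eqP/matrixP => a b; apply/eqP.
rewrite [X in _ == X]mxE -normr_le0 (le_trans (p1 a b)) // mulr0 mul0rn.
by rewrite rmorph0.
Qed.

End Comms.
End Polar.

(** * First-order expansions *)

Section FirstOrder.
Context {R : realType}.
Implicit Types (f g : R -> R) (a t : R).

(** A derivative at 0 with a quadratic remainder. This form is stable under sums and multiples by
    plain arithmetic and is all that a first-order condition at a minimum requires. *)
Definition slope0 f a := exists c d : R,
  0 < d /\ forall t, `|t| < d -> `|f t - f 0 - a * t| <= c * t ^+ 2.

Lemma slope0_min f a (d : R) : slope0 f a -> 0 < d ->
  (forall t, `|t| < d -> f 0 <= f t) -> a = 0.
Proof.
move=> [c [e [e0 fE]]] d0 fmin; apply/eqP/negPn/negP => a0.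
have na : 0 < `|a| by rewrite normr_gt0.
have c1 : 0 < 1 + `|c| by rewrite ltr_wpDr.
(* At distance [r] the remainder [c r^2] is at most half of [|a| r], so moving against the sign of
   [a] would go below the minimum. *)
pose r := Num.min (Num.min (d / 2) (e / 2)) (`|a| / (2 * (1 + `|c|))).
have r0 : 0 < r by rewrite !lt_min !divr_gt0 // mulr_gt0.
have rd : r < d by apply: le_lt_trans (_ : d / 2 < d); rewrite ?ge_min ?lexx //; lra.
have re : r < e by apply: le_lt_trans (_ : e / 2 < e); rewrite ?ge_min ?lexx ?orbT //; lra.
have ra : r * (2 * (1 + `|c|)) <= `|a|.
  by rewrite -ler_pdivlMr ?mulr_gt0 // /r ge_min lexx orbT.
have [t [tr ta]] : exists t, `|t| = r /\ a * t = - (`|a| * r).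
  have [a1|/ltW a1] := leP 0 a.
    by exists (- r); rewrite normrN gtr0_norm // ger0_norm // mulrN.
  by exists r; rewrite gtr0_norm // ler0_norm // mulNr opprK.
have h1 : f 0 <= f t by apply: fmin; rewrite tr.
have := fE t; rewrite tr => /(_ re); rewrite ler_norml => /andP[_].
rewrite ta -(real_normK (num_real t)) tr => h2.
have h3 : `|a| * r <= c * r ^+ 2 by lra.
have h4 : c * r ^+ 2 <= `|c| * r ^+ 2 by rewrite ler_wpM2r ?sqr_ge0 ?ler_norm.
have h5 : `|a| * r <= `|c| * r * r by rewrite -mulrA -expr2; lra.
rewrite ler_pM2r // in h5; nra.
Qed.

Lemma slope0D f g a b : slope0 f a -> slope0 g b -> slope0 (fun t => f t + g t) (a + b).
Proof.
move=> [c [d [d0 fE]]] [c' [d' [d0' gE]]]; exists (c + c'), (Num.min d d').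
split=> [|t]; rewrite lt_min ?d0 // => /andP[/fE h /gE h'].
have -> : f t + g t - (f 0 + g 0) - (a + b) * t =
  (f t - f 0 - a * t) + (g t - g 0 - b * t) by ring.
by rewrite (le_trans (ler_normD _ _)) // mulrDl lerD.
Qed.

Lemma slope0Z f a k : slope0 f a -> slope0 (fun t => k * f t) (k * a).
Proof.
move=> [c [d [d0 fE]]]; exists (`|k| * c), d; split=> // t /fE h.
by rewrite -mulrA -!mulrBr normrM -mulrA ler_wpM2l.
Qed.

Lemma slope0_eq f g a b : slope0 f a -> f =1 g -> a = b -> slope0 g b.
Proof. by move=> fa /funext <- <-. Qed.

Lemma slope0_cst k : slope0 (fun=> k) 0.
Proof.
by exists 0, 1; split=> // t _; rewrite subrr sub0r mul0r oppr0 normr0 mul0r.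
Qed.

Lemma slope0_sum (I : Type) (r : seq I) (f : I -> R -> R) (a : I -> R) :
  (forall i, slope0 (f i) (a i)) -> slope0 (fun t => \sum_(i <- r) f i t) (\sum_(i <- r) a i).
Proof.
move=> fa; elim: r => [|i r IH].
  by apply: slope0_eq (slope0_cst 0) _ _; [move=> t|]; rewrite big_nil.
by apply: slope0_eq (slope0D (fa i) IH) _ _; [move=> t|]; rewrite big_cons.
Qed.

Lemma small_mul (t a : R) : `|t| < (2 * (1 + `|a|))^-1 -> `|t * a| <= 2^-1.
Proof.
have a1 : 0 < 1 + `|a| by rewrite ltr_wpDr.
move=> /ltW h; rewrite normrM; apply: (@le_trans _ _ (`|t| * (1 + `|a|))).
  by rewrite ler_wpM2l // lerDr.
by rewrite -ler_pdivlMr // -invfM.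
Qed.

Lemma slope0_ratio (a b : R) :
  slope0 (fun t => (1 + t * a) ^+ 2 / (1 + t * b) ^+ 2) (2 * (a - b)).
Proof.
pose c0 : R := `|a ^+ 2 - b ^+ 2 - 4 * b * (a - b)| + `|2 * b ^+ 2 * (a - b)|.
exists (4 * c0), (Num.min 1 (2 * (1 + `|b|))^-1); split.
  by rewrite lt_min ltr01 invr_gt0 mulr_gt0 // ltr_wpDr.
move=> t; rewrite lt_min => /andP[/ltW t1 /small_mul tb].
have tb' : 2^-1 <= 1 + t * b by move: tb; rewrite ler_norml; lra.
have tp : 0 < 1 + t * b by lra.
have t2 : 4^-1 <= (1 + t * b) ^+ 2 by nra.
have t3 : 0 < (1 + t * b) ^+ 2 by rewrite exprn_gt0.
rewrite !mul0r !addr0 !expr1n divr1.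
have -> : (1 + t * a) ^+ 2 / (1 + t * b) ^+ 2 - 1 - 2 * (a - b) * t =
    (a ^+ 2 - b ^+ 2 - 4 * b * (a - b) - t * (2 * b ^+ 2 * (a - b))) * t ^+ 2
     / (1 + t * b) ^+ 2 by field; rewrite gt_eqF.
rewrite normrM normfV (gtr0_norm t3) normrM (ger0_norm (sqr_ge0 t)).
rewrite ler_pdivrMr //.
have c1 : `|a ^+ 2 - b ^+ 2 - 4 * b * (a - b) - t * (2 * b ^+ 2 * (a - b))| <= c0.
  apply: le_trans (ler_normB _ _) _; rewrite lerD2l normrM.
  by rewrite -[X in _ <= X]mul1r ler_wpM2r.
have c2 : 0 <= c0 by rewrite addr_ge0.
have q0 := sqr_ge0 t.
apply: (@le_trans _ _ (c0 * t ^+ 2)); first by rewrite ler_wpM2r.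
have -> : 4 * c0 * t ^+ 2 * (1 + t * b) ^+ 2 = c0 * t ^+ 2 * (4 * (1 + t * b) ^+ 2) by ring.
have q1 : 0 <= c0 * t ^+ 2 by rewrite mulr_ge0.
by apply: ler_peMr => //; lra.
Qed.

(** Both bounds come from [ln (1 + y) <= y]: applied to [1 + t a] it bounds the logarithm above,
    applied to the inverse it bounds it below. *)
Lemma slope0_ln (a : R) : slope0 (fun t => ln ((1 + t * a) ^+ 2)) (2 * a).
Proof.
exists (4 * a ^+ 2), (2 * (1 + `|a|))^-1; split.
  by rewrite invr_gt0 mulr_gt0 // ltr_wpDr.
move=> t /small_mul; rewrite ler_norml => /andP[h1 h2].
have tp : 0 < 1 + t * a by lra.
have -> : ln ((1 + t * a) ^+ 2) = 2 * ln (1 + t * a) by rewrite lnXn // mulr_natl.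
rewrite mul0r addr0 expr1n ln1 subr0.
have u1 : ln (1 + t * a) <= t * a by apply: le_ln1Dx; lra.
have u2 : - ln (1 + t * a) <= (1 + t * a)^-1 - 1.
  rewrite -lnV //; have := @le_ln1Dx R ((1 + t * a)^-1 - 1).
  by rewrite (addrC 1 (_ - 1)) subrK; apply; rewrite ltrBrDl subrr invr_gt0.
have u3 : (1 + t * a)^-1 - 1 = - (t * a) + (t * a) ^+ 2 / (1 + t * a).
  by field; rewrite gt_eqF.
have u4 : (t * a) ^+ 2 / (1 + t * a) <= 2 * (t * a) ^+ 2.
  by rewrite ler_pdivrMr //; have := sqr_ge0 (t * a); nra.
have u5 := sqr_ge0 (t * a).
have -> : 4 * a ^+ 2 * t ^+ 2 = 4 * (t * a) ^+ 2 by ring.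
by rewrite ler_norml; apply/andP; split; lra.
Qed.

End FirstOrder.

(** * The linearised complex moment map *)

Section Bilinear.
Context {C : numClosedFieldType} {m : nat}.
Local Notation E := (qdata C m 1).
Implicit Types (x v : E) (a : 'M[C]_m).

Lemma mxentD n p (A B : 'M[C]_(n, p)) i j : (A + B) i j = A i j + B i j.
Proof. by rewrite mxE. Qed.

Lemma mxentN n p (A : 'M[C]_(n, p)) i j : (- A) i j = - A i j.
Proof. by rewrite mxE. Qed.

Lemma mxentZ n p c (A : 'M[C]_(n, p)) i j : (c *: A) i j = c * A i j.
Proof. by rewrite mxE. Qed.

Definition mxent := (mxentD, mxentN, mxentZ).

(** The polarisation of the quadratic map [mu_C], that is, its differential at [x] in the direction
    [v]. *)
Definition bil x v : 'M[C]_m :=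
  qB1 x *m qB2 v - qB2 v *m qB1 x + (qB1 v *m qB2 x - qB2 x *m qB1 v)
  + qi x *m qj v + qi v *m qj x.

Lemma bilE x v : bil x v = mu_C (x + v) - mu_C x - mu_C v.
Proof.
case: x v => [[[B1 B2] i] j] [[[D1 D2] k] l]; rewrite /bil /mu_C /qB1 /qB2 /qi /qj /=.
rewrite !(mulmxDl, mulmxDr).
by apply/matrixP => c d; rewrite !mxent; ring.
Qed.

Lemma bil_linear x : linear (bil x).
Proof.
move=> c; case: x => [[[B1 B2] i] j] [[[D1 D2] k] l] [[[F1 F2] p] q].
rewrite /bil /qB1 /qB2 /qi /qj /= !(mulmxDl, mulmxDr) -!(scalemxAl, scalemxAr).
by apply/matrixP => r s; rewrite !mxent; ring.
Qed.

HB.instance Definition _ x := GRing.isLinear.Build C E 'M[C]_m _ (bil x) (bil_linear x).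

Lemma bilC x v : bil x v = bil v x.
Proof. by rewrite !bilE addrC [x + v]addrC addrA [- _ + _]addrC addrAC. Qed.

(** The exact difference formula of a quadratic map, with the differential taken at the midpoint; it
    replaces Taylor expansions in the Newton estimates. *)
Lemma mu_C_diff x v : bil (x + v) (x - v) = 2 *: (mu_C x - mu_C v).
Proof.
case: x v => [[[B1 B2] i] j] [[[D1 D2] k] l]; rewrite /bil /mu_C /qB1 /qB2 /qi /qj /=.
rewrite !(mulmxDl, mulmxDr) !(mulmxN, mulNmx).
by apply/matrixP => c d; rewrite !mxent; ring.
Qed.

(** The adjoint of [bil x] for the Hermitian trace forms. By [trace_adj_bil] the composite
    [bil x \o adj_bil x] is positive, with the kernel of [adj_bil x] as its kernel. *)
Definition adj_bil x a : E :=
  (a *m (qB2 x)^t* - (qB2 x)^t* *m a, (qB1 x)^t* *m a - a *m (qB1 x)^t*,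
   a *m (qj x)^t*, (qi x)^t* *m a).

Lemma adj_bil_linear x : linear (adj_bil x).
Proof.
move=> c a b; apply: qdataP; rewrite /adj_bil /qB1 /qB2 /qi /qj /=;
  rewrite !(mulmxDl, mulmxDr) -!(scalemxAl, scalemxAr) //.
- by rewrite scalerBr opprD addrACA.
- by rewrite scalerBr opprD addrACA.
Qed.

HB.instance Definition _ x :=
  GRing.isLinear.Build C 'M[C]_m E _ (adj_bil x) (adj_bil_linear x).

Lemma trace_adj_bil x a : \tr (a^t* *m bil x (adj_bil x a)) =
  \tr (qB1 (adj_bil x a) *m (qB1 (adj_bil x a))^t*)
  + \tr (qB2 (adj_bil x a) *m (qB2 (adj_bil x a))^t*)
  + \tr (qi (adj_bil x a) *m (qi (adj_bil x a))^t*)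
  + \tr (qj (adj_bil x a) *m (qj (adj_bil x a))^t*).
Proof.
case: x => [[[B1 B2] i] j]; rewrite /bil /adj_bil /qB1 /qB2 /qi /qj /=.
set P := a *m _ - _; set S := _ - a *m B1^t*; set U := a *m j^t*; set V := i^t* *m a.
have PE : P^t* = B2 *m a^t* - a^t* *m B2 by rewrite adjmxD adjmxN !adjmxM !adjmxK.
have SE : S^t* = a^t* *m B1 - B1 *m a^t* by rewrite adjmxD adjmxN !adjmxM !adjmxK.
have UE : U^t* = j *m a^t* by rewrite adjmxM adjmxK.
have VE : V^t* = a^t* *m i by rewrite adjmxM adjmxK.
rewrite PE SE UE VE; move: (a^t*) => b; clearbody P S U V.
rewrite !(mulmxDr, mulmxDl, mulmxN, mulNmx) !mxtraceD !raddfN /= !mulmxA.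
have -> : \tr (b *m P *m B2) = \tr (P *m B2 *m b) by rewrite -mulmxA mxtrace_mulC.
have -> : \tr (b *m B2 *m P) = \tr (P *m b *m B2) by rewrite mxtrace_mulC mulmxA.
have -> : \tr (b *m B1 *m S) = \tr (S *m b *m B1) by rewrite mxtrace_mulC mulmxA.
have -> : \tr (b *m S *m B1) = \tr (S *m B1 *m b) by rewrite -mulmxA mxtrace_mulC.
have -> : \tr (b *m U *m j) = \tr (U *m j *m b) by rewrite -mulmxA mxtrace_mulC.
have -> : \tr (b *m i *m V) = \tr (V *m b *m i) by rewrite mxtrace_mulC mulmxA.
ring.
Qed.

Lemma inj_linear_inv (f : {linear 'M[C]_m -> 'M[C]_m}) :
  (forall a, f a = 0 -> a = 0) -> exists g : {linear 'M[C]_m -> 'M[C]_m}, forall a, f (g a) = a.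
Proof.
move=> fi; have fu : lin_mx f \in unitmx.
  rewrite -row_free_unit -kermx_eq0; apply/eqP/row_matrixP => i; rewrite row0.
  have : row i (kermx (lin_mx f)) *m lin_mx f = 0.
    by apply/eqP; rewrite -sub_kermx row_sub.
  rewrite mul_rV_lin => /(congr1 vec_mx); rewrite mxvecK linear0 => /fi.
  by move/(congr1 mxvec); rewrite vec_mxK linear0.
exists (vec_mx \o (mulmxr (invmx (lin_mx f)) \o mxvec)) => a /=.
apply: (can_inj mxvecK).
by rewrite -mul_vec_lin vec_mxK mulmxKV.
Qed.

(* A matrix orthogonal to the image of [bil x] commutes with [B] and kills
   [i], [j], so it vanishes on a level set of [mu_C]. *)
Lemma bil_inv tau x : tau != 0 -> mu_C x = - tau%:M ->
  exists g : {linear 'M[C]_m -> 'M[C]_m}, forall a, bil x (adj_bil x (g a)) = a.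
Proof.
move=> t0 lx; have h0 n p (A : 'M[C]_(n, p)) : 0 <= \tr (A *m A^t*).
  rewrite /mxtrace sumr_ge0 // => a _; rewrite mxE sumr_ge0 // => b _.
  by rewrite [X in _ * X]mxE mxE -normCK exprn_ge0.
have h1 n p (A : 'M[C]_(n, p)) : \tr (A *m A^t*) = 0 -> A = 0.
  move/eqP; rewrite /mxtrace psumr_eq0; last first.
    by move=> a _; rewrite mxE sumr_ge0 // => b _; rewrite [X in _ * X]mxE mxE -normCK exprn_ge0.
  move=> /allP hA; apply/matrixP => a b; move: (hA a); rewrite mem_index_enum => /(_ isT) /=.
  rewrite mxE psumr_eq0; last by move=> c _; rewrite [X in _ * X]mxE mxE -normCK exprn_ge0.
  move/allP/(_ b); rewrite mem_index_enum => /(_ isT) /=.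
  by rewrite [X in _ * X]mxE mxE -normCK sqrf_eq0 normr_eq0 mxE => /eqP.
have ker a : bil x (adj_bil x a) = 0 -> a = 0.
  move=> /(congr1 (fun b => \tr (a^t* *m b))); rewrite trace_adj_bil mulmx0 mxtrace0.
  set y := adj_bil x a => /eqP.
  rewrite paddr_eq0; [|by rewrite !addr_ge0|exact: h0].
  rewrite paddr_eq0; [|by rewrite addr_ge0|exact: h0].
  rewrite paddr_eq0; [|exact: h0|exact: h0].
  case/andP => /andP[/andP[/eqP/h1 E1 /eqP/h1 E2] /eqP/h1 E3] /eqP/h1 E4.
  have aE : a = (a^t*)^t* by rewrite adjmxK.
  move: E1 E2 E3 E4; rewrite /y /adj_bil /qB1 /qB2 /qi /qj /= => E1 E2 E3 E4.
  have ai n p (A B : 'M[C]_(n, p)) : A^t* = B^t* -> A = B.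
    by move=> /(congr1 (fun M => M^t*)); rewrite !adjmxK.
  have F1 : a^t* *m x.1.1.1 = x.1.1.1 *m a^t*.
    apply: ai; rewrite !adjmxM adjmxK.
    exact: (subr0_eq E2).
  have F2 : a^t* *m x.1.1.2 = x.1.1.2 *m a^t*.
    apply: ai; rewrite !adjmxM adjmxK.
    exact: (esym (subr0_eq E1)).
  have F4 : a^t* *m x.1.2 = 0.
    by apply: ai; rewrite adjmxM adjmxK E4; apply/matrixP => r s; rewrite !mxE conjC0.
  have fr : free_at x := level_free t0 lx.
  rewrite aE; suff -> : a^t* = 0 by apply/matrixP => r s; rewrite !mxE conjC0.
  exact: fr F1 F2 F4.
have [g gP] := @inj_linear_inv (bil x \o adj_bil x) ker.
by exists g => a; exact: gP.
Qed.
End Bilinear.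

(** * Averaging over the group *)

Section Average.
Context {C : numFieldType} {gT : finGroupType} {G : {group gT}} {V : lmodType C}.
Variable T : gT -> V -> V.
Hypothesis T_lin : forall s, linear (T s).
Hypothesis TM : forall s t x, s \in G -> t \in G -> T (s * t)%g x = T s (T t x).

Definition avg x : V := #|G|%:R^-1 *: \sum_(s in G) T s x.

Lemma avg_linear : linear avg.
Proof.
move=> a x y; rewrite /avg (eq_bigr (fun s => a *: T s x + T s y)); last by move=> s _; rewrite T_lin.
by rewrite big_split /= -scaler_sumr scalerDr !scalerA mulrC.
Qed.

Lemma avg_act t x : t \in G -> T t (avg x) = avg x.
Proof.
move=> tG; pose f := GRing.isLinear.Build C V V _ (T t) (T_lin t).
pose F : {linear V -> V} := HB.pack (T t) f.
have -> : T t (avg x) = F (avg x) by [].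
rewrite /avg linearZ raddf_sum /=; congr (_ *: _).
rewrite [RHS](reindex_inj (mulgI t)) /=; apply: eq_big => s; first by rewrite groupMl.
by move=> sG; rewrite TM.
Qed.

Lemma avg_id x : (forall s, s \in G -> T s x = x) -> avg x = x.
Proof.
move=> h; rewrite /avg (eq_bigr (fun=> x)) // sumr_const.
by rewrite -scaler_nat scalerA mulVf ?scale1r // pnatr_eq0 -lt0n cardG_gt0.
Qed.
End Average.

Section GroupAction.
Context {R : realType}.
Local Notation C := (cplx R).
Context {gT : finGroupType} {G : {group gT}} {m : nat}.
Local Notation E := (qdata C m 1).
Variables (rho : gT -> 'M[C]_m) (sg : gT -> 'M[C]_2).
Hypothesis rhoM : forall s t, s \in G -> t \in G -> rho (s * t)%g = rho s *m rho t.
Hypothesis rho1 : rho 1%g = 1%:M.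
Hypothesis sgM : forall s t, s \in G -> t \in G -> sg (s * t)%g = sg s *m sg t.
Hypothesis sg1 : sg 1%g = 1%:M.
Hypothesis sgdet : forall s, s \in G -> \det (sg s) = 1.
Local Notation comm := (comms (fun s => s \in G) rho).

Lemma rhoV s : s \in G -> rho s *m rho s^-1%g = 1%:M.
Proof. by move=> sG; rewrite -rhoM ?groupV // mulgV. Qed.

Lemma rho_unit s : s \in G -> rho s \in unitmx.
Proof. by move=> sG; have [] := invmx_eq (rhoV sG). Qed.

Lemma sgV s : s \in G -> sg s^-1%g *m sg s = 1%:M.
Proof. by move=> sG; rewrite -sgM ?groupV // mulVg. Qed.

Definition fixd (x : E) := forall s, s \in G -> gauge (rho s) x = act2 (sg s) x.

(** A linear left action whose invariants are the points satisfying [fixd]; the inverse compensates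
    for [act2] being a right action. *)
Definition Tact (s : gT) (x : E) : E := gauge (rho s) (act2 (sg s^-1%g) x).

Definition Mact (s : gT) (a : 'M[C]_m) : 'M[C]_m := rho s *m a *m invmx (rho s).

Lemma gauge_linear (g : 'M[C]_m) : linear (gauge g : E -> E).
Proof.
move=> a x y; apply: qdataP; rewrite /gauge /qB1 /qB2 /qi /qj /=;
  by rewrite !(mulmxDr, mulmxDl) -!(scalemxAl, scalemxAr).
Qed.

Lemma act2_linear s : linear (act2 s : E -> E).
Proof.
move=> a x y; apply: qdataP; rewrite /act2 /qB1 /qB2 /qi /qj //=.
  by rewrite !scalerDr !scalerA ![_ * a]mulrC addrACA.
by rewrite !scalerDr !scalerA ![_ * a]mulrC addrACA.
Qed.

Lemma Tact_linear s : linear (Tact s).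
Proof. by move=> a x y; rewrite /Tact act2_linear gauge_linear. Qed.

Lemma Mact_linear s : linear (Mact s).
Proof. by move=> a x y; rewrite /Mact mulmxDr mulmxDl -scalemxAr -scalemxAl. Qed.

Lemma TactM s t x : s \in G -> t \in G -> Tact (s * t)%g x = Tact s (Tact t x).
Proof.
move=> sG tG; have [sV tV] : (s^-1%g \in G) /\ (t^-1%g \in G) by rewrite !groupV.
rewrite /Tact [(_ * _)^-1%g]invgM (sgM tV sV) -act2M (rhoM sG tG).
rewrite (gaugeM _ (rho_unit sG) (rho_unit tG)); congr (gauge _ _).
exact: gauge_act2.
Qed.

Definition avgE := avg (G := G) Tact.
Definition avgM := avg (G := G) Mact.

HB.instance Definition _ := GRing.isLinear.Build C E E _ avgE (avg_linear Tact_linear).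
HB.instance Definition _ :=
  GRing.isLinear.Build C 'M[C]_m 'M[C]_m _ avgM (avg_linear Mact_linear).

Lemma fixdP x : fixd x <-> forall s, s \in G -> Tact s x = x.
Proof.
split=> h s sG.
  have sV : s^-1%g \in G by rewrite groupV.
  by rewrite /Tact gauge_act2 (h s sG) act2M -(sgM sG sV) mulgV sg1 act21.
by rewrite -[X in act2 _ X](h s sG) /Tact -gauge_act2 act2M (sgV sG) act21.
Qed.

Lemma avgE_fixd x : fixd (avgE x).
Proof. by apply/fixdP => s sG; exact: (avg_act Tact_linear TactM). Qed.

Lemma avgE_id x : fixd x -> avgE x = x.
Proof. by move/fixdP => h; exact: (avg_id (G := G) (T := Tact) h). Qed.

Lemma Mact_comm s a : s \in G -> comm a -> Mact s a = a.
Proof. by move=> sG ha; rewrite /Mact -(ha s sG) -mulmxA (mulmxV (rho_unit sG)) mulmx1. Qed.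

Lemma comm_Mact a : (forall s, s \in G -> Mact s a = a) -> comm a.
Proof.
by move=> h s sG; rewrite -{1}(h s sG) /Mact -!mulmxA (mulVmx (rho_unit sG)) mulmx1.
Qed.

Lemma avgM_id a : comm a -> avgM a = a.
Proof. by move=> h; apply: (avg_id (G := G) (T := Mact)) => s sG; exact: Mact_comm. Qed.

Lemma mu_C_Tact s x : s \in G -> mu_C (Tact s x) = Mact s (mu_C x).
Proof. move=> sG; have sV : s^-1%g \in G by rewrite groupV.
by rewrite /Tact (mu_C_gauge _ (rho_unit sG)) (mu_C_act2 _ (sgdet sV)). Qed.

Lemma bil_Tact s x v : s \in G -> bil (Tact s x) (Tact s v) = Mact s (bil x v).
Proof.
move=> sG; rewrite !bilE.
have TD : Tact s x + Tact s v = Tact s (x + v).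
  by rewrite -[x]scale1r Tact_linear !scale1r.
have MD a b : Mact s (a - b) = Mact s a - Mact s b.
  by rewrite -[a - b]addrC -scaleN1r Mact_linear scaleN1r addrC.
by rewrite TD !(mu_C_Tact _ sG) !MD.
Qed.

Lemma fixd_mu_C x : fixd x -> comm (mu_C x).
Proof. by move/fixdP=> h; apply: comm_Mact => s sG; rewrite -(mu_C_Tact _ sG) (h s sG). Qed.

(** At a fixed point the differential of [mu_C] is equivariant. Hence its right inverse can be
    averaged into one with values in the fixed subspace. *)
Lemma bil_avgE x v : fixd x -> bil x (avgE v) = avgM (bil x v).
Proof.
move/fixdP=> h; rewrite /avgE /avgM /avg linearZ raddf_sum /=; congr (_ *: _).
by apply: eq_bigr => s sG; rewrite -{1}(h s sG) (bil_Tact _ _ sG).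
Qed.

Lemma fixd_gauge g x : g \in unitmx -> comm g -> fixd x -> fixd (gauge g x).
Proof.
move=> gu hg h s sG; rewrite -(gaugeM _ (rho_unit sG) gu) -(hg s sG).
by rewrite (gaugeM x gu (rho_unit sG)) (h s sG) gauge_act2.
Qed.

Lemma fixdD x y : fixd x -> fixd y -> fixd (x + y).
Proof.
move=> /fixdP hx /fixdP hy; apply/fixdP => s sG.
by rewrite -{1}[x]scale1r Tact_linear scale1r (hx s sG) (hy s sG).
Qed.

Lemma fixd_mu_R x : (forall s, s \in G -> rho s \is unitarymx) ->
  (forall s, s \in G -> sg s \is unitarymx) -> fixd x -> comm (mu_R x).
Proof.
move=> rU sU h s sG; have [_ u1 iE uu] := unitarymxE (rU s sG).
have : mu_R (gauge (rho s) x) = mu_R x by rewrite (h s sG) (mu_R_act2 _ (sU s sG)).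
rewrite (mu_R_unitary _ (rU s sG)) => E.
by rewrite -{1}E -!mulmxA u1 mulmx1.
Qed.
End GroupAction.

Import numFieldNormedType.Exports.
Local Open Scope classical_set_scope.

(** * Differentiability and compactness *)

Section Differentiability.
Context {C : numFieldType} {V : normedModType C}.
Implicit Types x : V.

Lemma diff_entry m n (f : V -> 'M[C]_(m, n)) x i j :
  differentiable f x -> differentiable (fun v => f v i j) x.
Proof.
move=> df; apply: (@differentiable_comp _ _ _ _ f (fun A : 'M[C]_(m, n) => A i j)) => //.
exact: differentiable_coord.
Qed.

Lemma diff_sum (W : normedModType C) (I : Type) (r : seq I) (P : pred I) (f : I -> V -> W) x :
  (forall i, differentiable (f i) x) -> differentiable (fun v => \sum_(i <- r | P i) f i v) x.
Proof.
move=> df; elim: r => [|i r IH].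
  rewrite (_ : (fun _ => _) = cst 0); first exact: differentiable_cst.
  by apply: funext => v; rewrite big_nil.
have [Pi|Pi] := boolP (P i).
  rewrite (_ : (fun _ => _) = f i + (fun v => \sum_(j <- r | P j) f j v)).
    exact: differentiableD.
  by apply: funext => v; rewrite big_cons Pi.
rewrite (_ : (fun _ => _) = (fun v => \sum_(j <- r | P j) f j v)) //.
by apply: funext => v; rewrite big_cons (negPf Pi).
Qed.

Lemma diff_mul (f g : V -> C) x :
  differentiable f x -> differentiable g x -> differentiable (fun v => f v * g v) x.
Proof. exact: differentiableM. Qed.

Lemma diff_prod (I : Type) (r : seq I) (P : pred I) (f : I -> V -> C) x :
  (forall i, differentiable (f i) x) -> differentiable (fun v => \prod_(i <- r | P i) f i v) x.
Proof.
move=> df; elim: r => [|i r IH].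
  rewrite (_ : (fun _ => _) = cst 1); first exact: differentiable_cst.
  by apply: funext => v; rewrite big_nil.
have [Pi|Pi] := boolP (P i).
  rewrite (_ : (fun _ => _) = (fun v => f i v * \prod_(j <- r | P j) f j v)).
    exact: diff_mul.
  by apply: funext => v; rewrite big_cons Pi.
rewrite (_ : (fun _ => _) = (fun v => \prod_(j <- r | P j) f j v)) //.
by apply: funext => v; rewrite big_cons (negPf Pi).
Qed.

Lemma diff_scale (W : normedModType C) (f : V -> C) (w : W) x :
  differentiable f x -> differentiable (fun v => f v *: w) x.
Proof. exact: differentiableZl. Qed.

Lemma diff_mx m n (f : V -> 'M[C]_(m, n)) x :
  (forall i j, differentiable (fun v => f v i j) x) -> differentiable f x.
Proof.
move=> df; rewrite (_ : f = (fun v => \sum_i \sum_j f v i j *: delta_mx i j)).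
  by apply: diff_sum => i; apply: diff_sum => j; apply: diff_scale.
by apply: funext => v; rewrite -matrix_sum_delta.
Qed.

Lemma diff_mulmx m n p (f : V -> 'M[C]_(m, n)) (g : V -> 'M[C]_(n, p)) x :
  differentiable f x -> differentiable g x -> differentiable (fun v => f v *m g v) x.
Proof.
move=> df dg; apply: diff_mx => i j.
rewrite (_ : (fun _ => _) = (fun v => \sum_k f v i k * g v k j)).
  by apply: diff_sum => k; apply: diff_mul; apply: diff_entry.
by apply: funext => v; rewrite mxE.
Qed.

Lemma diff_det m (f : V -> 'M[C]_m) x :
  differentiable f x -> differentiable (fun v => \det (f v)) x.
Proof.
move=> df; apply: diff_sum => s; apply: diff_mul; first exact: differentiable_cst.
by apply: diff_prod => i; exact: diff_entry.
Qed.

Lemma diff_inv (f : V -> C) x : f x != 0 ->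
  differentiable f x -> differentiable (fun v => (f v)^-1) x.
Proof. by move=> f0 df; apply: differentiableV. Qed.

End Differentiability.

Section DiffInv.
Context {C : numFieldType} {V : normedModType C}.

Lemma diff_adjugate m (f : V -> 'M[C]_m) (x : V) :
  differentiable f x -> differentiable (fun v => \adj (f v)) x.
Proof.
move=> df; apply: diff_mx => i j.
rewrite (_ : (fun _ => _) = (fun v => (-1) ^+ (j + i) * \det (row' j (col' i (f v))))).
  apply: diff_mul; first exact: differentiable_cst.
  apply: diff_det; apply: diff_mx => k l.
  rewrite (_ : (fun _ => _) = (fun v => f v (lift j k) (lift i l))); first exact: diff_entry.
  by apply: funext => v; rewrite !mxE.
by apply: funext => v; rewrite mxE.
Qed.

(** Cramer's formula: a single rational expression to which the rules of differentiation apply,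
    unlike [invmx], which is defined by cases. *)
Definition minv m (A : 'M[C]_m) := (\det A)^-1 *: \adj A.

Lemma minvE m (A : 'M[C]_m) : A \in unitmx -> invmx A = minv A.
Proof. by move=> uA; rewrite /minv /invmx uA. Qed.

Lemma diff_minv m (f : V -> 'M[C]_m) (x : V) : f x \in unitmx ->
  differentiable f x -> differentiable (fun v => minv (f v)) x.
Proof.
move=> fu df; apply: diff_mx => i j.
rewrite (_ : (fun _ => _) = (fun v => (\det (f v))^-1 * \adj (f v) i j)).
  apply: diff_mul; last exact/diff_entry/diff_adjugate.
  by apply: diff_inv; [move: fu; rewrite unitmxE unitfE | exact: diff_det].
by apply: funext => v; rewrite mxE.
Qed.

Lemma diff_id (x : V) : differentiable (fun v : V => v) x.
Proof. exact: ex_diff. Qed.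

Lemma diff_fst (U W : normedModType C) (f : V -> U * W) (x : V) :
  differentiable f x -> differentiable (fun v => (f v).1) x.
Proof.
move=> df; apply: (@differentiable_comp _ _ _ _ f (fun q : U * W => q.1)) => //.
by apply: linear_differentiable => p; exact: cvg_fst.
Qed.

Lemma diff_snd (U W : normedModType C) (f : V -> U * W) (x : V) :
  differentiable f x -> differentiable (fun v => (f v).2) x.
Proof.
move=> df; apply: (@differentiable_comp _ _ _ _ f (fun q : U * W => q.2)) => //.
by apply: linear_differentiable => p; exact: cvg_snd.
Qed.

Lemma near_unitmx m (f : V -> 'M[C]_m) (x : V) : f x \in unitmx ->
  differentiable f x -> \forall v \near x, f v \in unitmx.
Proof.
rewrite unitmxE unitfE => fx /diff_det/differentiable_continuous df.
have : \forall v \near x, \det (f v) != 0 by exact: (cvgr_neq0 (\det (f x))).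
by apply: filterS => v h; rewrite unitmxE unitfE.
Qed.

End DiffInv.

Section DiffQdata.
Context {C : numClosedFieldType} {V : normedModType C} {m w : nat}.
Local Notation E := (qdata C m w).

(** The action with the inverse as a separate argument: it is polynomial, and together with [minv]
    it extends [gauge] by a formula. *)
Definition gauge2 (g h : 'M[C]_m) (x : E) : E :=
  (g *m qB1 x *m h, g *m qB2 x *m h, g *m qi x, qj x *m h).

Lemma gauge2E (g : 'M[C]_m) x : g \in unitmx -> gauge g x = gauge2 g (minv g) x.
Proof. by move=> gu; rewrite /gauge minvE. Qed.

Lemma diff_qdata (f1 f2 : V -> 'M[C]_m) (f3 : V -> 'M[C]_(m, w)) (f4 : V -> 'M[C]_(w, m)) x :
  differentiable f1 x -> differentiable f2 x -> differentiable f3 x -> differentiable f4 x ->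
  differentiable (fun v => (f1 v, f2 v, f3 v, f4 v) : E) x.
Proof. by move=> d1 d2 d3 d4; do 3?apply: differentiable_pair. Qed.

Lemma diff_qB1 (f : V -> E) x : differentiable f x -> differentiable (fun v => qB1 (f v)) x.
Proof. by move=> df; do 3!apply: diff_fst. Qed.

Lemma diff_qB2 (f : V -> E) x : differentiable f x -> differentiable (fun v => qB2 (f v)) x.
Proof. by move=> df; apply: diff_snd; do 2!apply: diff_fst. Qed.

Lemma diff_qi (f : V -> E) x : differentiable f x -> differentiable (fun v => qi (f v)) x.
Proof. by move=> df; apply: diff_snd; apply: diff_fst. Qed.

Lemma diff_qj (f : V -> E) x : differentiable f x -> differentiable (fun v => qj (f v)) x.
Proof. by move=> df; apply: diff_snd. Qed.

Lemma diff_gauge2 (g h : V -> 'M[C]_m) (f : V -> E) x :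
  differentiable g x -> differentiable h x -> differentiable f x ->
  differentiable (fun v => gauge2 (g v) (h v) (f v)) x.
Proof.
move=> dg dh df; apply: diff_qdata; do ?apply: diff_mulmx => //.
- exact: diff_qB1.
- exact: diff_qB2.
- exact: diff_qi.
- exact: diff_qj.
Qed.

End DiffQdata.

Section ComplexTopology.
Context {R : realType}.
Local Notation C := (cplx R).

Lemma rc_continuous : continuous (@rc R : R -> C).
Proof.
move=> a; apply/cvgrPdist_lt => e e0.
have er : rc (rp e) = e by rewrite rc_rp // gtr0_real.
rewrite -er rc_gt0 in e0; near=> b.
rewrite -er -rmorphB /= rc_norm rc_lt; near: b.
exact: cvgr_dist_lt.
Unshelve. all: by end_near. Qed.

Lemma nm_continuous : continuous (@nm R : C -> R).
Proof.
move=> z; have FF : Filter (nbhs z) by exact: nbhs_filter.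
apply/cvgrPdist_lt => e e0; 
have : \forall t \near z, `|z - t| < rc e.
  by apply: (@cvgr_dist_lt _ _ _ _ FF id z) => //; rewrite rc_gt0.
apply: filterS => t; rewrite -rc_lt; apply: le_lt_trans.
rewrite -rc_norm rmorphB /= !rc_nm; exact: ler_dist_dist.
Qed.

(** Compactness is imported from [R]: the disk is a closed subset of the continuous image of a real
    square. *)
Lemma compact_disk (B : R) : compact [set z : C | nm z <= B].
Proof.
pose f (p : R * R) : C := rc p.1 + 'i * rc p.2.
have cf : continuous f.
  move=> p; apply: cvgD.
    by apply: (cvg_comp _ _ cvg_fst); exact: rc_continuous.
  apply: cvgM; first exact: cvg_cst.
  by apply: (cvg_comp _ _ cvg_snd); exact: rc_continuous.
apply: (@subclosed_compact _ _ (f @` (`[- B, B]%classic `*` `[- B, B]%classic))).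
- apply: (@preimage_closed _ _ nm [set r | r <= B]); last exact: closed_le.
  by move=> z _; exact: nm_continuous.
- apply: continuous_compact; last by apply: compact_setX; exact: segment_compact.
  by apply: continuous_subspaceT.
- move=> z /= zB; exists (rp ('Re z), rp ('Im z)); last first.
    by rewrite /f /= !rc_rp ?Creal_Re ?Creal_Im // -Crect.
  have hR : nm ('Re z) <= B.
    by apply: le_trans zB; rewrite -rc_le !rc_nm; exact: (leif_normC_Re_Creal z).1.
  have hI : nm ('Im z) <= B.
    apply: le_trans zB; rewrite -rc_le !rc_nm.
    rewrite -(@ler_pXn2r _ 2) ?nnegrE ?normr_ge0 // [X in _ <= X]normC2_Re_Im.
    by rewrite real_normK ?Creal_Im // lerDr real_exprn_even_ge0 ?Creal_Re.
  have T (x : C) : x \is Num.real -> nm x <= B -> `[- B, B]%classic (rp x).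
    by move=> xr; rewrite -(rc_rp xr) nm_rc rp_rc ler_norml /= in_itv.
  by split; apply: T; rewrite ?Creal_Re ?Creal_Im.
Qed.

Lemma compact_rowbox n (B : R) : compact [set v : 'rV[C]_n | forall i, nm (v 0 i) <= B].
Proof. have := @rV_compact C n (fun=> [set z : C | nm z <= B]) (fun=> @compact_disk B).
exact. Qed.

Lemma compact_box m n (B : R) : compact [set A : 'M[C]_(m, n) | forall i j, nm (A i j) <= B].
Proof.
have cv : continuous (vec_mx : 'rV[C]_(m * n) -> 'M[C]_(m, n)).
  move=> v; apply: differentiable_continuous; apply: diff_mx => i j.
  rewrite (_ : (fun _ => _) = (fun v : 'rV[C]_(m * n) => v 0 (mxvec_index i j))).
    exact: differentiable_coord.
  by apply: funext => u; rewrite mxE.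
rewrite (_ : mkset _ = vec_mx @` [set v : 'rV[C]_(m * n) | forall i, nm (v 0 i) <= B]).
  apply: continuous_compact; last exact: compact_rowbox.
  by apply: continuous_subspaceT.
apply/seteqP; split=> [A AB|_ [v vB <-] i j]; last by rewrite mxE; exact: vB.
exists (mxvec A); last by rewrite mxvecK.
by move=> k; case/mxvec_indexP: k => i j; rewrite mxvecE; exact: AB.
Qed.

End ComplexTopology.

(** * The Kempf-Ness correspondence *)

Section Pinch.
Context {C : numClosedFieldType} {m : nat}.
Implicit Types e g h p : 'M[C]_m.

(** When [e] is a projection commuting with [g], this is [g] on the image of [e] and the identity on
    the complement. Its determinant is thus that of one block of [g], without coordinates on the
    block. *)
Definition pin e g : 'M[C]_m := 1%:M + e *m (g - 1%:M).

Lemma pin1 e : pin e 1%:M = 1%:M.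
Proof. by rewrite /pin subrr mulmx0 addr0. Qed.

Lemma pinM e h g : e *m e = e -> h *m e = e *m h -> pin e (h *m g) = pin e h *m pin e g.
Proof.
move=> ee he; rewrite /pin; have [a hE] : exists a, h = 1%:M + a.
  by exists (h - 1%:M); rewrite addrC subrK.
have [b gE] : exists b, g = 1%:M + b by exists (g - 1%:M); rewrite addrC subrK.
have ae : a *m e = e *m a.
  by move: he; rewrite hE mulmxDl mulmxDr mul1mx mulmx1 => /addrI.
have K (c : 'M[C]_m) : 1%:M + c - 1%:M = c by rewrite addrC addKr.
have -> : h *m g - 1%:M = b + (a + a *m b).
  by rewrite hE gE mulmxDl mul1mx mulmxDr mulmx1 -(addrA _ b) K.
rewrite hE gE !K (mulmxDl _ _ (1%:M + _)) mul1mx.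
rewrite (mulmxDr (e *m a)) mulmx1.
have -> : e *m a *m (e *m b) = e *m (a *m b) by rewrite -mulmxA (mulmxA a) ae !mulmxA ee.
by rewrite !mulmxDr -!addrA.
Qed.

Lemma pin_adj e g : e^t* = e -> g^t* *m e = e *m g^t* -> (pin e g)^t* = pin e (g^t*).
Proof.
move=> eH ge; rewrite /pin adjmxD adjmx1 adjmxM eH adjmxD adjmxN adjmx1.
by rewrite mulmxBl mulmxBr ge mul1mx mulmx1.
Qed.

Lemma det_adj g : \det (g^t*) = (\det g)^*.
Proof. by rewrite det_map_mx det_tr. Qed.

(** An eigenvector for an eigenvalue other than 1 lies in the image of [e], where [pin e p] and [p]
    agree. *)
Lemma pin_eigen e p (r : 'rV[C]_m) mu : e *m e = e -> p *m e = e *m p ->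
  r *m pin e p = mu *: r -> mu != 1 -> r *m p = mu *: r.
Proof.
move=> ee pe; rewrite /pin mulmxDr mulmx1 mulmxBr mulmx1 mulmxBr => rE mu1.
have re : r *m e = r.
  have h : r *m (e *m p) *m (1%:M - e) = 0.
    by rewrite mulmxBr mulmx1 -!mulmxA pe (mulmxA e) ee subrr.
  have h2 : (r *m (e *m p) - r *m e) *m (1%:M - e) = 0.
    by rewrite mulmxBl h mulmxBr mulmx1 -mulmxA ee subrr subrr.
  have := congr1 (mulmxr (1%:M - e)) rE; rewrite /= mulmxDl h2 addr0 -scalemxAl.
  move/eqP; rewrite -subr_eq0 -{1}[r *m _]scale1r -scalerBl scaler_eq0 subr_eq0.
  rewrite eq_sym (negPf mu1) /= mulmxBr mulmx1 subr_eq0 => /eqP/esym.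
  exact.
move: rE; rewrite mulmxA re addrC subrK => ->.
exact: erefl.
Qed.

End Pinch.

Section KempfNess.
Context {R : realType}.
Local Notation C := (cplx R).
Context {T : Type} {D : T -> Prop} {m : nat} {rho : T -> 'M[C]_m}.
Hypothesis rhoU : forall s, D s -> rho s \is unitarymx.
Local Notation comm := (comms D rho).
Implicit Types g h p : 'M[C]_m.

Definition lpin e g : R := ln (sqn (\det (pin e g))).

Section Block.
Context {e : 'M[C]_m}.
Hypothesis eH : e^t* = e.
Hypothesis eP : e *m e = e.
Hypothesis eC : forall h, comm h -> h *m e = e *m h.

Lemma comm_pin_unit g : g \in unitmx -> comm g -> pin e g \in unitmx.
Proof.
move=> gu cg; have : pin e g *m pin e (invmx g) = 1%:M.
  by rewrite -(pinM _ eP (eC cg)) mulmxV // pin1.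
by move=> h; exact: (mulmx1_unit h).1.
Qed.

Lemma sqn_pin_gt0 g : g \in unitmx -> comm g -> 0 < sqn (\det (pin e g)).
Proof.
move=> gu cg; rewrite lt_def sqn_ge0 sqn_eq0 andbT.
by have := comm_pin_unit gu cg; rewrite unitmxE unitfE.
Qed.

Lemma lpinM h g : h \in unitmx -> g \in unitmx -> comm h -> comm g ->
  lpin e (h *m g) = lpin e h + lpin e g.
Proof.
move=> hu gu ch cg; rewrite /lpin (pinM _ eP (eC ch)) det_mulmx sqnM lnM; first exact: erefl.
  by rewrite posrE sqn_pin_gt0.
by rewrite posrE sqn_pin_gt0.
Qed.

Lemma lpin1 : lpin e 1%:M = 0.
Proof. by rewrite /lpin pin1 det1 -(rmorph1 rc) sqn_rc expr1n ln1. Qed.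

Lemma lpin_adj g : comm g -> lpin e (g^t*) = lpin e g.
Proof.
move=> cg; rewrite /lpin -(pin_adj eH (eC (comms_adj rhoU cg))) det_adj.
by rewrite sqn_conj.
Qed.

Lemma lpin_unitary g : comm g -> g \is unitarymx -> lpin e g = 0.
Proof.
move=> cg gU; have [gV gK _ gu] := unitarymxE gU.
have [_ _ _ gu'] := unitarymxE (adjmx_unitary gU).
have := lpin1; rewrite -gV (lpinM gu gu' cg (comms_adj rhoU cg)).
rewrite (lpin_adj cg); lra.
Qed.

Lemma pin_hfun_eigen u (s : 'I_m -> R) v (mu : 'I_m -> R) :
  u \is unitarymx -> v \is unitarymx -> comm (hfun u s) ->
  pin e (hfun u s) = hfun v mu -> forall a, mu a = 1 \/ exists b, mu a = s b.
Proof.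
move=> uu vu cp E a; have [vV _ _ vU] := unitarymxE vu.
have [uV uK _ uU] := unitarymxE uu.
have row_hfun (w : 'M[C]_m) (k : 'I_m -> R) (c : 'I_m) : w *m w^t* = 1%:M ->
    row c w *m hfun w k = rc (k c) *: row c w.
  move=> wV; rewrite -row_mul /hfun !mulmxA wV mul1mx; apply/rowP => b.
  by rewrite [LHS]mxE mul_rdiag [RHS]mxE [row c w 0 b]mxE.
have rE : row a v *m pin e (hfun u s) = rc (mu a) *: row a v by rewrite E row_hfun.
have [->|mu1] := eqVneq (mu a) 1; [by left | right].
have rmu1 : rc (mu a) != 1 by rewrite -(rmorph1 rc) (inj_eq rc_inj).
have := pin_eigen eP (eC cp) rE rmu1; set r := row a v => rp.
have tE : (r *m u^t*) *m rdiag s = rc (mu a) *: (r *m u^t*).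
  move/(congr1 (mulmxr (u^t*))): rp; rewrite /= /hfun -!mulmxA uV mulmx1 !mulmxA.
  by rewrite -scalemxAl.
have : r *m u^t* != 0.
  apply/eqP => r0; have r1 : r = 0 by rewrite -[r]mulmx1 -uK mulmxA r0 mul0mx.
  have /eqP : (row a v *m v^t*) 0 a = 0 by rewrite -/r r1 mul0mx mxE.
  by rewrite -row_mul vV !mxE eqxx oner_eq0.
move=> /rV0Pn[b] tb; exists b; apply: rc_inj.
move/rowP/(_ b): tE; rewrite mul_mx_rdiag [RHS]mxE mulrC => h.
exact: (mulIf tb (esym h)).
Qed.

(** By [pin_hfun_eigen] each eigenvalue of the block matrix is 1 or an eigenvalue of [hfun u s], so
    the logarithm of its squared determinant grows only linearly in [l]. *)
Lemma lpin_bound u (s : 'I_m -> R) (l : R) : u \is unitarymx -> comm (hfun u s) ->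
  (forall a, 0 < s a) -> (forall a, `|ln (s a)| <= l) -> 0 <= l ->
  `|lpin e (hfun u s)| <= 2 * m%:R * l.
Proof.
move=> uu cp s0 sl l0.
have [v vu [mu E]] : exists2 v, v \is unitarymx & exists mu, pin e (hfun u s) = hfun v mu.
  apply: herm_spectral; have := pin_adj eH (eC (comms_adj rhoU cp)).
  by rewrite hfun_adj.
have muP := pin_hfun_eigen uu vu cp E.
have mu_s a : expR (- l) <= mu a <= expR l.
  have [->|[b ->]] := muP a.
    by rewrite -expR0 !ler_expR oppr_le0 l0.
  have sE : s b = expR (ln (s b)) by rewrite lnK // posrE.
  by rewrite sE !ler_expR -ler_norml.
have mu0 a : 0 < mu a by have /andP[h _] := mu_s a; apply: lt_le_trans h; exact: expR_gt0.
rewrite /lpin E (det_hfun vu) sqn_rc lnXn ?prodr_gt0 //.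
have up : \prod_a mu a <= expR l ^+ m.
  rewrite -[X in _ ^+ X]card_ord -prodr_const; apply: ler_prod => a _.
  by rewrite ltW //=; have /andP[] := mu_s a.
have lo : expR (- l) ^+ m <= \prod_a mu a.
  rewrite -[X in _ ^+ X]card_ord -prodr_const; apply: ler_prod => a _.
  by rewrite expR_ge0 /=; have /andP[] := mu_s a.
have p0 : 0 < \prod_a mu a by rewrite prodr_gt0.
rewrite -ler_ln ?posrE ?exprn_gt0 ?expR_gt0 // lnXn ?expR_gt0 // expRK in up.
rewrite -ler_ln ?posrE ?exprn_gt0 ?expR_gt0 // lnXn ?expR_gt0 // expRK in lo.
rewrite -mulr_natl -[l *+ m]mulr_natl -[(- l) *+ m]mulr_natl in up lo *.
by rewrite ler_norml; apply/andP; split; lra.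
Qed.

End Block.

Lemma qn2_entries (y : qdata C m 1) :
  [/\ forall a b, sqn (qB1 y a b) <= qn2 y, forall a b, sqn (qB2 y a b) <= qn2 y,
      forall a, sqn (qi y a 0) <= qn2 y & forall a, sqn (qj y 0 a) <= qn2 y].
Proof.
have h1 := fro_ge0 (qB1 y); have h2 := fro_ge0 (qB2 y).
have h3 := fro_ge0 (qi y); have h4 := fro_ge0 (qj y).
split=> [a b|a b|a|a]; rewrite /qn2.
- by have := sqn_le_fro (qB1 y) a b; lra.
- by have := sqn_le_fro (qB2 y) a b; lra.
- by have := sqn_le_fro (qi y) a 0; lra.
- by have := sqn_le_fro (qj y) 0 a; lra.
Qed.

(** The entry supplied by [gap] is multiplied by at least [exp r], with [r] the gap width. The crude
    bound [exp r >= r] already gives quadratic growth, which beats the linear growth of the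
    determinant terms. *)
Lemma qn2_scaled_lower (y : qdata C m 1) (tau : C) (s : 'I_m -> R) (q : R) a0 :
  tau != 0 -> mu_C y = - tau%:M -> qn2 y = q -> (forall a, 0 < s a) ->
  kappa_of m tau q ^+ 2 * (`|ln (s a0)| / m%:R) ^+ 2 <= qn2 (gauge (rdiag s) y).
Proof.
move=> t0 muE yq s0; have q0 : 0 <= q by rewrite -yq qn2_ge0.
have kp := kappa_of_gt0 m t0 q0; have kl := kappa_of_lt m t0 q0.
have bd : qbounded y (1 + q) by rewrite -yq; exact: qn2_bounded.
have [E1 E2 Ei Ej] := gauge_rdiagE y s0.
have [B1 B2 Bi Bj] := qn2_entries (gauge (rdiag s) y).
pose th a := ln (s a); set r := `|ln (s a0)| / m%:R.
have r0 : 0 <= r by rewrite divr_ge0.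
have sE a : s a = expR (th a) by rewrite lnK // posrE.
have X (z : C) d t : rc (kappa_of m tau q) <= `|z| -> r <= d -> t = expR d ^+ 2 ->
    kappa_of m tau q ^+ 2 * r ^+ 2 <= sqn z * t.
  move=> hz hd ->; apply: ler_pM; rewrite ?sqr_ge0 //; first exact: sqn_ge (ltW kp) hz.
  apply: lerXn2r; rewrite ?nnegrE ?expR_ge0 //; apply: le_trans hd _.
  by apply: le_trans (expR_ge1Dx d); rewrite lerDr.
case: (gap th a0 muE bd kp kl) => [[a [b [hd [h|h]]]]|[a [hd h]]|[a [hd h]]].
- apply: le_trans (B1 a b); rewrite E1; apply: X h hd _.
  by rewrite !sE expRB expr_div_n.
- apply: le_trans (B2 a b); rewrite E2; apply: X h hd _.
  by rewrite !sE expRB expr_div_n.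
- by apply: le_trans (Bi a); rewrite Ei; apply: X h hd _; rewrite sE.
- apply: le_trans (Bj a); rewrite Ej; apply: X h hd _.
  by rewrite sE expRN exprVn.
Qed.

Lemma sqr_divA (k l n : R) : k ^+ 2 / n ^+ 2 * l ^+ 2 = k ^+ 2 * (l / n) ^+ 2.
Proof. by rewrite [(l / n) ^+ 2]exprMn exprVn; ring. Qed.

Lemma coercive (c b P l : R) : 0 < c -> 0 <= b -> 0 <= l ->
  c * l ^+ 2 - b * l <= P -> l <= (`|P| + b) / c + 1.
Proof.
move=> c0 b0 l0 h; rewrite leNgt; apply/negP => lt.
have P0 := normr_ge0 P; have PP := ler_norm P.
have h1 : 1 <= l by apply: ltW; apply: le_lt_trans lt; rewrite lerDr divr_ge0 ?addr_ge0 // ltW.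
have h2 : `|P| + b < c * l.
  by rewrite mulrC -ltr_pdivrMr //; apply: le_lt_trans lt; rewrite lerDl.
nra.
Qed.

Context {K : nat} (e : 'I_K -> 'M[C]_m) (zeta : 'I_K -> R).
Hypothesis eH : forall k, (e k)^t* = e k.
Hypothesis eP : forall k, e k *m e k = e k.
Hypothesis eC : forall k h, comm h -> h *m e k = e k *m h.
Hypothesis ce : forall k, comm (e k).

Definition lsum g : R := \sum_k zeta k * lpin (e k) g.

Lemma lsumM h g : h \in unitmx -> g \in unitmx -> comm h -> comm g ->
  lsum (h *m g) = lsum h + lsum g.
Proof.
move=> hu gu ch cg; rewrite /lsum -big_split; apply: eq_bigr => k _.
by rewrite (lpinM (eP k) (@eC k) hu gu ch cg) mulrDr.
Qed.

Lemma lsum_unitary w : w \is unitarymx -> comm w -> lsum w = 0.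
Proof.
move=> wu cw; apply: big1 => k _.
by rewrite (lpin_unitary (eH k) (eP k) (@eC k) cw wu) mulr0.
Qed.

Definition psi (x : qdata C m 1) g : R := qn2 (gauge g x) + lsum g.

Lemma psiE x g : psi x g = qn2 (gauge g x) + lsum g.
Proof. by []. Qed.

Lemma psiM x h g : h \in unitmx -> g \in unitmx -> comm h -> comm g ->
  psi x (h *m g) = psi (gauge g x) h + lsum g.
Proof.
move=> hu gu ch cg.
have E : qn2 (gauge (h *m g) x) = qn2 (gauge h (gauge g x)) :=
  congr1 (fun y => qn2 y) (gaugeM x hu gu).
have := lsumM hu gu ch cg; rewrite /psi.
move: (lsum (h *m g)) (lsum h) (lsum g) (qn2 _) (qn2 _) E => a b c p q -> ->.
by rewrite addrA.
Qed.

Lemma psi_unitary x w g : w \is unitarymx -> g \in unitmx -> comm w -> comm g ->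
  psi x (w *m g) = psi x g.
Proof.
move=> wu gu cw cg; have [_ _ _ wU] := unitarymxE wu.
apply: etrans (psiM x wU gu cw cg) _; rewrite /psi (lsum_unitary wu cw) addr0.
by rewrite (qn2_unitary _ wu).
Qed.

(** Moving [x] by [u] makes the positive element diagonal without changing [qn2], so the constants
    do not depend on [u]. The norm then contributes [c l^2], while [lsum] is at most [b l] in
    size. *)
Lemma psi_proper x (tau : C) (P : R) : tau != 0 -> mu_C x = - tau%:M ->
  exists2 l : R, 0 <= l & forall u (s : 'I_m -> R), u \is unitarymx -> (forall a, 0 < s a) ->
    comm (hfun u s) -> psi x (hfun u s) <= P -> forall a, `|ln (s a)| <= l.
Proof.
move=> t0 muE; pose S := \sum_k `|zeta k|.
have S0 : 0 <= S by apply: sumr_ge0.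
have [m0|m0] := posnP m.
  by exists 0 => // u s _ _ _ _ [a al]; exfalso; rewrite m0 in al.
have kp := kappa_of_gt0 m t0 (qn2_ge0 x).
have mp : 0 < m%:R :> R by rewrite ltr0n.
pose c := kappa_of m tau (qn2 x) ^+ 2 / m%:R ^+ 2.
have c0 : 0 < c by rewrite divr_gt0 ?exprn_gt0.
have b0 : 0 <= 2 * m%:R * S by rewrite !mulr_ge0.
exists ((`|P| + 2 * m%:R * S) / c + 1).
  by rewrite addr_ge0 // divr_ge0 ?addr_ge0 // ltW.
move=> u s uu s0 cp psiP a1; have [_ _ _ uU] := unitarymxE uu.
have [pU _] := hfun_inv uu (fun a => lt0r_neq0 (s0 a)).
case: (@arg_maxP _ _ _ a1 predT (fun a => `|ln (s a)|) isT) => a0 _ a0P.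
apply: le_trans (a0P a1 isT) _; apply: coercive => //.
apply: le_trans psiP; rewrite /psi -(qn2_unitary _ uu) -(gaugeM _ uU pU).
have -> : u *m hfun u s = rdiag s *m u.
  by have [uV _ _ _] := unitarymxE uu; rewrite /hfun !mulmxA uV mul1mx.
have [dU _] := rdiag_inv (fun a => lt0r_neq0 (s0 a)); rewrite (gaugeM _ dU uU).
apply: lerD.
  have yE : mu_C (gauge u x) = - tau%:M.
    by rewrite -raddfN; apply: mu_C_gauge_scalar => //; rewrite raddfN.
  have := qn2_scaled_lower a0 t0 yE (qn2_unitary x uu) s0.
  by apply: le_trans; rewrite /c sqr_divA.
rewrite lerNl /lsum -sumrN mulrAC /S mulr_sumr; apply: ler_sum => k _.
apply: le_trans (ler_norm _) _; rewrite normrN normrM mulrC ler_wpM2r //.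
apply: (lpin_bound (eH k) (eP k) (@eC k) uu cp s0) => // a.
exact: a0P.
Qed.

End KempfNess.

Section RealContinuity.
Context {R : realType}.
Local Notation C := (cplx R).
Context {V : normedModType C}.

Lemma cts_sum (I : Type) (r : seq I) (f : I -> V -> R) (v : V) :
  (forall i, {for v, continuous (f i)}) -> {for v, continuous (fun y => \sum_(i <- r) f i y)}.
Proof.
move=> cf; elim: r => [|i r IH].
  rewrite (_ : (fun _ => _) = cst 0); first exact: cvg_cst.
  by apply: funext => y; rewrite big_nil.
rewrite (_ : (fun _ => _) = (fun y => f i y + \sum_(j <- r) f j y)).
  by apply: cvgD; [exact: cf | exact: IH].
by apply: funext => y; rewrite big_cons.
Qed.

Lemma ctsD (f g : V -> R) (v : V) : {for v, continuous f} -> {for v, continuous g} ->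
  {for v, continuous (fun y => f y + g y)}.
Proof. by move=> cf cg; apply: cvgD; [exact: cf | exact: cg]. Qed.

Lemma ctsZ (k : R) (f : V -> R) (v : V) : {for v, continuous f} ->
  {for v, continuous (fun y => k * f y)}.
Proof. by move=> cf; apply: cvgM; [exact: cvg_cst | exact: cf]. Qed.

Lemma cts_sqn (f : V -> C) (v : V) : differentiable f v ->
  {for v, continuous (fun y => sqn (f y))}.
Proof.
move=> /differentiable_continuous cf.
have cn : {for v, continuous (fun y => nm (f y))}.
  by apply: continuous_comp cf _; exact: nm_continuous.
by rewrite /sqn; apply: cvgM; exact: cn.
Qed.

Lemma cts_ln (f : V -> R) (v : V) : {for v, continuous f} -> 0 < f v ->
  {for v, continuous (fun y => ln (f y))}.
Proof. by move=> cf f0; apply: continuous_comp cf _; exact: continuous_ln. Qed.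

Lemma cts_fro m n (f : V -> 'M[C]_(m, n)) (v : V) : differentiable f v ->
  {for v, continuous (fun y => fro (f y))}.
Proof.
move=> df; apply: cts_sum => i; apply: cts_sum => j.
exact/cts_sqn/diff_entry.
Qed.

Lemma cts_qn2 m w (f : V -> qdata C m w) (v : V) : differentiable f v ->
  {for v, continuous (fun y => qn2 (f y))}.
Proof.
move=> df; rewrite /qn2; do 3?apply: cvgD; apply: cts_fro.
- exact: diff_qB1.
- exact: diff_qB2.
- exact: diff_qi.
- exact: diff_qj.
Qed.

End RealContinuity.

(** * Existence of a minimum of the Kempf-Ness function and its first-order condition *)

Section Existence.
Context {R : realType}.
Local Notation C := (cplx R).
Context {T : Type} {D : T -> Prop} {m : nat} {rho : T -> 'M[C]_m}.
Hypothesis rhoU : forall s, D s -> rho s \is unitarymx.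
Local Notation comm := (comms D rho).
Implicit Types g h p : 'M[C]_m.

Lemma closed_comm : closed [set g | comm g].
Proof.
rewrite (_ : mkset _ = \bigcap_(s in D) \bigcap_(i in setT) \bigcap_(j in setT)
   (fun g => nm ((g *m rho s - rho s *m g) i j)) @^-1` [set r | r <= 0]).
  apply: closed_bigI => s _; apply: closed_bigI => i _; apply: closed_bigI => j _.
  apply: preimage_closed; last exact: closed_le.
  move=> g _; apply: continuous_comp; last exact: nm_continuous.
  apply: differentiable_continuous; apply: diff_entry; apply: differentiableB.
    by apply: diff_mulmx; [exact: diff_id | exact: differentiable_cst].
  by apply: diff_mulmx; [exact: differentiable_cst | exact: diff_id].
apply/seteqP; split=> g.
  by move=> cg s Ds i _ j _; rewrite /= cg // subrr mxE -rc_le rc_nm normr0 rmorph0.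
move=> cg s Ds; apply/eqP; rewrite -subr_eq0; apply/eqP/matrixP => i j.
have := cg s Ds i I j I; rewrite /= -rc_le rc_nm rmorph0 normr_le0 => /eqP ->.
by rewrite mxE.
Qed.

Lemma compact_gauge (B d : R) :
  compact [set g : 'M[C]_m | [/\ forall i j, nm (g i j) <= B, comm g & d <= sqn (\det g)]].
Proof.
apply: (subclosed_compact _ (@compact_box R m m B)); last by move=> g [].
rewrite (_ : mkset _ = [set g : 'M[C]_m | forall i j, nm (g i j) <= B] `&`
  ([set g | comm g] `&` (fun g => sqn (\det g)) @^-1` [set r | d <= r])); last first.
  by apply/seteqP; split=> g; [case=> h1 h2 h3 | case=> h1 [h2 h3]]; split.
apply: closedI.
  by apply: compact_closed; [exact: norm_hausdorff | exact: compact_box].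
apply: closedI; first exact: closed_comm.
apply: preimage_closed; last exact: closed_ge.
by move=> g _; apply: cts_sqn; apply: diff_det; exact: diff_id.
Qed.

Context {K : nat} (e : 'I_K -> 'M[C]_m) (zeta : 'I_K -> R).
Hypothesis eH : forall k, (e k)^t* = e k.
Hypothesis eP : forall k, e k *m e k = e k.
Hypothesis eC : forall k h, comm h -> h *m e k = e k *m h.
Hypothesis ce : forall k, comm (e k).
Local Notation psi := (psi e zeta).

Lemma psi_cts (x : qdata C m 1) (S : set 'M[C]_m) :
  (forall g, S g -> g \in unitmx /\ comm g) ->
  {within S, continuous (fun g => qn2 (gauge2 g (minv g) x) + lsum e zeta g)}.
Proof.
move=> SU; apply: continuous_in_subspaceT => g; rewrite inE => /SU[gu cg].
apply: (@ctsD R 'M[C]_m _ _ g).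
  apply: cts_qn2; apply: diff_gauge2; first exact: diff_id.
    by apply: diff_minv => //; exact: diff_id.
  exact: differentiable_cst.
apply: cts_sum => k; apply: ctsZ.
apply: (@cts_ln R 'M[C]_m _ g); last exact: (sqn_pin_gt0 (eP k) (@eC k) gu cg).
apply: cts_sqn; apply: diff_det; rewrite /pin.
apply: differentiableD; first exact: differentiable_cst.
apply: diff_mulmx; first exact: differentiable_cst.
by apply: differentiableB; [exact: diff_id | exact: differentiable_cst].
Qed.

Lemma small_positive (I : finType) (f : I -> R) :
  exists2 d, 0 < d & forall t, `|t| < d -> forall i, 0 < 1 + t * f i.
Proof.
exists (2 * (1 + `|\sum_i `|f i| |))^-1.
  by rewrite invr_gt0 mulr_gt0 // ltr_wpDr.
move=> t /small_mul h i.
have : `|t * f i| <= `|t * \sum_i `|f i| |.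
  rewrite !normrM ler_wpM2l // [X in _ <= X]ger0_norm ?sumr_ge0 //.
  by rewrite (bigD1 i) //= lerDl sumr_ge0.
move=> /le_trans /(_ h); rewrite ler_norml; lra.
Qed.

Lemma fro_eq0 (N : 'M[C]_m) : fro N = 0 -> N = 0.
Proof.
move=> f0; apply/matrixP => a b; apply/eqP; rewrite [X in _ == X]mxE -sqn_eq0.
by apply/eqP/le_anti; rewrite sqn_ge0 andbT -f0 sqn_le_fro.
Qed.

Lemma ln_prod (I : Type) (r : seq I) (F : I -> R) : (forall i, 0 < F i) ->
  ln (\prod_(i <- r) F i) = \sum_(i <- r) ln (F i).
Proof.
move=> F0; elim: r => [|i r IH]; first by rewrite !big_nil ln1.
rewrite !big_cons lnM ?posrE ?F0 //; first by rewrite IH.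
by apply: prodr_gt0 => j _.
Qed.

Lemma hfunZ (u : 'M[C]_m) (l : 'I_m -> R) t : rc t *: hfun u l = hfun u (fun a => t * l a).
Proof.
rewrite /hfun scalemxAl scalemxAr; congr (_ *m _ *m _).
by apply/matrixP => a b; rewrite mxE !rdiagE rmorphM mulrnAr.
Qed.

Lemma hfun_line (u : 'M[C]_m) (l : 'I_m -> R) t : u \is unitarymx ->
  hfun u (fun a => 1 + t * l a) = 1%:M + rc t *: hfun u l.
Proof. by move=> uu; rewrite hfunZ -(hfun1 uu) hfunD. Qed.

Lemma lpin_line k (N v : 'M[C]_m) (al : 'I_m -> R) t : v \is unitarymx ->
  e k *m N = hfun v al -> (forall a, 0 < 1 + t * al a) ->
  lpin (e k) (1%:M + rc t *: N) = \sum_a ln ((1 + t * al a) ^+ 2).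
Proof.
move=> vu E al0; rewrite /lpin /pin (addrC _ (rc t *: N)) addrK -scalemxAr E -(hfun_line _ _ vu).
rewrite (det_hfun vu) sqn_rc -prodrXl ln_prod // => a.
by rewrite exprn_gt0.
Qed.

Lemma sum_mudiag (y : qdata C m 1) (nu : 'I_m -> R) :
  \sum_a nu a * mudiag y a =
    \sum_a \sum_b sqn (qB1 y a b) * (nu a - nu b)
    + \sum_a \sum_b sqn (qB2 y a b) * (nu a - nu b)
    + \sum_a sqn (qi y a 0) * nu a - \sum_a sqn (qj y 0 a) * nu a.
Proof.
rewrite -!sum_antisym -!big_split -sumrB /=; apply: eq_bigr => a _.
rewrite /mudiag; ring.
Qed.

(** The vectors [i] and [j] are treated as entries joined to an extra index of weight 0; the factors
    [1 + t * 0] let [slope0_ratio] handle all four terms. *)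
Definition qline (y : qdata C m 1) (nu : 'I_m -> R) (t : R) : R :=
  \sum_a \sum_b sqn (qB1 y a b) * ((1 + t * nu a) ^+ 2 / (1 + t * nu b) ^+ 2)
  + \sum_a \sum_b sqn (qB2 y a b) * ((1 + t * nu a) ^+ 2 / (1 + t * nu b) ^+ 2)
  + \sum_a sqn (qi y a 0) * ((1 + t * nu a) ^+ 2 / (1 + t * 0) ^+ 2)
  + \sum_a sqn (qj y 0 a) * ((1 + t * 0) ^+ 2 / (1 + t * nu a) ^+ 2).

Lemma slope0_qline (y : qdata C m 1) (nu : 'I_m -> R) :
  slope0 (qline y nu) (2 * \sum_a nu a * mudiag y a).
Proof.
have -> : 2 * \sum_a nu a * mudiag y a =
    \sum_a \sum_b sqn (qB1 y a b) * (2 * (nu a - nu b))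
    + \sum_a \sum_b sqn (qB2 y a b) * (2 * (nu a - nu b))
    + \sum_a sqn (qi y a 0) * (2 * (nu a - 0)) + \sum_a sqn (qj y 0 a) * (2 * (0 - nu a)).
  rewrite sum_mudiag mulrBr !mulrDr !mulr_sumr -sumrN; congr (_ + _ + _ + _).
  - by apply: eq_bigr => a _; rewrite mulr_sumr; apply: eq_bigr => b _; ring.
  - by apply: eq_bigr => a _; rewrite mulr_sumr; apply: eq_bigr => b _; ring.
  - by apply: eq_bigr => a _; ring.
  - by apply: eq_bigr => a _; ring.
rewrite /qline; do 3?apply: slope0D.
- by apply: slope0_sum => a; apply: slope0_sum => b; apply/slope0Z/slope0_ratio.
- by apply: slope0_sum => a; apply: slope0_sum => b; apply/slope0Z/slope0_ratio.
- by apply: slope0_sum => a; apply/slope0Z/slope0_ratio.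
- by apply: slope0_sum => a; apply/slope0Z/slope0_ratio.
Qed.

Lemma qlineE (y : qdata C m 1) (nu : 'I_m -> R) t : (forall a, 0 < 1 + t * nu a) ->
  qn2 (gauge (rdiag (fun a => 1 + t * nu a)) y) = qline y nu t.
Proof.
move=> nu0; have [E1 E2 Ei Ej] := gauge_rdiagE y nu0.
rewrite /qn2 /fro /qline; congr (_ + _ + _ + _).
- by apply: eq_bigr => a _; apply: eq_bigr => b _; rewrite E1.
- by apply: eq_bigr => a _; apply: eq_bigr => b _; rewrite E2.
- by apply: eq_bigr => a _; rewrite big_ord1 Ei mulr0 addr0 expr1n divr1.
- by rewrite big_ord1; apply: eq_bigr => a _; rewrite Ej mulr0 addr0 expr1n div1r.
Qed.

(** By unitary invariance, [psi_proper] bounds the positive factor of any [g] in the sublevel set of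
    the identity, and the unitary factor is bounded anyway. This sublevel set therefore lies in a
    compact part of the invertible commutant. *)
Lemma psi_min (x : qdata C m 1) (tau : C) : tau != 0 -> mu_C x = - tau%:M ->
  exists g, [/\ g \in unitmx, comm g & forall h, h \in unitmx -> comm h -> psi x g <= psi x h].
Proof.
move=> t0 muE.
have [l l0 lP] := psi_proper rhoU zeta eH eP eC (psi x 1%:M) t0 muE.
(* If the positive factor has eigenvalues between [expR (- l)] and [expR l], its entries are at most
   [m expR l], those of [g] at most [m^2 expR l], and the squared determinant of [g] is at least
   [d]. *)
pose B := (expR l *+ m) *+ m; pose d := (expR (- l) ^+ 2) ^+ m.
have d0 : 0 < d by rewrite !exprn_gt0 ?expR_gt0.
pose S := [set g : 'M[C]_m | [/\ forall i j, nm (g i j) <= B, comm g & d <= sqn (\det g)]].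
have SU g : S g -> g \in unitmx /\ comm g.
  case=> _ cg dg; split=> //; rewrite unitmxE unitfE -sqn_eq0 gt_eqF //.
  exact: lt_le_trans dg.
have low g : g \in unitmx -> comm g -> psi x g <= psi x 1%:M -> S g.
  move=> gu cg gP; have [u [s [uu s0 gE cp]]] := polar rhoU gu cg.
  have [pU _] := hfun_inv uu (fun a => lt0r_neq0 (s0 a)).
  have wu := polar_unitary uu s0 gE.
  have cw : comm (g *m invmx (hfun u s)) by apply: commsM => //; exact: commsV.
  have gwp : g = g *m invmx (hfun u s) *m hfun u s by rewrite -mulmxA mulVmx // mulmx1.
  move: (g *m invmx (hfun u s)) wu cw gwp => w wu cw gwp.
  have pP : psi x (hfun u s) <= psi x 1%:M.
    by have := psi_unitary rhoU zeta eH eP eC x wu pU cw cp; rewrite -gwp => <-.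
  have sl := lP u s uu s0 cp pP.
  have sb a : expR (- l) <= s a <= expR l.
    have sE : s a = expR (ln (s a)) by rewrite lnK // posrE.
    by rewrite sE !ler_expR -ler_norml.
  split=> //.
    move=> i j; rewrite nm_le gwp; apply: le_trans.
      apply: (@mulmx_bound _ _ _ _ _ _ 1 (rc (expR l *+ m))).
        by move=> a b; exact: unitary_entry.
      apply: hfun_small => // a; rewrite ger0_norm; last by rewrite ltW.
      by have /andP[] := sb a.
    by rewrite mul1r -rmorphMn.
  have dE : sqn (\det g) = \prod_a s a ^+ 2.
    apply: rc_inj; rewrite -sqnE mulrC -det_adj -det_mulmx gE.
    exact: det_hfun.
  rewrite dE /d -[X in _ ^+ X]card_ord -prodr_const; apply: ler_prod => a _.
  rewrite exprn_ge0 ?expR_ge0 //=; apply: lerXn2r; rewrite ?nnegrE ?expR_ge0 ?(ltW (s0 a)) //.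
  by have /andP[] := sb a.
have S1 : S 1%:M by apply: low => //; [exact: unitmx1 | exact: comms1].
have cS : {within S, continuous (fun g => qn2 (gauge2 g (minv g) x) + lsum e zeta g)}.
  exact: psi_cts.
have [g gS gmin] := compact_EVT_min (ex_intro _ _ S1) (@compact_gauge B d) cS.
have psi2E h : h \in unitmx -> psi x h = qn2 (gauge2 h (minv h) x) + lsum e zeta h.
  by move=> hu; rewrite psiE gauge2E.
rewrite inE in gS; have [gu cg] := SU g gS.
have gmin' h : S h -> psi x g <= psi x h.
  by move=> hS; rewrite (psi2E _ gu) (psi2E _ (SU h hS).1); apply: gmin; rewrite inE.
exists g; split; [exact: gu | exact: cg | move=> h hu ch].
have := gmin' h; have := low h hu ch; have := gmin' _ S1.
move: (psi x h) (psi x 1%:M) (psi x g) => a b c {}low1 lowh minh.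
have [hP|/ltW hP] := leP a b; first exact (minh (lowh hP)).
exact (le_trans low1 hP).
Qed.

(* At a minimum of [psi] along the orbit, the derivative in the direction
   [N = mu_R + Z] is twice the squared norm of [N]. *)
Lemma kn_exists (x : qdata C m 1) (tau : C) : tau != 0 -> mu_C x = - tau%:M ->
  (forall g, g \in unitmx -> comm g -> comm (mu_R (gauge g x))) ->
  exists g, [/\ g \in unitmx, comm g &
    mu_R (gauge g x) = - \sum_k rc (zeta k) *: e k].
Proof.
move=> t0 muE mc; have [g [gu cg gmin]] := psi_min t0 muE.
exists g; split; [exact: gu | exact: cg | set x1 := gauge g x; set Z := \sum_k _].
pose N := mu_R x1 + Z.
suff N0 : N = 0 by apply/eqP; rewrite -addr_eq0; apply/eqP.
have cZ : comm Z.
  rewrite /Z; elim/big_rec: _ => [s _|k A _ cA]; first by rewrite mul0mx mulmx0.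
  by apply: commsD => //; apply: commsZ.
have cN : comm N by apply: commsD => //; exact: mc.
have ZH : Z^t* = Z.
  rewrite /Z; elim/big_rec: _ => [|k A _ IH]; first by rewrite trmx0 map_mx0.
  by rewrite adjmxD adjmxZ rc_conj eH IH.
have NH : N^t* = N by rewrite adjmxD mu_R_herm ZH.
have [v vu [nu NE]] := herm_spectral NH.
(* The segment [1 + t N] is diagonal in the basis [v], but its block determinants require the
   eigenvalues of [e k *m N], which is Hermitian because [N] commutes with [e k] and has an
   eigenbasis of its own. *)
have /choice[va /choice[al alP]] : forall k, exists v, exists al, v \is unitarymx /\ e k *m N = hfun v al.
  move=> k; have [|w wu [b bE]] := @herm_spectral R m (e k *m N).
    by rewrite adjmxM NH eH (eC k cN).
  by exists w, b.
have [d1 d10 d1P] := small_positive nu.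
have [d2 d20 d2P] := small_positive (fun ka : 'I_K * 'I_m => al ka.1 ka.2).
pose F t := qline (gauge v x1) nu t + \sum_k zeta k * \sum_a ln ((1 + t * al k a) ^+ 2).
have FE t : `|t| < Num.min d1 d2 -> psi x1 (hfun v (fun a => 1 + t * nu a)) = F t.
  rewrite lt_min => /andP[/d1P h1 /d2P h2].
  have A : qn2 (gauge (hfun v (fun a => 1 + t * nu a)) x1) = qline (gauge v x1) nu t.
    have [vV _ _ vU] := unitarymxE vu.
    have [pU _] := hfun_inv vu (fun a => lt0r_neq0 (h1 a)).
    have [dU _] := rdiag_inv (fun a => lt0r_neq0 (h1 a)).
    rewrite -(qlineE _ h1) -(qn2_unitary _ vu) -(gaugeM _ vU pU) -(gaugeM _ dU vU).
    have -> : v *m hfun v (fun a => 1 + t * nu a) = rdiag (fun a => 1 + t * nu a) *m v.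
      by rewrite /hfun !mulmxA vV mul1mx.
    exact: erefl.
  have B : lsum e zeta (hfun v (fun a => 1 + t * nu a)) =
      \sum_k zeta k * \sum_a ln ((1 + t * al k a) ^+ 2).
    apply: eq_bigr => k _; have [wu E] := alP k.
    by rewrite (hfun_line _ _ vu) -NE (lpin_line wu E) // => a; exact: (h2 (k, a)).
  by rewrite psiE A B.
have slF : slope0 F (2 * \sum_a nu a * mudiag (gauge v x1) a +
    \sum_k zeta k * \sum_a 2 * al k a).
  apply: slope0D; first exact: slope0_qline.
  by apply: slope0_sum => k; apply: slope0Z; apply: slope0_sum => a; exact: slope0_ln.
clearbody F.
have h0 : hfun v (fun a => 1 + 0 * nu a) = 1%:M.
  by rewrite (hfun_line _ _ vu) rmorph0 scale0r addr0.
have d0 : 0 < Num.min d1 d2 by rewrite lt_min d10.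
have Fmin t : `|t| < Num.min d1 d2 -> F 0 <= F t.
  move=> ht; have := FE 0; rewrite normr0 h0 => /(_ d0) <-; have <- := FE t ht.
  have h1 : forall a, 0 < 1 + t * nu a by apply: d1P; move: ht; rewrite lt_min => /andP[].
  have [pU _] := hfun_inv vu (fun a => lt0r_neq0 (h1 a)).
  have ch : comm (hfun v (fun a => 1 + t * nu a)).
    by rewrite (hfun_line _ _ vu) -NE; apply: commsD; [exact: comms1 | exact: commsZ].
  have := gmin (hfun v (fun a => 1 + t * nu a) *m g).
  rewrite unitmx_mul pU gu => /(_ isT (commsM ch cg)).
  rewrite (psiM zeta eP eC x pU gu ch cg).
  have := psiM zeta eP eC x (unitmx1 _ _) gu comms1 cg; rewrite mul1mx => ->.
  rewrite -/x1; move: (psi x1 1%:M) (psi x1 (hfun _ _)) (lsum _ _ _) => a b c.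
  by rewrite lerD2r.
have := slope0_min slF d0 Fmin.
have -> : 2 * \sum_a nu a * mudiag (gauge v x1) a + \sum_k zeta k * \sum_a 2 * al k a
    = 2 * fro N.
  apply: rc_inj; rewrite rmorphD /= !rcM -mxtrace_fro NH.
  have T1 : rc (\sum_a nu a * mudiag (gauge v x1) a) = \tr (N *m mu_R x1).
    rewrite NE mxtrace_hfun rmorph_sum; apply: eq_bigr => a _.
    by rewrite rmorphM /= -mu_R_diag mu_R_unitary.
  have T2 : rc (\sum_k zeta k * \sum_a 2 * al k a) = rc 2 * \tr (N *m Z).
    rewrite rmorph_sum /Z mulmx_sumr [\tr _]raddf_sum mulr_sumr; apply: eq_bigr => k _ /=.
    rewrite rcM -mulr_sumr rcM -scalemxAr mxtraceZ (eC k cN).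
    have [wu ->] := alP k; rewrite (mxtrace_hfun1 wu).
    by rewrite mulrCA.
  by rewrite T1 T2 -mulrDr -raddfD -mulmxDr.
move/eqP; rewrite mulf_eq0 pnatr_eq0 /= => /eqP f0.
exact: fro_eq0.
Qed.

End Existence.

(** * Real-valued norms, and differentiability as an estimate in [R] *)

Section RealNorm.
Context {R : realType}.
Local Notation C := (cplx R).

Definition rn (V : normedModType C) (v : V) : R := nm `|v|.

Section Basic.
Context {V : normedModType C}.
Implicit Types u v : V.

Lemma rc_rn v : rc (rn v) = `|v|.
Proof. by rewrite /rn rc_nm normr_id. Qed.

Lemma rn_ge0 v : 0 <= rn v. Proof. exact: nm_ge0. Qed.

Lemma rn_le v (r : R) : (rn v <= r) = (`|v| <= rc r).
Proof. by rewrite -rc_rn rc_le. Qed.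

Lemma rnD u v : rn (u + v) <= rn u + rn v.
Proof. by rewrite rn_le rmorphD /= !rc_rn ler_normD. Qed.

Lemma rnN v : rn (- v) = rn v.
Proof. by rewrite /rn normrN. Qed.

Lemma rnB u v : rn (u - v) <= rn u + rn v.
Proof. by rewrite -(rnN v) rnD. Qed.

Lemma rnC u v : rn (u - v) = rn (v - u).
Proof. by rewrite -rnN opprB. Qed.

Lemma rn0 : rn (0 : V) = 0.
Proof. by apply: rc_inj; rewrite rc_rn normr0 rmorph0. Qed.

Lemma rn_eq0 v : rn v = 0 -> v = 0.
Proof. by move=> h; apply/eqP; rewrite -normr_eq0 -rc_rn h rmorph0. Qed.

Lemma rnZ (a : C) v : rn (a *: v) = nm a * rn v.
Proof. by apply: rc_inj; rewrite rcM rc_nm !rc_rn normrZ. Qed.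

Lemma rn_sum (I : Type) (r : seq I) (F : I -> V) :
  rn (\sum_(i <- r) F i) <= \sum_(i <- r) rn (F i).
Proof.
elim: r => [|i r IH]; first by rewrite !big_nil rn0.
by rewrite !big_cons (le_trans (rnD _ _)) // lerD2l.
Qed.

Lemma near_rn (v : V) (P : V -> Prop) :
  (\forall u \near v, P u) <-> exists2 d : R, 0 < d & forall u, rn (u - v) < d -> P u.
Proof.
split.
  move=> /nbhs_normP[e /= e0 eP]; exists (rp e).
    by rewrite -rc_gt0 rc_rp // gtr0_real.
  move=> u uv; apply: eP; rewrite /= -rc_rn -(rc_rp (gtr0_real e0)) rc_lt rnC.
  exact: uv.
move=> [d d0 dP]; apply/nbhs_normP; exists (rc d); first by rewrite /= rc_gt0.
by move=> u /=; rewrite -rc_rn rc_lt => h; apply: dP; rewrite rnC.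
Qed.

End Basic.

Section Diff.
Context {V W : normedModType C}.

Definition lbounded (f : V -> W) := exists K : R, forall v, rn (f v) <= K * rn v.

Lemma lbounded_continuous (f : {linear V -> W}) : lbounded f -> continuous f.
Proof.
move=> [K KP]; have K1 : 0 < 1 + `|K| by rewrite ltr_wpDr.
move=> v; apply/cvgrPdist_lt => e e0; apply/near_rn.
exists (rp e / (1 + `|K|)).
  by rewrite divr_gt0 // -rc_gt0 rc_rp // gtr0_real.
move=> u uv; rewrite -rc_rn -(rc_rp (gtr0_real e0)) rc_lt -linearB.
apply: le_lt_trans (KP _) _; rewrite rnC in uv.
rewrite ltr_pdivlMr // in uv; apply: le_lt_trans uv.
rewrite mulrC ler_wpM2l ?rn_ge0 //; have := ler_norm K; lra.
Qed.

Lemma continuous_lbounded (f : {linear V -> W}) : continuous f -> lbounded f.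
Proof.
move=> /linear_bounded_continuous/linear_boundedP[M [Mr MP]].
pose M1 := M + 1; have M1P : forall v, `|f v| <= M1 * `|v|.
  by apply: MP; rewrite /M1 ltrDl.
exists (nm M1) => v; rewrite -rc_le rcM !rc_rn rc_nm.
apply: le_trans (M1P v) _; rewrite ler_wpM2r //; apply: real_ler_norm.
by rewrite /M1 realD.
Qed.

(** With its converse [diff_intro], this replaces the little-o formulation by an estimate with real
    [e] and [d], which can then be restricted to subsets. *)
Lemma diff_elim (f : V -> W) (v : V) : differentiable f v ->
  exists df : {linear V -> W}, lbounded df /\ forall e : R, 0 < e ->
    exists2 d : R, 0 < d & forall u, rn (u - v) < d ->
      rn (f u - f v - df (u - v)) <= e * rn (u - v).
Proof.
move=> df; exists ('d f v); split; first exact/continuous_lbounded/diff_continuous.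
move=> e e0; have := diff_locally df; move=> /eqaddoP /(_ (rc e)).
rewrite rc_gt0 => /(_ e0) /near_rn[d d0 dP]; exists d => // u uv.
have := dP (u - v); rewrite subr0 => /(_ uv).
rewrite -[X in `|X|]/(f ((u - v) + v) - (f v + 'd f v (u - v))).
by rewrite subrK rn_le rcM rc_rn opprD addrA.
Qed.

Lemma diff_intro (f : V -> W) (v : V) (df : {linear V -> W}) : lbounded df ->
  (forall e : R, 0 < e -> exists2 d : R, 0 < d & forall u, rn (u - v) < d ->
      rn (f u - f v - df (u - v)) <= e * rn (u - v)) -> differentiable f v.
Proof.
move=> /lbounded_continuous cdf fP.
have E : f \o shift v = cst (f v) + df +o_ 0 id.
  apply/eqaddoP => e e0; have er := rc_rp (gtr0_real e0).
  have [|d d0 dP] := fP (rp e); first by rewrite -rc_gt0 er.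
  apply/near_rn; exists d => // u; rewrite subr0 => ud.
  have := dP (u + v); rewrite addrK => /(_ ud).
  rewrite -[X in _ -> is_true (`|X| <= _)]/(f (u + v) - (f v + df u)).
  by rewrite rn_le rcM rc_rn er opprD addrA.
apply/diff_locallyP; rewrite (diff_unique cdf E); split; [exact: cdf | exact: E].
Qed.

End Diff.

Section Norms.

Lemma rn_entry m n (A : 'M[C]_(m, n)) i j : nm (A i j) <= rn A.
Proof.
rewrite -rc_le rc_nm rc_rn.
suff : `|A i j| <= mx_norm A by [].
by rewrite mx_normE -[leLHS]nngE num_le; exact: (le_bigmax _ _ (i, j)).
Qed.

Lemma rn_mx_le m n (A : 'M[C]_(m, n)) (c : R) : 0 <= c ->
  (forall i j, nm (A i j) <= c) -> rn A <= c.
Proof.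
move=> c0 Ac; rewrite rn_le.
suff : mx_norm A <= rc c by [].
have c0' : 0 <= rc c by rewrite rc_ge0.
rewrite mx_normE -[rc c]/((NngNum c0')%:num) num_le; apply/bigmax_leP; split=> [|ij _].
  by rewrite -num_le.
by rewrite -num_le /= -rc_nm rc_le.
Qed.

Lemma rn_mulmx m n p (A : 'M[C]_(m, n)) (B : 'M[C]_(n, p)) :
  rn (A *m B) <= n%:R * (rn A * rn B).
Proof.
apply: rn_mx_le; first by rewrite !mulr_ge0 ?rn_ge0.
move=> i j; rewrite nm_le rcM mulrC rmorph_nat mulr_natr rcM.
by apply: mulmx_bound => k l; rewrite -nm_le rn_entry.
Qed.

Lemma rn_adj m n (A : 'M[C]_(m, n)) : rn (A^t*) <= rn A.
Proof.
apply: rn_mx_le; first exact: rn_ge0.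
by move=> i j; rewrite !mxE -rc_le rc_nm norm_conjC -rc_nm rc_le rn_entry.
Qed.

Context {U V : normedModType C}.

Lemma rn_fst (x : U * V) : rn x.1 <= rn x.
Proof.
rewrite rn_le rc_rn prod_normE comparable_le_max ?lexx //.
by apply: real_comparable; exact: normr_real.
Qed.

Lemma rn_snd (x : U * V) : rn x.2 <= rn x.
Proof.
rewrite rn_le rc_rn prod_normE comparable_le_max ?lexx ?orbT //.
by apply: real_comparable; exact: normr_real.
Qed.

Lemma rn_pair (x : U * V) (c : R) : rn x.1 <= c -> rn x.2 <= c -> rn x <= c.
Proof.
rewrite !rn_le => h1 h2; rewrite prod_normE comparable_ge_max ?h1 ?h2 //.
by apply: real_comparable; exact: normr_real.
Qed.

End Norms.

Section QdataNorm.
Context {m w : nat}.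
Local Notation E := (qdata C m w).
Implicit Types x : E.

Lemma rn_qB1 x : rn (qB1 x) <= rn x.
Proof. exact: le_trans (rn_fst _) (le_trans (rn_fst _) (rn_fst _)). Qed.

Lemma rn_qB2 x : rn (qB2 x) <= rn x.
Proof. exact: le_trans (rn_snd _) (le_trans (rn_fst _) (rn_fst _)). Qed.

Lemma rn_qi x : rn (qi x) <= rn x.
Proof. exact: le_trans (rn_snd _) (rn_fst _). Qed.

Lemma rn_qj x : rn (qj x) <= rn x.
Proof. exact: rn_snd. Qed.

Lemma mx_lbounded n p (W : normedModType C) (f : {linear 'M[C]_(n, p) -> W}) : lbounded f.
Proof.
exists (\sum_i \sum_j rn (f (delta_mx i j))) => A.
rewrite [A in X in X <= _]matrix_sum_delta linear_sum mulr_suml.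
apply: le_trans (rn_sum _ _) _; apply: ler_sum => i _.
rewrite linear_sum mulr_suml; apply: le_trans (rn_sum _ _) _; apply: ler_sum => j _.
by rewrite linearZ rnZ mulrC ler_wpM2l ?rn_ge0 ?rn_entry.
Qed.

End QdataNorm.
End RealNorm.

(** * Real differentials and Newton's method *)

Section Rdiff.
Context {R : realType}.
Local Notation C := (cplx R).

(** Differentiability along [S]: only increments inside [S] are tested, but the differential is
    complex linear. On a full neighbourhood this is ordinary complex differentiability
    ([rdiff_diff]); in general [l] is not unique. *)
Definition rdiff (V W : normedModType C) (S : set V) (f : V -> W) (v : V) :=
  exists l : {linear V -> W}, lbounded l /\ forall e : R, 0 < e ->
    exists2 d : R, 0 < d & forall u, S u -> rn (u - v) < d ->
      rn (f u - f v - l (u - v)) <= e * rn (u - v).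

Lemma diff_rdiff (V W : normedModType C) (S : set V) (f : V -> W) v :
  differentiable f v -> rdiff S f v.
Proof.
move=> /diff_elim[l [lb h]]; exists l; split=> // e /h[d d0 dP].
by exists d => // u _; exact: dP.
Qed.

Lemma rdiff_diff (V W : normedModType C) (S : set V) (f : V -> W) v (r : R) :
  0 < r -> (forall u, rn (u - v) < r -> S u) -> rdiff S f v -> differentiable f v.
Proof.
move=> r0 rS [l [lb h]]; apply: (diff_intro lb) => e /h[d d0 dP].
exists (Num.min d r); first by rewrite lt_min d0.
by move=> u; rewrite lt_min => /andP[ud ur]; apply: dP ud; exact: rS.
Qed.

Lemma lbounded_ge (V W : normedModType C) (f : V -> W) : lbounded f ->
  exists2 K : R, 0 < K & forall v, rn (f v) <= K * rn v.
Proof.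
move=> [K KP]; exists (1 + `|K|); first by rewrite ltr_wpDr.
move=> v; apply: le_trans (KP v) _; rewrite ler_wpM2r ?rn_ge0 //.
by have := ler_norm K; lra.
Qed.

Lemma rdiff_lip (V W : normedModType C) (S : set V) (f : V -> W) v : rdiff S f v ->
  exists K d : R, [/\ 0 < K, 0 < d & forall u, S u -> rn (u - v) < d ->
    rn (f u - f v) <= K * rn (u - v)].
Proof.
move=> [l [/lbounded_ge[K K0 KP] /(_ 1 ltr01)[d d0 dP]]]; exists (K + 1), d; split=> //.
  exact: addr_gt0.
move=> u Su ud; have := dP u Su ud; have := KP (u - v).
have := rnD (f u - f v - l (u - v)) (l (u - v)); rewrite subrK.
move: (rn (f u - f v)) (rn _) (rn (l _)) (rn _) => a b c d'; lra.
Qed.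

Lemma rdiff_comp (U V W : normedModType C) (S : set U) (S' : set V)
    (f : U -> V) (g : V -> W) v (r : R) : 0 < r ->
  (forall u, S u -> rn (u - v) < r -> S' (f u)) ->
  rdiff S f v -> rdiff S' g (f v) -> rdiff S (g \o f) v.
Proof.
move=> r0 rS fd [l' [/lbounded_ge[K' K'0 K'P] h']].
have [K [d1 [K0 d10 lip]]] := rdiff_lip fd.
have [l [/lbounded_ge[L L0 LP] h]] := fd.
exists (l' \o l); split.
  exists (K' * L) => u /=; apply: le_trans (K'P _) _.
  by rewrite -mulrA ler_wpM2l // ltW.
move=> e e0.
have [d2 d20 d2P] := h (e / (2 * K')) (divr_gt0 e0 (mulr_gt0 (ltr0n R 2) K'0)).
have [d3 d30 d3P] := h' (e / (2 * K)) (divr_gt0 e0 (mulr_gt0 (ltr0n R 2) K0)).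
exists (Num.min (Num.min d1 d2) (Num.min r (d3 / K))).
  by rewrite !lt_min d10 d20 r0 divr_gt0.
move=> u Su; rewrite !lt_min => /andP[/andP[u1 u2] /andP[ur u3]] /=.
have B1 := lip u Su u1; have B2 := d2P u Su u2.
have {}u3 : rn (f u - f v) < d3.
  by apply: le_lt_trans B1 _; rewrite mulrC -ltr_pdivlMr.
have B3 := d3P (f u) (rS u Su ur) u3.
have B4 := K'P (f u - f v - l (u - v)).
have E : g (f u) - g (f v) - l' (l (u - v)) =
    (g (f u) - g (f v) - l' (f u - f v)) + l' (f u - f v - l (u - v)).
  by rewrite [l' (_ - l _)]linearB addrA subrK.
rewrite E; apply: le_trans (rnD _ _) _.
have B5 : e / (2 * K) * rn (f u - f v) <= e / 2 * rn (u - v).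
  apply: le_trans (ler_wpM2l _ B1) _; first by rewrite ltW // divr_gt0 // mulr_gt0.
  have -> : e / (2 * K) * (K * rn (u - v)) = e / 2 * rn (u - v); last by [].
  by move: (rn (u - v)) => t; field; rewrite gt_eqF.
have B6 : K' * rn (f u - f v - l (u - v)) <= e / 2 * rn (u - v).
  apply: le_trans (ler_wpM2l (ltW K'0) B2) _.
  have -> : K' * (e / (2 * K') * rn (u - v)) = e / 2 * rn (u - v); last by [].
  by move: (rn (u - v)) => t; field; rewrite gt_eqF.
have := le_trans B3 B5; have := le_trans B4 B6.
have : e / 2 * rn (u - v) + e / 2 * rn (u - v) = e * rn (u - v) by rewrite -mulrDl -splitr.
by move=> <- h1 h2; exact: lerD h2 h1.
Qed.

Lemma rdiff_eq (V W : normedModType C) (S : set V) (f g : V -> W) v (r : R) :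
  0 < r -> (forall u, S u -> rn (u - v) < r -> f u = g u) -> f v = g v ->
  rdiff S f v -> rdiff S g v.
Proof.
move=> r0 rS fv [l [lb h]]; exists l; split=> // e /h[d d0 dP].
exists (Num.min d r); first by rewrite lt_min d0.
by move=> u Su; rewrite lt_min => /andP[ud ur]; rewrite -fv -rS //; exact: dP.
Qed.
End Rdiff.

Section Arithmetic.
Context {R : realFieldType}.
Implicit Types a b c d q r s t : R.

Lemma le_half_eq0 t : 0 <= t -> t <= 2^-1 * t -> t = 0. Proof. lra. Qed.

Lemma le_half_half_eq0 a b : 0 <= a -> a <= b -> b <= 2^-1 * a -> a = 0. Proof. lra. Qed.

Lemma le_radius a s t x r : x <= s + t -> t <= r / 2 -> s <= 2^-1 * a -> a <= r -> x <= r.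
Proof. lra. Qed.

Lemma le_center a b c d : a <= b + d -> d <= c + c -> b <= 1 -> a <= 2 * c + 1.
Proof. lra. Qed.

Lemma lt_center c : 0 <= c -> 0 < 2 * c + 1. Proof. lra. Qed.

Lemma le_midpoint (l k a b q r : R) : l <= k * q -> q <= a + b -> a <= r -> b <= r -> 0 < k ->
  2^-1 * l <= k * r.
Proof.
move=> h1 h2 h3 h4 h5; have : k * q <= k * (r + r) by rewrite ler_wpM2l ?(ltW h5) //; lra.
rewrite mulrDr; lra.
Qed.

Lemma le_contract a b c d : c <= 2^-1 * a -> b <= 2^-1 * d -> a <= c + b -> a <= d.
Proof. lra. Qed.

Lemma le_midpoint2 l k kr c d y z y' z' s t w : l <= k -> k <= kr ->
  z <= z' + c -> y <= y' + c -> z' <= d -> y' <= d -> s <= z + l -> t <= y + l -> w <= s + t ->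
  w <= 2 * (c + d + kr).
Proof. lra. Qed.

End Arithmetic.

Lemma rn_continuous (R : realType) (V : normedModType (cplx R)) : continuous (@rn R V).
Proof.
move=> v; apply: (@continuous_comp V (cplx R) R (fun v => `|v|) (@nm R)); last exact: nm_continuous.
exact: norm_continuous.
Qed.

Section Retraction.
Context {R : realType} {m : nat}.
Local Notation C := (cplx R).
Local Notation E := (qdata C m 1).

(** Four products have inner dimension [m] and two have inner dimension 1, whence [4 m + 2]. *)
Lemma bil_le (x v : E) : rn (bil x v) <= (4 * m%:R + 2) * (rn x * rn v).
Proof.
have h n (A : 'M[C]_(m, n)) (B : 'M[C]_(n, m)) a b : rn A <= a -> rn B <= b ->
    rn (A *m B) <= n%:R * (a * b).
  move=> Aa Bb; apply: le_trans (rn_mulmx _ _) _; rewrite ler_wpM2l //.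
  by apply: ler_pM; rewrite ?rn_ge0.
have hD A B a b : rn A <= a -> rn B <= b -> rn (A + B : 'M[C]_m) <= a + b.
  by move=> Aa Bb; apply: le_trans (rnD _ _) _; exact: lerD.
have hB A B a b : rn A <= a -> rn B <= b -> rn (A - B : 'M[C]_m) <= a + b.
  by move=> Aa Bb; apply: le_trans (rnB _ _) _; exact: lerD.
have E : (4 * m%:R + 2) * (rn x * rn v) = m%:R * (rn x * rn v) + m%:R * (rn v * rn x)
    + (m%:R * (rn v * rn x) + m%:R * (rn x * rn v)) + 1%:R * (rn x * rn v) + 1%:R * (rn v * rn x).
  move: (rn x) (rn v) (m%:R : R) => a b c; ring.
rewrite E /bil; apply: (hD); last exact: h (rn_qi v) (rn_qj x).
apply: (hD); last exact: h (rn_qi x) (rn_qj v).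
by apply: (hD); apply: (hB); apply: (h); rewrite ?rn_qB1 ?rn_qB2.
Qed.

Lemma mu_CD (x v : E) : mu_C (x + v) = mu_C x + bil x v + mu_C v.
Proof. by rewrite bilE -addrA subrK addrC subrK. Qed.

Lemma mu_CB (x v : E) : mu_C x - mu_C v = 2^-1 *: bil (x + v) (x - v).
Proof. by rewrite mu_C_diff scalerA mulVf ?scale1r. Qed.

Lemma mu_C_level_diff (x y : E) : mu_C x = mu_C y -> mu_C (y - x) = - bil x (y - x).
Proof.
have := mu_CD x (y - x); rewrite addrC subrK => -> h.
have : bil x (y - x) + mu_C (y - x) = 0 by apply: (addrI (mu_C x)); rewrite addrA -h addr0.
by move/eqP; rewrite addrC addr_eq0 => /eqP.
Qed.

Lemma bil_linear_l (a : C) (x y v : E) : bil (a *: x + y) v = a *: bil x v + bil y v.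
Proof. by rewrite [LHS]bilC (bil_linear v a x y) (bilC v x) (bilC v y). Qed.

Lemma bilDl (x y v : E) : bil (x + y) v = bil x v + bil y v.
Proof. by have := bil_linear_l 1 x y v; rewrite !scale1r. Qed.

Lemma bilBl (x y v : E) : bil (x - y) v = bil x v - bil y v.
Proof. by have := bil_linear_l (-1) y x v; rewrite !scaleN1r addrC => ->; rewrite addrC. Qed.

Lemma bilZl (a : C) (x v : E) : bil (a *: x) v = a *: bil x v.
Proof.
by have := bil_linear_l a x (x - x) v; rewrite bilBl !subrr !addr0.
Qed.

Lemma nm_half : nm (2^-1 : C) = 2^-1.
Proof. by rewrite -(rmorph_nat rc 2) -fmorphV nm_rc ger0_norm. Qed.

Lemma newton_radii (x0 : E) (KL : R) : 0 < KL -> exists r d : R, [/\ 0 < r, 0 < d,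
  forall z : E, rn z <= d + KL * r -> (4 * m%:R + 2) * (rn z * KL) <= 2^-1
  & forall y : E, rn (y - x0) <= d -> rn (mu_C y - mu_C x0) <= r / 2].
Proof.
move=> KL0; have : 0 < 4 * m%:R + 2 :> R by rewrite ltr_wpDl ?mulr_ge0.
have bl := @bil_le; move: bl; move: (4 * m%:R + 2 : R) => Kb bl Kb0.
have q0 : 0 < 2 * rn x0 + 1 by exact/lt_center/rn_ge0.
(* Then [KL r = 1 / (4 Kb KL)], and the first bound on [d] is the same number, so [d + KL r] is at
   most [1 / (2 Kb KL)], the threshold for contraction by 1/2. The last bound on [d] makes the
   initial defect at most [r / 2], because the norm of [y + x0] is at most [2 |x0| + 1]. *)
pose r := (4 * Kb * KL ^+ 2)^-1.
have r0 : 0 < r by rewrite invr_gt0 !mulr_gt0 // exprn_gt0.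
exists r, (Num.min (4 * Kb * KL)^-1 (Num.min 1 (r / (Kb * (2 * rn x0 + 1))))); split=> //.
- by rewrite !lt_min ltr01 invr_gt0 divr_gt0 ?mulr_gt0.
- move=> z; rewrite (_ : KL * r = (4 * Kb * KL)^-1); last first.
    by rewrite /r; field; rewrite !gt_eqF.
  set d := Num.min _ _ => zr.
  have {}zr : rn z <= 2 * (4 * Kb * KL)^-1.
    by apply: le_trans zr _; rewrite [leRHS]mulr_natl mulr2n lerD2r /d ge_min lexx.
  have := ler_wpM2l (ltW Kb0) (ler_wpM2r (ltW KL0) zr).
  have -> : Kb * (2 * (4 * Kb * KL)^-1 * KL) = 2^-1 by field; rewrite !gt_eqF.
  exact: id.
- move=> y yd; have [d1 d2] : rn (y - x0) <= 1 /\ rn (y - x0) <= r / (Kb * (2 * rn x0 + 1)).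
    by split; apply: le_trans yd _; rewrite !ge_min lexx ?orbT.
  have h : rn (y + x0) <= 2 * rn x0 + 1.
    have := rnD (y - x0) (2 *: x0); rewrite scaler_nat mulr2n addrA subrK => h.
    exact: le_center h (rnD _ _) d1.
  rewrite mu_CB rnZ nm_half mulrC ler_wpM2r ?invr_ge0 //.
  apply: le_trans (bl _ _) _.
  have := ler_pM (rn_ge0 _) (rn_ge0 _) h d2 => /(ler_wpM2l (ltW Kb0)).
  have -> : Kb * ((2 * rn x0 + 1) * (r / (Kb * (2 * rn x0 + 1)))) = r; last exact: id.
  by clear -q0 Kb0; move: (2 * rn x0 + 1) q0 r => q q0 t; field; rewrite !gt_eqF.
Qed.
End Retraction.

Section Newton.
Context {R : realType} {m : nat}.
Local Notation C := (cplx R).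
Local Notation E := (qdata C m 1).
Variables (x0 : E) (tau : C) (F : set E) (P : set 'M[C]_m) (L1 : {linear 'M[C]_m -> E}).
Hypothesis x0l : mu_C x0 = - tau%:M.
Hypothesis FD : forall x y, F x -> F y -> F (x + y).
Hypothesis FL : forall a, F (L1 a).
Hypothesis Pcl : closed P.
Hypothesis PB : forall a b, P a -> P b -> P (a - b).
Hypothesis Ps : P tau%:M.
Hypothesis Pmu : forall x, F x -> P (mu_C x).
Hypothesis L1P : forall a, P a -> bil x0 (L1 a) = a.

(** Newton's iteration with the derivative frozen at [x0]; a fixed point [a] puts [y + L1 a] on the
    level set. In the application [F] is the fixed subspace, [P] the commutant, and [L1] an averaged
    right inverse of [bil x0]. *)
Definition newton (y : E) (a : 'M[C]_m) : 'M[C]_m := a - (mu_C (y + L1 a) + tau%:M).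

(** An identity, not an estimate, because [mu_C] is quadratic: the first argument of [bil] is the
    displacement from [x0] of the midpoint of [y + L1 a] and [y + L1 b]. *)
Lemma newtonB y a b : P a -> P b ->
  newton y a - newton y b = - bil (y - x0 + 2^-1 *: L1 (a + b)) (L1 (a - b)).
Proof.
move=> Pa Pb; have H := L1P (PB Pa Pb).
have E1 : y + L1 a + (y + L1 b) = 2 *: y + L1 (a + b).
  by rewrite linearD addrACA scaler_nat mulr2n.
have E2 : y + L1 a - (y + L1 b) = L1 (a - b) by rewrite linearB opprD addrACA subrr add0r.
have : mu_C (y + L1 a) - mu_C (y + L1 b) = bil (y + 2^-1 *: L1 (a + b)) (L1 (a - b)).
  by rewrite mu_CB E1 E2 !bilDl !bilZl scalerDr scalerA mulVf ?scale1r.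
move=> E3; rewrite /newton.
have -> : y - x0 + 2^-1 *: L1 (a + b) = (y + 2^-1 *: L1 (a + b)) - x0 by rewrite addrAC.
rewrite bilBl -E3 H; move: (mu_C _) (mu_C _) => A B.
by apply/matrixP=> i j; rewrite !mxent; ring.
Qed.

Variables (r d KL Kb : R).
Hypothesis KL0 : 0 < KL.
Hypothesis KLP : forall a, rn (L1 a) <= KL * rn a.
Hypothesis Kb0 : 0 < Kb.
Hypothesis KbP : forall x v : E, rn (bil x v) <= Kb * (rn x * rn v).
Hypothesis r0 : 0 < r.
Hypothesis d0 : 0 < d.
Hypothesis small : forall z : E, rn z <= d + KL * r -> Kb * (rn z * KL) <= 2^-1.
Hypothesis mu_small : forall y : E, rn (y - x0) <= d -> rn (mu_C y - mu_C x0) <= r / 2.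

Lemma newton_small (z : E) b : rn z <= d + KL * r -> rn (bil z (L1 b)) <= 2^-1 * rn b.
Proof.
move=> zr; apply: le_trans (KbP _ _) _.
apply: le_trans (ler_wpM2l (ltW Kb0) (ler_wpM2l (rn_ge0 _) (KLP b))) _.
by rewrite !mulrA -(mulrA Kb); apply: ler_wpM2r; [exact: rn_ge0 | exact: small].
Qed.

Lemma newton_contract y a b : rn (y - x0) <= d -> P a -> P b -> rn a <= r -> rn b <= r ->
  rn (newton y a - newton y b) <= 2^-1 * rn (a - b).
Proof.
move=> yd Pa Pb ar br; rewrite (newtonB y Pa Pb) rnN; apply: newton_small.
apply: le_trans (rnD _ _) _; apply: lerD yd _; rewrite rnZ nm_half.
exact: le_midpoint (KLP _) (rnD _ _) ar br KL0.
Qed.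

Lemma newton0 y : rn (y - x0) <= d -> rn (newton y 0) <= r / 2.
Proof.
move=> yd; rewrite /newton linear0 addr0 sub0r rnN -[tau%:M]opprK -x0l.
exact: mu_small.
Qed.

Let P0 : P 0. Proof. by rewrite -(subrr tau%:M); exact: PB. Qed.

Let PD a b : P a -> P b -> P (a + b).
Proof. by move=> Pa Pb; rewrite -[b]opprK; apply: (PB Pa); rewrite -[- b]add0r; exact: PB. Qed.

Lemma newtonP y a : F y -> P a -> P (newton y a).
Proof. by move=> Fy Pa; apply: PB => //; apply: PD => //; apply/Pmu/FD. Qed.

Lemma newton_ball y a : rn (y - x0) <= d -> P a -> rn a <= r -> rn (newton y a) <= r.
Proof.
move=> yd Pa ar; have r00 : rn (0 : 'M[C]_m) <= r by rewrite rn0 ltW.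
have h1 := newton_contract yd Pa P0 ar r00; rewrite subr0 in h1.
have h2 := rnD (newton y a - newton y 0) (newton y 0); rewrite subrK in h2.
exact: le_radius h2 (newton0 yd) h1 ar.
Qed.

Lemma compact_ball : compact [set a : 'M[C]_m | P a /\ rn a <= r].
Proof.
apply: (subclosed_compact _ (@compact_box R m m r)).
  rewrite (_ : mkset _ = [set g : 'M[C]_m | forall i j, nm (g i j) <= r] `&` P).
    by apply: closedI => //; apply: compact_closed; [exact: norm_hausdorff | exact: compact_box].
  apply/seteqP; split=> a [h1 h2]; split=> //.
    by move=> i j; exact: le_trans (rn_entry _ _ _) h2.
  by apply: rn_mx_le; [exact: ltW | exact: h1].
by move=> a [_ ar] i j; exact: le_trans (rn_entry _ _ _) ar.
Qed.

Lemma diff_mu_C (V : normedModType C) (f : V -> E) v : differentiable f v ->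
  differentiable (fun v => mu_C (f v)) v.
Proof.
move=> df; apply: differentiableD; last first.
  by apply: diff_mulmx; [exact: diff_qi | exact: diff_qj].
by apply: differentiableB; apply: diff_mulmx;
  by [exact: diff_qB1 | exact: diff_qB2].
Qed.

Lemma diff_lbounded (V W : normedModType C) (f : {linear V -> W}) v :
  lbounded f -> differentiable f v.
Proof. by move=> /lbounded_continuous cf; exact: linear_differentiable. Qed.

(** Instead of iterating, minimise the displacement of [newton y] over the compact ball in [P]. One
    further step halves the displacement, so its minimum is 0. *)
Lemma newton_fix y : F y -> rn (y - x0) <= d ->
  exists a, [/\ P a, rn a <= r & mu_C (y + L1 a) = - tau%:M].
Proof.
move=> Fy yd; pose ph a : R := rn (newton y a - a).
have phE a : ph a = rn (mu_C (y + L1 a) + tau%:M).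
  by rewrite /ph /newton addrAC subrr add0r rnN.
have S0 : [set a : 'M[C]_m | P a /\ rn a <= r] 0.
  by split; [exact: P0 | rewrite rn0 ltW].
have cph : {within [set a : 'M[C]_m | P a /\ rn a <= r], continuous ph}.
  apply: continuous_subspaceT => a.
  have -> : ph = @rn R _ \o (fun a => mu_C (y + L1 a) + tau%:M) by apply: funext => b; rewrite phE.
  apply: continuous_comp; last exact: rn_continuous.
  apply: differentiable_continuous; apply: differentiableD; last exact: differentiable_cst.
  apply: diff_mu_C; apply: differentiableD; first exact: differentiable_cst.
  by apply: diff_lbounded; exact: mx_lbounded.
have [a aS amin] := compact_EVT_min (ex_intro _ _ S0) compact_ball cph.
have [Pa ar] : P a /\ rn a <= r by move: aS; rewrite inE.
have [Pb br] : P (newton y a) /\ rn (newton y a) <= r.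
  by split; [exact: newtonP | exact: newton_ball].
have h1 := amin (newton y a) (mem_set (conj Pb br)).
have h2 : ph (newton y a) <= 2^-1 * ph a := newton_contract yd Pb Pa br ar.
have h3 : ph a = 0 := le_half_half_eq0 (rn_ge0 _) h1 h2.
exists a; split=> //; move: h3; rewrite phE => /rn_eq0 /eqP.
by rewrite addr_eq0 => /eqP.
Qed.

Definition nsol (y : E) : 'M[C]_m :=
  xget 0 [set a | [/\ P a, rn a <= r & mu_C (y + L1 a) = - tau%:M]].

Lemma nsolP y : F y -> rn (y - x0) <= d ->
  [/\ P (nsol y), rn (nsol y) <= r & mu_C (y + L1 (nsol y)) = - tau%:M].
Proof. by move=> Fy /(newton_fix Fy)[a aP]; exact: (@xgetI _ 0 [set a | [/\ P a, rn a <= r & mu_C (y + L1 a) = - tau%:M]] a aP). Qed.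

#[local] Opaque nsol.

Lemma newton_eq y a : mu_C (y + L1 a) = - tau%:M -> newton y a = a.
Proof. by rewrite /newton => ->; rewrite addNr subr0. Qed.

Lemma nsol0 y : F y -> rn (y - x0) <= d -> mu_C y = - tau%:M -> nsol y = 0.
Proof.
move=> Fy yd yl; have [Pa ar al] := nsolP Fy yd.
have r00 : rn (0 : 'M[C]_m) <= r by rewrite rn0 ltW.
have e0 : newton y 0 = 0 by apply: newton_eq; rewrite linear0 addr0.
have := newton_contract yd Pa P0 ar r00; rewrite (newton_eq al) e0 subr0 => h.
exact: rn_eq0 (le_half_eq0 (rn_ge0 _) h).
Qed.

Lemma newton_lip y z a b : rn (y - x0) <= d -> rn (z - x0) <= d ->
  P a -> rn a <= r -> mu_C (y + L1 a) = - tau%:M ->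
  P b -> rn b <= r -> mu_C (z + L1 b) = - tau%:M ->
  rn (b - a) <= Kb * (2 * (rn x0 + d + KL * r)) * rn (z - y).
Proof.
move=> yd zd Pa ar al Pb br bl.
have h := newton_contract zd Pb Pa br ar; rewrite (newton_eq bl) in h.
have E : newton z a - a = - (2^-1 *: bil ((z + L1 a) + (y + L1 a)) (z - y)).
  have -> : z - y = (z + L1 a) - (y + L1 a) by rewrite opprD addrACA subrr addr0.
  by rewrite -mu_CB al opprK /newton addrAC subrr add0r.
have h2 : rn (newton z a - a) <= 2^-1 * (Kb * (2 * (rn x0 + d + KL * r)) * rn (z - y)).
  rewrite E rnN rnZ nm_half ler_wpM2l ?invr_ge0 //.
  apply: le_trans (KbP _ _) _.
  rewrite -mulrA; apply: ler_wpM2l (ltW Kb0) _ _ _; apply: ler_wpM2r (rn_ge0 _) _ _ _.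
  have b3 := rnD (z - x0) x0; have b4 := rnD (y - x0) x0; rewrite subrK in b3; rewrite subrK in b4.
  exact: le_midpoint2 (KLP a) (ler_wpM2l (ltW KL0) ar) b3 b4 zd yd (rnD _ _) (rnD _ _) (rnD _ _).
have h3 := rnD (b - newton z a) (newton z a - a).
rewrite addrA subrK in h3.
exact: le_contract h h2 h3.
Qed.

Lemma nsol_lip y z : F y -> F z -> rn (y - x0) <= d -> rn (z - x0) <= d ->
  rn (nsol z - nsol y) <= Kb * (2 * (rn x0 + d + KL * r)) * rn (z - y).
Proof.
move=> Fy Fz yd zd; have [h1 h2 h3] := nsolP Fy yd; have [h4 h5 h6] := nsolP Fz zd.
exact: newton_lip yd zd h1 h2 h3 h4 h5 h6.
Qed.

Lemma mu_C_le (v : E) : rn (mu_C v) <= Kb * rn v ^+ 2.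
Proof.
have e0 : mu_C (0 : E) = 0.
  have [e1 e2 e3] : [/\ qB1 (0 : E) = 0, qB2 (0 : E) = 0 & qi (0 : E) = 0] by [].
  by rewrite /mu_C e1 e2 e3 !mul0mx subrr addr0.
have := mu_CB v 0; rewrite e0 addr0 !subr0 => ->; rewrite rnZ nm_half.
apply: le_trans (KbP _ _); rewrite ler_piMl ?rn_ge0 //; lra.
Qed.

Definition retr (y : E) : E := y + L1 (nsol y).

Lemma retr_rdiff y : F y -> rn (y - x0) < d -> rdiff F retr y.
Proof.
move=> Fy yd; have [Pa ar al] := nsolP Fy (ltW yd).
have XE : retr y = y + L1 (nsol y) by [].
have Xs b : rn (bil (retr y - x0) (L1 b)) <= 2^-1 * rn b.
  apply: newton_small; rewrite XE addrAC; apply: le_trans (rnD _ _) _.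
  apply: lerD (ltW yd) _; apply: le_trans (KLP _) _; exact: ler_wpM2l (ltW KL0) _ _ ar.
(* On [P], where [L1] is a right inverse of [bil x0], this agrees with [bil (retr y) \o L1]. In the
   present form it differs from the identity by an operator of norm at most 1/2 on all matrices, so
   it is invertible there. *)
pose S : {linear 'M[C]_m -> 'M[C]_m} := idfun \+ (bil (retr y - x0) \o L1).
have SE b : S b = b + bil (retr y - x0) (L1 b) by [].
have Si b : S b = 0 -> b = 0.
  rewrite SE => /eqP; rewrite addr_eq0 => /eqP bE; apply: rn_eq0.
  by apply: le_half_eq0 (rn_ge0 _) _; rewrite {1}bE rnN.
have [T ST] := inj_linear_inv Si.
have TS b : T (S b) = b.
  by apply: subr0_eq; apply: Si; rewrite linearB ST subrr.
have [KT KT0 KTP] := lbounded_ge (mx_lbounded T).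
pose l : {linear E -> E} := idfun \- (L1 \o (T \o bil (retr y))).
have lE v : l v = v - L1 (T (bil (retr y) v)) by [].
exists l; split.
  exists (1 + KL * (KT * (Kb * rn (retr y)))) => v; rewrite lE mulrDl mul1r.
  apply: le_trans (rnB _ _) _; rewrite lerD2l -!mulrA.
  apply: le_trans (KLP _) _; apply: ler_wpM2l (ltW KL0) _ _ _.
  by apply: le_trans (KTP _) _; apply: ler_wpM2l (ltW KT0) _ _ _; exact: KbP.
have retrL z : F z -> rn (z - x0) <= d -> rn (retr z - retr y) <=
    (1 + KL * (Kb * (2 * (rn x0 + d + KL * r)))) * rn (z - y).
  move=> Fz zd; rewrite /retr opprD addrACA -linearB mulrDl mul1r.
  apply: le_trans (rnD _ _) _; rewrite lerD2l -mulrA.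
  apply: le_trans (KLP _) _; apply: ler_wpM2l (ltW KL0) _ _ _.
  exact: nsol_lip Fy Fz (ltW yd) zd.
(* Both values of [retr] lie on the level set, so by [mu_C_level_diff] the differential applied to
   their difference is exactly minus its quadratic term. The error of the linear approximation is
   therefore quadratic, and the Lipschitz bound [retrL] finishes. *)
have main z : F z -> rn (z - x0) <= d ->
    retr z - retr y - l (z - y) = - L1 (T (mu_C (retr z - retr y))).
  move=> Fz zd; have [Pb br bl] := nsolP Fz zd.
  have DE : retr z - retr y = (z - y) + L1 (nsol z - nsol y).
    by rewrite /retr opprD addrACA -linearB.
  have mE : mu_C (retr z - retr y) = - bil (retr y) (retr z - retr y).
    exact: mu_C_level_diff (etrans al (esym bl)).
  have SD : S (nsol z - nsol y) = bil (retr y) (L1 (nsol z - nsol y)).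
    by rewrite SE bilBl (L1P (PB Pb Pa)) addrC subrK.
  have nE : nsol z - nsol y = T (bil (retr y) (L1 (nsol z - nsol y))) by rewrite -SD TS.
  have bE : bil (retr y) (retr z - retr y) =
      bil (retr y) (z - y) + bil (retr y) (L1 (nsol z - nsol y)) by rewrite DE linearD.
  rewrite mE (linearN T) (linearN L1) opprK bE (linearD T) -nE (linearD L1) lE DE opprB.
  by rewrite addrC addrA subrK.
set K := 1 + _ in retrL.
have K0 : 0 < K.
  rewrite /K; apply: (addr_gt0 ltr01); rewrite mulr_gt0 // mulr_gt0 // mulr_gt0 //.
  by apply: ltr_pwDr; [exact: mulr_gt0 | exact: addr_ge0 (rn_ge0 _) (ltW d0)].
have M0 : 0 < KL * (KT * (Kb * K ^+ 2)) by rewrite !mulr_gt0 // exprn_gt0.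
move=> e e0; exists (Num.min (d - rn (y - x0)) (e / (KL * (KT * (Kb * K ^+ 2))))).
  by rewrite lt_min subr_gt0 yd divr_gt0.
move=> z Fz; rewrite lt_min ltrBrDr => /andP[z1 z2].
have zd : rn (z - x0) <= d.
  have := rnD (z - y) (y - x0); rewrite addrA subrK => h; exact: le_trans h (ltW z1).
rewrite (main z Fz zd) rnN.
apply: le_trans (KLP _) _; apply: le_trans (ler_wpM2l (ltW KL0) (KTP _)) _.
apply: le_trans (ler_wpM2l (ltW KL0) (ler_wpM2l (ltW KT0) (mu_C_le _))) _.
have h := retrL z Fz zd.
have h2 : rn (retr z - retr y) ^+ 2 <= (K * rn (z - y)) ^+ 2.
  by apply: lerXn2r h; rewrite nnegrE ?rn_ge0 // mulr_ge0 ?rn_ge0 // ltW.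
apply: le_trans (ler_wpM2l (ltW KL0) (ler_wpM2l (ltW KT0) (ler_wpM2l (ltW Kb0) h2))) _.
have -> : KL * (KT * (Kb * (K * rn (z - y)) ^+ 2)) =
    KL * (KT * (Kb * K ^+ 2)) * rn (z - y) * rn (z - y).
  by move: (rn (z - y)) => t; rewrite exprMn expr2; move: (K ^+ 2) => t2; rewrite !mulrA.
by apply: ler_wpM2r (rn_ge0 _) _ _ _; rewrite mulrC -ler_pdivlMr // ltW.
Qed.

Lemma retr_fix y : F y -> rn (y - x0) <= d -> mu_C y = - tau%:M -> retr y = y.
Proof. by move=> Fy yd yl; rewrite /retr nsol0 // linear0 addr0. Qed.

Lemma retrP y : F y -> rn (y - x0) <= d -> F (retr y) /\ mu_C (retr y) = - tau%:M.
Proof. by move=> Fy yd; have [_ _ yl] := nsolP Fy yd; split; [exact: FD | exact: yl]. Qed.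
End Newton.

(** * Retraction onto the fixed level set *)

Lemma le_mul_add (R : realFieldType) (a b c k s t u : R) : 0 <= k -> a <= s -> b <= t -> c <= u ->
  0 <= a -> 0 <= b -> 0 <= c -> k * (a * (b + c)) <= k * (s * (t + u)).
Proof. by move=> k0 h1 h2 h3 a0 b0 c0; rewrite ler_wpM2l // ler_pM ?addr_ge0 // lerD. Qed.

Section Setting.
Context {R : realType} {gT : finGroupType}.
Local Notation C := (cplx R).
Implicit Types (G : {group gT}) (m : nat).

(* What the correspondence needs: the two representations are unitary, and
   every [Gamma]-fixed point of the level set meets [mu_R = Z]. *)
Record kn_setting G m (rho : gT -> 'M[C]_m) (sg : gT -> 'M[C]_2) (tau : C) (Z : 'M[C]_m) := {
  kn_rhoM : forall s t, s \in G -> t \in G -> rho (s * t)%g = rho s *m rho t;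
  kn_rho1 : rho 1%g = 1%:M;
  kn_rhoU : forall s, s \in G -> rho s \is unitarymx;
  kn_sgM : forall s t, s \in G -> t \in G -> sg (s * t)%g = sg s *m sg t;
  kn_sg1 : sg 1%g = 1%:M;
  kn_sgU : forall s, s \in G -> sg s \is unitarymx;
  kn_sgdet : forall s, s \in G -> \det (sg s) = 1;
  kn_tau : tau != 0;
  kn_Z : forall h, comms (fun s => s \in G) rho h -> h *m Z = Z *m h;
  kn_meet : forall x : qdata C m 1, fixd (G := G) rho sg x -> mu_C x = - tau%:M ->
    exists g, [/\ g \in unitmx, comms (fun s => s \in G) rho g & mu_R (gauge g x) = Z]
}.
End Setting.

Section Local.
Context {R : realType} {gT : finGroupType} {G : {group gT}} {m : nat}.
Local Notation C := (cplx R).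
Local Notation E := (qdata C m 1).
Context {rho : gT -> 'M[C]_m} {sg : gT -> 'M[C]_2} {tau : C} {Z : 'M[C]_m}.
Hypothesis H : kn_setting G rho sg tau Z.
Local Notation comm := (comms (fun s => s \in G) rho).
Local Notation fixd := (fixd (G := G) rho sg).

Definition fixlev : set E := [set x | fixd x /\ mu_C x = - tau%:M].
Definition hklev : set E := [set x | fixlev x /\ mu_R x = Z].

(** Averaging the right inverse of [bil_inv] keeps the Newton correction in the fixed subspace, and
    [bil_avgE] shows that it remains a right inverse on the commutant. *)
Lemma retraction (x0 : E) : fixlev x0 -> exists d : R, exists2 r : E -> E, 0 < d &
  forall y, fixd y -> rn (y - x0) < d ->
    [/\ fixlev (r y), rdiff (fixd : set E) r y & fixlev y -> r y = y].
Proof.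
move=> [x0f x0l]; have [g gP] := bil_inv (kn_tau H) x0l.
pose L1 : {linear 'M[C]_m -> E} := avgE (G := G) rho sg \o (adj_bil x0 \o g).
have [KL KL0 KLP] := lbounded_ge (mx_lbounded L1).
have L1P a : comm a -> bil x0 (L1 a) = a.
  move=> ca; rewrite /L1 /= (bil_avgE (kn_rhoM H) (kn_rho1 H) (kn_sgM H) (kn_sg1 H) (kn_sgdet H)) //.
  by rewrite gP (avgM_id (kn_rhoM H) (kn_rho1 H) ca).
have FD x y : fixd x -> fixd y -> fixd (x + y).
  exact: (fixdD (kn_sgM H) (kn_sg1 H)).
have FL a : fixd (L1 a) by exact: (avgE_fixd (kn_rhoM H) (kn_rho1 H) (kn_sgM H) (kn_sg1 H)).
have Pcl : closed (comm : set 'M[C]_m) := closed_comm.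
have PB a b : comm a -> comm b -> comm (a - b) by exact: commsB.
have Ps : comm tau%:M by move=> s _; rewrite scalar_mxC.
have Pmu x : fixd x -> comm (mu_C x).
  exact: (fixd_mu_C (kn_rhoM H) (kn_rho1 H) (kn_sgM H) (kn_sg1 H) (kn_sgdet H)).
have [r [d [r0 d0 small mu_small]]] := newton_radii x0 KL0.
have Kb0 : 0 < 4 * m%:R + 2 :> R by rewrite ltr_wpDl ?mulr_ge0.
exists d, (retr tau (comm : set _) L1 r) => // y Fy yd; split.
- exact: (retrP x0l FD FL Pcl PB Ps Pmu L1P KL0 KLP Kb0 (@bil_le _ _) r0 small mu_small Fy (ltW yd)).
- exact: (retr_rdiff x0l FD FL Pcl PB Ps Pmu L1P KL0 KLP Kb0 (@bil_le _ _) r0 d0 small mu_small Fy yd).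
- move=> [_ yl].
  exact: (retr_fix x0l FD FL Pcl PB Ps Pmu L1P KL0 KLP Kb0 (@bil_le _ _) r0 small mu_small Fy (ltW yd) yl).
Qed.

Lemma rn_gram n p (A B : 'M[C]_(n, p)) :
  rn (A *m A^t* - B *m B^t*) <= p%:R * (rn (A - B) * (rn A + rn B)).
Proof.
have -> : A *m A^t* - B *m B^t* = (A - B) *m A^t* + B *m (A - B)^t*.
  by rewrite adjmxD adjmxN mulmxBl mulmxBr addrA subrK.
apply: le_trans (rnD _ _) _; rewrite mulrDr [in X in _ <= X]mulrDr.
apply: lerD; apply: le_trans (rn_mulmx _ _) _; rewrite ler_wpM2l //.
  by rewrite ler_wpM2l ?rn_ge0 // rn_adj.
by rewrite mulrC ler_wpM2r ?rn_ge0 // rn_adj.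
Qed.

Lemma rn_gram' n p (A B : 'M[C]_(n, p)) :
  rn (A^t* *m A - B^t* *m B) <= n%:R * (rn (A - B) * (rn A + rn B)).
Proof.
rewrite -{2}[A]adjmxK -{2}[B]adjmxK; apply: le_trans (rn_gram _ _) _.
rewrite ler_wpM2l // -adjmxN -adjmxD; apply: ler_pM; rewrite ?rn_ge0 ?addr_ge0 ?rn_ge0 //.
  exact: rn_adj.
by apply: lerD; exact: rn_adj.
Qed.

Lemma mu_R_lip (x y : E) :
  rn (mu_R x - mu_R y) <= (4 * m%:R + 2) * (rn (x - y) * (rn x + rn y)).
Proof.
have hD (A B : 'M[C]_m) a b : rn A <= a -> rn B <= b -> rn (A + B) <= a + b.
  by move=> Aa Bb; apply: le_trans (rnD _ _) _; exact: lerD.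
have hB (A B : 'M[C]_m) a b : rn A <= a -> rn B <= b -> rn (A - B) <= a + b.
  by move=> Aa Bb; apply: le_trans (rnB _ _) _; exact: lerD.
have q (a b c k : R) : 0 <= k -> a <= rn (x - y) -> b <= rn x -> c <= rn y -> 0 <= a -> 0 <= b -> 0 <= c ->
    k * (a * (b + c)) <= k * (rn (x - y) * (rn x + rn y)).
  exact: le_mul_add.
have g n p (A B : 'M[C]_(n, p)) : rn (A - B) <= rn (x - y) -> rn A <= rn x -> rn B <= rn y ->
    rn (A *m A^t* - B *m B^t*) <= p%:R * (rn (x - y) * (rn x + rn y)).
  by move=> h1 h2 h3; apply: le_trans (rn_gram _ _) _; apply: q; rewrite ?rn_ge0.
have g' n p (A B : 'M[C]_(n, p)) : rn (A - B) <= rn (x - y) -> rn A <= rn x -> rn B <= rn y ->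
    rn (A^t* *m A - B^t* *m B) <= n%:R * (rn (x - y) * (rn x + rn y)).
  by move=> h1 h2 h3; apply: le_trans (rn_gram' _ _) _; apply: q; rewrite ?rn_ge0.
have -> : (4 * m%:R + 2) * (rn (x - y) * (rn x + rn y)) =
   m%:R * (rn (x - y) * (rn x + rn y)) + m%:R * (rn (x - y) * (rn x + rn y))
   + (m%:R * (rn (x - y) * (rn x + rn y)) + m%:R * (rn (x - y) * (rn x + rn y)))
   + 1%:R * (rn (x - y) * (rn x + rn y)) + 1%:R * (rn (x - y) * (rn x + rn y)).
  by move: (_ * (_ + _)) => t; ring.
have s1 : rn (qB1 x - qB1 y) <= rn (x - y) := rn_qB1 (x - y).
have s2 : rn (qB2 x - qB2 y) <= rn (x - y) := rn_qB2 (x - y).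
have s3 : rn (qi x - qi y) <= rn (x - y) := rn_qi (x - y).
have s4 : rn (qj x - qj y) <= rn (x - y) := rn_qj (x - y).
have -> : mu_R x - mu_R y =
  (qB1 x *m (qB1 x)^t* - qB1 y *m (qB1 y)^t*) - ((qB1 x)^t* *m qB1 x - (qB1 y)^t* *m qB1 y)
  + ((qB2 x *m (qB2 x)^t* - qB2 y *m (qB2 y)^t*) - ((qB2 x)^t* *m qB2 x - (qB2 y)^t* *m qB2 y))
  + (qi x *m (qi x)^t* - qi y *m (qi y)^t*) - ((qj x)^t* *m qj x - (qj y)^t* *m qj y).
  rewrite /mu_R; move: (_ *m _) (_ *m _) (_ *m _) (_ *m _) (_ *m _) (_ *m _).
  move=> a1 a2 a3 a4 a5 a6.
  move: (_ *m _) (_ *m _) (_ *m _) (_ *m _) (_ *m _) (_ *m _) => b1 b2 b3 b4 b5 b6.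
  by apply/matrixP => c d; rewrite !mxent; ring.
have t1 := g _ _ _ _ s1 (rn_qB1 x) (rn_qB1 y); have t1' := g' _ _ _ _ s1 (rn_qB1 x) (rn_qB1 y).
have t2 := g _ _ _ _ s2 (rn_qB2 x) (rn_qB2 y); have t2' := g' _ _ _ _ s2 (rn_qB2 x) (rn_qB2 y).
have t3 := g _ _ _ _ s3 (rn_qi x) (rn_qi y); have t4 := g' _ _ _ _ s4 (rn_qj x) (rn_qj y).
exact: hB (hD _ _ _ _ (hD _ _ _ _ (hB _ _ _ _ t1 t1') (hB _ _ _ _ t2 t2')) t3) t4.
Qed.

Lemma fro_le n p (A : 'M[C]_(n, p)) : fro A <= n%:R * (p%:R * rn A ^+ 2).
Proof.
rewrite /fro; apply: (@le_trans _ _ (\sum_(a < n) \sum_(b < p) rn A ^+ 2)).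
  apply: ler_sum => a _; apply: ler_sum => b _.
  by apply: lerXn2r; rewrite ?nnegrE ?nm_ge0 ?rn_ge0 // rn_entry.
have h (a : 'I_n) : true -> \sum_(b < p) rn A ^+ 2 = p%:R * rn A ^+ 2 :> R.
  by move=> _; rewrite sumr_const card_ord mulr_natl.
by rewrite (eq_bigr (fun=> p%:R * rn A ^+ 2) h) sumr_const card_ord [leRHS]mulr_natl.
Qed.

Lemma qn2_le (x : E) (r : R) : rn x <= r -> qn2 x <= (2 * m%:R * (m%:R + 1)) * r ^+ 2.
Proof.
move=> xr; have h n p (A : 'M[C]_(n, p)) : rn A <= rn x -> fro A <= n%:R * (p%:R * r ^+ 2).
  move=> Ax; apply: le_trans (fro_le A) _; rewrite !ler_wpM2l //.
  by apply: lerXn2r; rewrite ?nnegrE ?rn_ge0 ?(le_trans (rn_ge0 _) xr) // (le_trans Ax).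
have h1 := h _ _ _ (rn_qB1 x); have h2 := h _ _ _ (rn_qB2 x).
have h3 := h _ _ _ (rn_qi x); have h4 := h _ _ _ (rn_qj x).
have := lerD (lerD (lerD h1 h2) h3) h4; rewrite -/(qn2 x) => h5; apply: le_trans h5 _.
by rewrite le_eqVlt; apply/orP; left; apply/eqP; move: (r ^+ 2) (m%:R) => a b; ring.
Qed.

Lemma knK_mono (p q : R) : 0 <= p -> p <= q -> knK (m := m) tau p <= knK (m := m) tau q.
Proof.
move=> p0 pq; rewrite /knK ler_wpM2l ?mulr_ge0 ?exprn_ge0 //.
have kp := kappa_of_gt0 m (kn_tau H) p0; have kq := kappa_of_gt0 m (kn_tau H) (le_trans p0 pq).
rewrite lef_pV2 ?posrE ?exprn_gt0 //; apply: lerXn2r; rewrite ?nnegrE ?(ltW kp) ?(ltW kq) //.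
rewrite /kappa_of ler_wpM2l ?nm_ge0 // lef_pV2 ?posrE ?mulr_gt0 ?ltr_pwDl //.
- by rewrite ler_wpM2r // ler_wpM2l // lerD2l.
- exact: le_trans p0 pq.
Qed.
End Local.

Section Invariant.
Context {R : realType} {gT : finGroupType} {G : {group gT}} {m : nat}.
Local Notation C := (cplx R).
Local Notation E := (qdata C m 1).
Context {rho : gT -> 'M[C]_m} {sg : gT -> 'M[C]_2} {tau : C} {Z : 'M[C]_m}.
Hypothesis H : kn_setting G rho sg tau Z.
Local Notation comm := (comms (fun s => s \in G) rho).
Local Notation fixd := (fixd (G := G) rho sg).
Local Notation fixlev := (fixlev (G := G) (rho := rho) (sg := sg) (tau := tau)).
Local Notation hklev := (hklev (G := G) (rho := rho) (sg := sg) (tau := tau) (Z := Z)).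

Lemma fixlev_gauge g y : g \in unitmx -> comm g -> fixlev y -> fixlev (gauge g y).
Proof.
move=> gu cg [yf yl]; split; last first.
  by move: yl; rewrite -raddfN => /(mu_C_gauge_scalar gu).
exact: (fixd_gauge (kn_rhoM H) (kn_rho1 H) gu cg yf).
Qed.

Lemma hklev_gauge u y : u \is unitarymx -> comm u -> hklev y -> hklev (gauge u y).
Proof.
move=> uu cu [yf yZ]; have [u1 u2 ui uu'] := unitarymxE uu; split; first exact: fixlev_gauge.
by rewrite (mu_R_unitary _ uu) yZ (kn_Z H cu) -mulmxA u1 mulmx1.
Qed.

(* The polar part of the element carrying [y] to the hyper-Kaehler level set
   depends on [y] in a Lipschitz way. *)
Lemma polar_lip (y0 : E) : hklev y0 -> exists K d : R, [/\ 0 < K, 0 < d &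
  forall y, fixlev y -> rn (y - y0) < d -> exists p, [/\ p \in unitmx, comm p,
    hklev (gauge p y) & rn (p - 1%:M) <= K * rn (y - y0)]].
Proof.
(* For [y] within distance 1 of [y0], [r] bounds the norm, [Q] bounds [qn2 y], and [k] bounds the
   constant of [kn_near]; this makes the estimate uniform in [y]. The factor [c] converts the
   distance to [y0] into a bound on [Z - mu_R y]. *)
move=> [y0f y0Z]; have [r r1 rE] : exists2 r : R, 0 < r & r = rn y0 + 1.
  by eexists; last reflexivity; rewrite ltr_wpDl ?rn_ge0.
have y0r : rn y0 <= r by rewrite rE; apply: ler_wpDr.
pose Q := (2 * m%:R * (m%:R + 1)) * r ^+ 2 : R.
have Q0 : 0 <= Q by rewrite /Q mulr_ge0 ?exprn_ge0 ?(ltW r1) // !mulr_ge0 // addr_ge0.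
have m4 : 0 < 4 * m%:R + 2 :> R by rewrite ltr_wpDl ?mulr_ge0.
have [c c0 cE] : exists2 c : R, 0 < c & c = (4 * m%:R + 2) * (r + r).
  by eexists; last reflexivity; rewrite mulr_gt0 // addr_gt0.
have kQ0 : 0 <= knK (m := m) tau Q.
  by rewrite /knK !mulr_ge0 ?invr_ge0 ?exprn_ge0 // ltW // kappa_of_gt0 // (kn_tau H).
have [k k0 kE] : exists2 k : R, 0 < k & k = 1 + knK (m := m) tau Q.
  by eexists; last reflexivity; rewrite ltr_pwDl.
exists (1 + 4 * k * c * m%:R), (Num.min 1 (2 * k * c)^-1); split.
- by rewrite ltr_pwDl // !mulr_ge0 // ?(ltW k0) ?(ltW c0).
- by rewrite lt_min ltr01 invr_gt0 !mulr_gt0.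
move=> y yf; rewrite lt_min => /andP[y1 y2].
have yr : rn y <= r.
  have := rnD (y - y0) y0; rewrite subrK => h; apply: le_trans h _.
  by rewrite rE [X in X <= _]addrC lerD2l (ltW y1).
have [g [gu cg gZ]] := kn_meet H yf.1 yf.2.
have yq : knK (m := m) tau (qn2 y) <= k.
  apply: le_trans (knK_mono H (qn2_ge0 _) (qn2_le yr)) _; rewrite -/Q kE ler_wpDl //.
have dZ : rn (Z - mu_R y) <= c * rn (y - y0).
  rewrite -y0Z; apply: le_trans (mu_R_lip _ _) _; rewrite cE -!mulrA ler_wpM2l ?(ltW m4) //.
  rewrite rnC mulrC; apply: ler_wpM2r; [exact: rn_ge0 | exact: lerD y0r yr].
have [|| p [w [[pu cp _ _ _] [pZ p1]]]] :=
    kn_near (kn_rhoU H) (eps := c * rn (y - y0)) (kn_tau H) yf.2 gu cg (@kn_Z _ _ _ _ _ _ _ _ H) gZ.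
- by move=> a b; rewrite -nm_le; exact: le_trans (rn_entry _ _ _) dZ.
- apply: le_trans (ler_wpM2r _ yq) _; first by rewrite mulr_ge0 ?rn_ge0 // (ltW c0).
  move: y2; rewrite -[(_)^-1]div1r ltr_pdivlMr ?mulr_gt0 // => y2.
  rewrite -(ler_pM2r (x := 2)) // mulVf // ltW //; apply: le_lt_trans y2.
  by rewrite le_eqVlt; apply/orP; left; apply/eqP; move: (rn _) => t; ring.
exists p; split=> //; first by split; [exact: fixlev_gauge | exact: pZ].
apply: rn_mx_le; first by rewrite mulr_ge0 ?rn_ge0 // addr_ge0 // !mulr_ge0 // ?(ltW k0) ?(ltW c0).
move=> a b; rewrite nm_le; apply: le_trans (p1 a b) _; rewrite rc_le.
have : 4 * knK (m := m) tau (qn2 y) * (c * rn (y - y0)) *+ m <= 4 * k * (c * rn (y - y0)) *+ m.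
  rewrite lerMn2r ler_wpM2r ?orbT // ?mulr_ge0 ?rn_ge0 ?(ltW c0) //.
  by rewrite ler_wpM2l.
have -> : 4 * k * (c * rn (y - y0)) *+ m = 4 * k * c * m%:R * rn (y - y0).
  by rewrite -[_ *+ m]mulr_natr; move: (rn _) (m%:R) => t s; ring.
by move=> h; apply: le_trans h _; rewrite [leRHS]mulrDl mul1r lerDr rn_ge0.
Qed.
End Invariant.

(** * Unitary invariance and complexified orbits *)

Section Cayley.
Context {C : numClosedFieldType} {m : nat}.
Implicit Types K : 'M[C]_m.

(** The Cayley transform is a rational curve of unitary matrices through 1 with velocity [2 K]. It
    stays in the commutant when [K] does, and serves in place of the exponential. *)
Lemma cayley_unitary K (t : C) : K^t* = - K -> t^* = t -> 1%:M - t *: K \in unitmx ->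
  (1%:M + t *: K) *m invmx (1%:M - t *: K) \is unitarymx.
Proof.
move=> sk tr Au; set B := 1%:M + _; set A := 1%:M - _ in Au *.
have BA : B^t* = A by rewrite /B adjmxD adjmxZ adjmx1 sk tr scalerN.
have AB : A^t* = B by rewrite -BA adjmxK.
have cAB : A *m B = B *m A.
  by rewrite /A /B mulmxDr !mulmxBl mulmxDl mulmx1 !mulmxBr !mul1mx !mulmx1.
apply: unitarymxI; rewrite adjmxM BA mulmxA -(mulmxA _ A B) cAB -!mulmxA (mulmxV Au) mulmx1.
by rewrite -AB -adjmxM (mulmxV Au) adjmx1.
Qed.

Lemma cayley_diff K (t : C) : 1%:M - t *: K \in unitmx ->
  (1%:M + t *: K) *m invmx (1%:M - t *: K) - 1%:M = (2 * t) *: (K *m invmx (1%:M - t *: K)).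
Proof.
move=> Au; rewrite -[X in _ - X](mulmxV Au) -mulmxBl.
have -> : 1%:M + t *: K - (1%:M - t *: K) = (2 * t) *: K.
  by apply/matrixP => i j; rewrite !mxent; ring.
by rewrite scalemxAl.
Qed.

(** The last clause says that [S] and [T] lie in every complex subspace containing [h] and its
    adjoint; it is applied to the commutant. *)
Lemma skew_decomp (h : 'M[C]_m) : exists S T : 'M[C]_m,
  [/\ S^t* = - S, T^t* = - T, h = S + 'i *: T &
      forall P : 'M[C]_m -> Prop, (forall a b, P a -> P b -> P (a + b)) ->
        (forall c a, P a -> P (c *: a)) -> P h -> P (h^t*) -> P S /\ P T].
Proof.
exists (2^-1 *: (h - h^t*)), ((2 * 'i)^-1 *: (h + h^t*)); split.
- by rewrite adjmxZ adjmxD adjmxN adjmxK -scalerN opprB fmorphV rmorph_nat.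
- rewrite adjmxZ adjmxD adjmxK fmorphV rmorphM rmorph_nat /= conjCi mulrN invrN scaleNr.
  by rewrite [h^t* + h]addrC.
- rewrite scalerA invfM mulrCA mulfV ?neq0Ci // mulr1 -scalerDr addrACA addNr addr0.
  by apply/matrixP => i j; rewrite !mxent; field.
- move=> P PD PZ Ph Pa; split; apply: (PZ); last exact: PD.
  by apply: (PD) => //; rewrite -scaleN1r; exact: PZ.
Qed.
End Cayley.

Section InvariantFunction.
Context {R : realType} {gT : finGroupType} {G : {group gT}} {m : nat}.
Local Notation C := (cplx R).
Local Notation E := (qdata C m 1).
Context {rho : gT -> 'M[C]_m} {sg : gT -> 'M[C]_2} {tau : C} {Z : 'M[C]_m}.
Hypothesis H : kn_setting G rho sg tau Z.
Local Notation comm := (comms (fun s => s \in G) rho).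
Local Notation fixd := (fixd (G := G) rho sg).
Local Notation fixlev := (fixlev (G := G) (rho := rho) (sg := sg) (tau := tau)).
Local Notation hklev := (hklev (G := G) (rho := rho) (sg := sg) (tau := tau) (Z := Z)).

Variable ft : E -> C^o.
Hypothesis ft_inv : forall y g, fixlev y -> g \in unitmx -> comm g -> ft (gauge g y) = ft y.

Lemma le_eps (x M : R) : 0 <= M -> (forall e, 0 < e -> x <= e * M) -> x <= 0.
Proof.
move=> M0 h; rewrite leNgt; apply/negP => x0.
have M1 : 0 < 2 * (M + 1) by rewrite mulr_gt0 // ltr_wpDl.
have := h (x / (2 * (M + 1))) (divr_gt0 x0 M1).
rewrite mulrAC ler_pdivlMr // => h2; have := mulr_ge0 (ltW x0) M0; nra.
Qed.

Lemma rn_sub_eq (W : normedModType C) (a b c : W) (x : R) : a = b -> rn (a - b - c) <= x -> rn c <= x.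
Proof. by move=> ->; rewrite subrr add0r rnN. Qed.

Lemma rn_sub_eq3 (W : normedModType C) (a b c a' b' c' : W) (x : R) : a = a' -> b = b' -> c = c' ->
  rn (a - b - c) <= x -> rn (a' - b' - c') <= x.
Proof. by move=> -> -> ->. Qed.

Section Base.
Variables (F : E -> C^o) (y0 : E) (dF : R).
Hypothesis y0h : hklev y0.
Hypothesis Fd : differentiable F y0.
Hypothesis dF0 : 0 < dF.
Hypothesis ftF : forall y, hklev y -> rn (y - y0) < dF -> ft y = F y.

Let V : normedModType C := ('M[C]_m * E)%type.
Let Ph (v : V) : E := gauge2 v.1 (minv v.1) v.2.
Let v0 : V := (1%:M, y0).

Let PhE p y : p \in unitmx -> gauge p y = Ph (p, y). Proof. exact: gauge2E. Qed.

Let Ph0 : Ph v0 = y0. Proof. by rewrite -PhE ?unitmx1 // gauge1. Qed.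

Let dPh : differentiable Ph v0.
Proof.
have d1 : differentiable (fun v : V => v.1) v0 by apply: diff_fst; exact: diff_id.
apply: diff_gauge2; [exact: d1 | | by apply: diff_snd; exact: diff_id].
by apply: diff_minv; [rewrite unitmx1 | exact: d1].
Qed.

Lemma Psi_local : exists d : R, 0 < d /\ forall p y, p \in unitmx -> hklev (gauge p y) ->
  rn (p - 1%:M) < d -> rn (y - y0) < d -> ft (gauge p y) = F (Ph (p, y)).
Proof.
have [K [d [K0 d0 KP]]] := rdiff_lip (diff_rdiff setT dPh).
exists (Num.min d (dF / K)); split; first by rewrite lt_min d0 divr_gt0.
move=> p y pu ph pd yd; rewrite -PhE //; apply: ftF => //; rewrite PhE // -[X in _ - X]Ph0.
have vd : rn ((p, y) - v0 : V) < Num.min d (dF / K).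
  apply: (@le_lt_trans _ _ (Num.max (rn (p - 1%:M)) (rn (y - y0)))); last by rewrite gt_max pd.
  by apply: rn_pair; rewrite /= le_max lexx ?orbT.
move: vd; rewrite lt_min => /andP[vd1 vd2].
by apply: le_lt_trans (KP _ I vd1) _; rewrite mulrC -ltr_pdivlMr.
Qed.

Let dPsi : differentiable (F \o Ph) v0.
Proof. exact: (differentiable_comp dPh (eq_ind_r (fun y => differentiable F y) Fd Ph0)). Qed.

Lemma dPsi_split (D : {linear V -> C^o}) (K X : 'M[C]_m) :
  D (K, 0) = D (K *m X, 0) + D (K *m (1%:M - X), 0).
Proof.
rewrite -linearD; congr (D _); congr (_, _); rewrite /= ?addr0 //.
by rewrite -mulmxDr addrC subrK mulmx1.
Qed.

(** Along the Cayley curve through 1 the point [y0] stays in [hklev], and there [F \o Ph] equals the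
    invariant function, which is constant. Hence its derivative in the direction [K] vanishes. *)
Lemma dPsi_skew (D : {linear V -> C^o}) : lbounded D ->
  (forall e : R, 0 < e -> exists2 d : R, 0 < d & forall u : V, rn (u - v0) < d ->
      rn ((F \o Ph) u - (F \o Ph) v0 - D (u - v0)) <= e * rn (u - v0)) ->
  forall K, comm K -> K^t* = - K -> D (K, 0) = 0.
Proof.
move=> /lbounded_ge[L L0 LP] DP K cK sk.
have du : differentiable (fun A : 'M[C]_m => A) (1%:M : 'M[C]_m) by exact: diff_id.
have [dU dU0 dUP] : exists2 d : R, 0 < d & forall A : 'M[C]_m, rn (A - 1%:M) < d -> A \in unitmx.
  by apply/near_rn; apply: near_unitmx du; rewrite unitmx1.
have [Kv [dv [Kv0 dv0 KvP]]] : exists K d : R, [/\ 0 < K, 0 < d & forall A : 'M[C]_m, setT A ->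
    rn (A - 1%:M) < d -> rn (minv A - minv 1%:M) <= K * rn (A - 1%:M)].
  by apply: rdiff_lip; apply: diff_rdiff; apply: diff_minv du; rewrite unitmx1.
have minv1 : minv 1%:M = 1%:M :> 'M[C]_m by rewrite -minvE ?unitmx1 // invmx1.
have [dl [dl0 dlP]] := Psi_local.
pose V1 : R := rn (1%:M : 'M[C]_m) + Kv.
have V10 : 0 <= V1 by rewrite addr_ge0 ?rn_ge0 // ltW.
apply: rn_eq0; apply/eqP; rewrite eq_le rn_ge0 andbT.
apply: (@le_eps _ (m%:R * (rn K * V1) + L * (m%:R * (rn K * Kv)))).
  by rewrite addr_ge0 // !mulr_ge0 ?rn_ge0 // ltW.
move=> e e0; have [d d0 dP] := DP e e0.
pose q : R := 1 + m%:R * (2 * V1).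
have q0 : 0 < q by rewrite ltr_pwDl // !mulr_ge0.
(* The bound by [e] is needed because the increment of the curve is a multiple of [K *m invmx A]
   rather than of [K]; the discrepancy has order [s]. Halving makes all the inequalities strict. *)
pose s : R := Num.min (Num.min 1 e) (Num.min (Num.min dU dv) (Num.min (d / q) (dl / q))) / 2.
have s0 : 0 < s by rewrite divr_gt0 // !lt_min ltr01 e0 dU0 dv0 !divr_gt0.
have [s1 se sU sv [sd sl]] : [/\ s < 1, s < e, s < dU, s < dv & s < d / q /\ s < dl / q].
  have h x : Num.min (Num.min 1 e) (Num.min (Num.min dU dv) (Num.min (d / q) (dl / q))) <= x ->
    s < x by move=> hx; apply: lt_le_trans hx; rewrite /s ltr_pdivrMr // mulr_natr mulr2n ltrDl; rewrite /s pmulr_lgt0 // in s0.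
  by split; [..|split]; apply: h; rewrite !ge_min lexx ?orbT.
pose t : R := s / (1 + rn K).
have K1 : 0 < 1 + rn K by rewrite ltr_pwDl ?rn_ge0.
have t0 : 0 < t by rewrite divr_gt0.
have tK : t * rn K <= s.
  rewrite /t mulrAC ler_pdivrMr // ler_wpM2l ?(ltW s0) // ler_wpDl //.
pose A : 'M[C]_m := 1%:M - rc t *: K.
have A1 : rn (A - 1%:M) <= s by rewrite /A addrAC subrr add0r rnN rnZ nm_rc gtr0_norm.
have Au : A \in unitmx by apply: dUP; exact: le_lt_trans A1 sU.
have vA : rn (invmx A - 1%:M) <= Kv * s.
  rewrite minvE // -[X in _ - X]minv1; apply: le_trans (KvP _ I (le_lt_trans A1 sv)) _.
  by rewrite ler_wpM2l // ltW.
have vA1 : rn (invmx A) <= V1.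
  have := rnD (invmx A - 1%:M) 1%:M; rewrite subrK => h; apply: le_trans h _.
  by rewrite /V1 addrC lerD2l; apply: le_trans vA _; rewrite ler_piMr // ltW.
pose u := (1%:M + rc t *: K) *m invmx A.
have uu : u \is unitarymx by apply: cayley_unitary => //; rewrite rc_conj.
have cu : comm u.
  apply: commsM; first by apply: commsD; [exact: comms1 | exact: commsZ].
  by apply: commsV Au _; apply: commsB; [exact: comms1 | exact: commsZ].
have uE : u - 1%:M = (2 * rc t) *: (K *m invmx A) by exact: cayley_diff.
have KA : rn (K *m invmx A) <= m%:R * (rn K * V1).
  by apply: le_trans (rn_mulmx _ _) _; rewrite ler_wpM2l // ler_wpM2l ?rn_ge0.
have nt : nm (2 * rc t) = 2 * t by rewrite -(rmorph_nat rc 2) -rcM nm_rc gtr0_norm // mulr_gt0.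
have u1 : rn (u - 1%:M) <= s * q.
  rewrite uE rnZ nt; apply: le_trans (ler_wpM2l _ KA) _; first by rewrite mulr_ge0 // ltW.
  have -> : 2 * t * (m%:R * (rn K * V1)) = t * rn K * (m%:R * (2 * V1)).
    by move: (rn K) (m%:R : R) => a b; ring.
  have hq : m%:R * (2 * V1) <= q by rewrite /q ler_wpDl.
  have hV : 0 <= m%:R * (2 * V1) by rewrite !mulr_ge0.
  exact: ler_pM (mulr_ge0 (ltW t0) (rn_ge0 K)) hV tK hq.
have uV : (u, y0) - v0 = (u - 1%:M, 0) :> V by rewrite /v0; congr (_, _); rewrite /= subrr.
have rV (B : 'M[C]_m) : rn ((B, 0) : V) <= rn B by apply: rn_pair; rewrite //= rn0 rn_ge0.
have u0 : u \in unitmx by have [] := unitarymxE uu.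
have uF : F (Ph (u, y0)) = F (Ph v0).
  have q1 : rn (u - 1%:M) < dl by apply: le_lt_trans u1 _; rewrite -ltr_pdivlMr.
  have q2 : rn (y0 - y0) < dl by rewrite subrr rn0.
  have q3 : rn (y0 - y0) < dF by rewrite subrr rn0.
  have e1 := dlP u y0 u0 (hklev_gauge H uu cu y0h) q1 q2.
  have e2 : ft (gauge u y0) = ft y0 := ft_inv y0h.1 u0 cu.
  have e3 : ft y0 = F y0 := ftF y0h q3.
  have e4 : F (Ph v0) = F y0 := congr1 F Ph0.
  exact: (etrans (esym e1) (etrans e2 (etrans e3 (esym e4)))).
have vd : rn ((u, y0) - v0 : V) < d.
  by rewrite uV; apply: le_lt_trans (rV _) _; apply: le_lt_trans u1 _; rewrite -ltr_pdivlMr.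
have vE : (u, y0) - v0 = (2 * rc t) *: (K *m invmx A, 0) :> V.
  by rewrite uV uE; congr (_, _); rewrite /= scaler0.
have := rn_sub_eq uF (dP (u, y0) vd).
rewrite vE linearZ !rnZ nt [leRHS]mulrCA.
have tt : 0 < 2 * t by rewrite mulr_gt0.
rewrite (ler_pM2l tt) => DK.
have B1 : rn (D (K *m invmx A, 0)) <= e * (m%:R * (rn K * V1)) :=
  le_trans DK (ler_wpM2l (ltW e0) (le_trans (rV _) KA)).
have hv : rn (1%:M - invmx A) <= Kv * e.
  by rewrite rnC; exact: le_trans vA (ler_wpM2l (ltW Kv0) (ltW se)).
have B2 : rn (D (K *m (1%:M - invmx A), 0)) <= e * (L * (m%:R * (rn K * Kv))).
  have h := le_trans (rn_mulmx _ _) (ler_wpM2l (ler0n R m) (ler_wpM2l (rn_ge0 K) hv)).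
  have h2 := le_trans (LP _) (ler_wpM2l (ltW L0) (le_trans (rV _) h)).
  apply: le_trans h2 _; rewrite le_eqVlt; apply/orP; left; apply/eqP.
  by clear; move: (rn K) (m%:R : R) => x y; ring.
rewrite (dPsi_split D K (invmx A)); apply: le_trans (rnD _ _) _; rewrite mulrDr; exact: lerD B1 B2.
Qed.

(** The differential [D] at [(1, y0)] kills [(h, 0)] for every [h] in the commutant, by [dPsi_skew]
    and complex linearity. So in the expansion at [(p, y)], with [p] from [polar_lip], the term in
    [p - 1] disappears, and the Lipschitz bound on [p] keeps the remainder small against
    [y - y0]. *)
Lemma invariant_rdiff0 : rdiff (fixlev : set E) ft y0.
Proof.
have [D [Dl DP]] := diff_elim dPsi.
have D0 h : comm h -> D (h, 0) = 0.
  move=> ch; have [S [T [sS sT hE cST]]] := skew_decomp h.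
  have [cS cT] : comm S /\ comm T.
    apply: (cST (fun a => comm a)); [exact: commsD | by move=> c a; exact: commsZ | exact: ch | ].
    exact: (comms_adj (kn_rhoU H) ch).
  rewrite hE.
  have -> : (S + 'i *: T, 0) = (S, 0) + 'i *: (T, 0) :> V.
    by congr (_, _); rewrite /= scaler0 addr0.
  by rewrite linearD linearZ /= (dPsi_skew Dl DP cS sS) (dPsi_skew Dl DP cT sT) scaler0 addr0.
have [K [dK [K0 dK0 KP]]] := polar_lip H y0h.
have [dl [dl0 dlP]] := Psi_local.
have ins_lin : linear (fun v : E => (0, v) : V).
  by move=> a x y; congr (_, _); rewrite /= scaler0 addr0.
pose insB := GRing.isLinear.Build C E V _ (fun v : E => (0, v) : V) ins_lin.
pose ins : {linear E -> V} := HB.pack (fun v : E => (0, v) : V) insB.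
exists (D \o ins); split.
  have [L L0 LP] := lbounded_ge Dl; exists L => v; apply: le_trans (LP _) _.
  by rewrite ler_wpM2l ?(ltW L0) //; apply: rn_pair; rewrite /= ?rn0 ?rn_ge0.
move=> e e0; have [d d0 dP] := DP (e / (K + 1)) (divr_gt0 e0 (addr_gt0 K0 ltr01)).
have K1 : 0 < K + 1 by exact: addr_gt0.
exists (Num.min dK (Num.min (Num.min dl (dl / (K + 1))) (d / (K + 1)))).
  by rewrite !lt_min dK0 dl0 !divr_gt0.
move=> y yf; rewrite !lt_min => /and3P[y1 /andP[y2 y2'] y3].
have [p [pu cp ph p1]] := KP y yf y1.
have p2 : rn (p - 1%:M) <= (K + 1) * rn (y - y0).
  by apply: le_trans p1 _; rewrite ler_wpM2r ?rn_ge0 // lerDl.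
have v1 : rn ((p, y) - v0 : V) <= (K + 1) * rn (y - y0).
  apply: rn_pair; first exact: p2.
  by rewrite /= ler_peMl ?rn_ge0 // lerDr ltW.
have vd : rn ((p, y) - v0 : V) < d.
  by apply: le_lt_trans v1 _; rewrite mulrC -ltr_pdivlMr.
have q1 : rn (p - 1%:M) < dl by apply: le_lt_trans p2 _; rewrite mulrC -ltr_pdivlMr.
have e1 : ft (gauge p y) = F (Ph (p, y)) := dlP p y pu ph q1 y2.
have e2 : ft (gauge p y) = ft y := ft_inv yf pu cp.
have q3 : rn (y0 - y0) < dF by rewrite subrr rn0.
have e3 : ft y0 = F y0 := ftF y0h q3.
have e4 : F (Ph v0) = F y0 := congr1 F Ph0.
have e5 : D ((p, y) - v0) = (D \o ins) (y - y0).
  have -> : (p, y) - v0 = (p - 1%:M, 0) + ins (y - y0) :> V.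
    by congr (_, _); rewrite /= ?add0r ?addr0.
  rewrite linearD D0 ?add0r //.
  by apply: commsB cp _; exact: comms1.
have := rn_sub_eq3 (etrans (esym e1) e2) (etrans e4 (esym e3)) e5 (dP (p, y) vd).
move=> h; apply: le_trans h _; apply: le_trans (ler_wpM2l _ v1) _.
  by rewrite ltW // divr_gt0.
by rewrite mulrA divfK // gt_eqF.
Qed.
End Base.
End InvariantFunction.

(** * Slices from words in the generators *)

Section Words.
Context {C : numClosedFieldType} {m : nat}.
Local Notation E := (qdata C m 1).
Implicit Types (x : E) (l : seq bool).

Fixpoint word l x : 'M[C]_(m, 1) :=
  if l is b :: l' then (if b then qB1 x else qB2 x) *m word l' x else qi x.

Lemma word_gauge l g x : g \in unitmx -> word l (gauge g x) = g *m word l x.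
Proof.
move=> gu; elim: l => [|b l IH] //=; rewrite IH mulmxA.
by case: b; rewrite /gauge /qB1 /qB2 /= -[_ *m invmx g *m g]mulmxA mulVmx // mulmx1 mulmxA.
Qed.

Definition wordmx (ls : seq (seq bool)) x : 'M[C]_(size ls, m) :=
  \matrix_(k, a) word (nth [::] ls k) x a 0.

Lemma row_wordmx ls x (k : 'I_(size ls)) : row k (wordmx ls x) = (word (nth [::] ls k) x)^T.
Proof. by apply/rowP => a; rewrite !mxE. Qed.

Lemma wordmx_sub ls l x : (wordmx ls x <= wordmx (l :: ls) x)%MS.
Proof.
apply/row_subP => k; have kl : (k.+1 < size (l :: ls))%N by rewrite ltnS.
have -> : row k (wordmx ls x) = row (Ordinal kl) (wordmx (l :: ls) x) by rewrite !row_wordmx.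
exact: row_sub.
Qed.

(* A maximal family of words spans a subspace which is invariant under [B] and
   contains the image of [i]; by the level equation it is everything. *)
Lemma words_span tau x : tau != 0 -> mu_C x = - tau%:M ->
  exists ls, row_full (wordmx ls x).
Proof.
move=> t0 xl; pose P r := `[< exists ls, \rank (wordmx ls x) = r >].
have Pex : exists r, P r by exists (\rank (wordmx [::] x)); apply/asboolP; exists [::].
have Pub r : P r -> (r <= m)%N by move/asboolP => [ls <-]; exact: rank_leq_col.
case: (ex_maxnP Pex Pub) => r /asboolP[ls lsr] rmax; exists ls.
have sub l : ((word l x)^T <= wordmx ls x)%MS.
  have le : (\rank (wordmx (l :: ls) x) <= \rank (wordmx ls x))%N.
    by rewrite lsr; apply: rmax; apply/asboolP; exists (l :: ls).
  have : (wordmx (l :: ls) x <= wordmx ls x)%MS.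
    by rewrite -(geq_leqif (mxrank_leqif_sup (wordmx_sub ls l x))).
  apply: submx_trans; have -> : (word l x)^T = row ord0 (wordmx (l :: ls) x).
    exact: esym (row_wordmx (ls := l :: ls) x ord0).
  exact: row_sub.
set W := wordmx ls x in lsr sub *.
have inv b : exists X, (if b then qB1 x else qB2 x) *m W^T = W^T *m X.
  have /submxP[X XE] : (W *m (if b then qB1 x else qB2 x)^T <= W)%MS.
    apply/row_subP => k; rewrite row_mul row_wordmx -trmx_mul.
    exact: (sub (b :: nth [::] ls k)).
  by exists X^T; apply: trmx_inj; rewrite !trmx_mul !trmxK XE.
have /submxP[c cE] := sub [::].
have iE : qi x = W^T *m c^T by apply: trmx_inj; rewrite trmx_mul !trmxK -cE.
pose Y := row_base (kermx W^T); have YW : Y *m W^T = 0.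
  by apply/sub_kermxP; rewrite eq_row_base.
have YY : Y *m pinvmx Y = 1%:M by rewrite mulmxVp // row_base_free.
have cov b : exists bb, Y *m (if b then qB1 x else qB2 x) = bb *m Y.
  have [X XE] := inv b; apply/submxP; rewrite eq_row_base; apply/sub_kermxP.
  by rewrite -mulmxA XE mulmxA YW mul0mx.
have [[b1 E1] [b2 E2]] := (cov true, cov false).
have Yi : Y *m qi x = 0 by rewrite iE mulmxA YW mul0mx.
have /eqP := coinvariant_eq0 t0 xl YY E1 E2 Yi.
rewrite mxrank_ker mxrank_tr subn_eq0 => h.
by rewrite /row_full eqn_leq rank_leq_col.
Qed.
End Words.

Section Slice.
Context {R : realType} {gT : finGroupType} {G : {group gT}} {m : nat}.
Local Notation C := (cplx R).
Local Notation E := (qdata C m 1).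
Context {rho : gT -> 'M[C]_m} {sg : gT -> 'M[C]_2} {tau : C} {Z : 'M[C]_m}.
Hypothesis H : kn_setting G rho sg tau Z.
Local Notation comm := (comms (fun s => s \in G) rho).
Local Notation fixd := (fixd (G := G) rho sg).
Local Notation fixlev := (fixlev (G := G) (rho := rho) (sg := sg) (tau := tau)).
Local Notation hklev := (hklev (G := G) (rho := rho) (sg := sg) (tau := tau) (Z := Z)).

Lemma diff_word (V : normedModType C) (l : seq bool) (f : V -> E) v : differentiable f v ->
  differentiable (fun v => word l (f v)) v.
Proof.
move=> df; elim: l => [|[] l IH] /=; first exact: diff_qi.
  by apply: diff_mulmx IH; exact: diff_qB1.
by apply: diff_mulmx IH; exact: diff_qB2.
Qed.

Lemma diff_act2 (V : normedModType C) s (f : V -> E) v : differentiable f v ->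
  differentiable (fun v => act2 s (f v)) v.
Proof.
move=> df; have d1 := diff_qB1 df; have d2 := diff_qB2 df.
have d a b : differentiable (fun v => a *: qB1 (f v) + b *: qB2 (f v) : 'M[C]_m) v.
  by apply: differentiableD; apply: differentiableZ.
by apply: diff_qdata; [exact: d | exact: d | exact: diff_qi | exact: diff_qj].
Qed.

(** A frame made of words: it is multiplied on the left by [g] under [gauge g] and, thanks to the
    averaging, on the right by [rho t] under [act2 (sg t)]. Its inverse therefore moves [x] to a
    normal form depending only on the [GL_m]-orbit and compatible with the group. *)
Definition slicemx ls (D : 'M[C]_(m, size ls)) (x : E) : 'M[C]_m :=
  #|G|%:R^-1 *: \sum_(s in G) (D *m wordmx ls (act2 (sg s) x))^T *m rho s^-1%g.

Lemma slicemx_gauge ls (D : 'M[C]_(m, size ls)) g x : g \in unitmx ->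
  slicemx D (gauge g x) = g *m slicemx D x.
Proof.
move=> gu; rewrite /slicemx -scalemxAr mulmx_sumr; congr (_ *: _); apply: eq_bigr => s _.
rewrite -gauge_act2 mulmxA; congr (_ *m _).
have -> : wordmx ls (gauge g (act2 (sg s) x)) = wordmx ls (act2 (sg s) x) *m g^T.
  apply/row_matrixP => k; rewrite row_mul !row_wordmx word_gauge // trmx_mul.
  exact: erefl.
by rewrite mulmxA trmx_mul trmxK.
Qed.

Lemma slicemx_act ls (D : 'M[C]_(m, size ls)) t x : t \in G ->
  slicemx D (act2 (sg t) x) = slicemx D x *m rho t.
Proof.
move=> tG; rewrite /slicemx -scalemxAl mulmx_suml; congr (_ *: _).
rewrite [RHS](reindex_inj (mulgI t)) /=; apply: eq_big => s; first by rewrite groupMl.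
move=> sG; have sV : s^-1%g \in G by rewrite groupV.
have tV : t^-1%g \in G by rewrite groupV.
rewrite act2M -(kn_sgM H tG sG) invMg -mulmxA (kn_rhoM H sV tV) -mulmxA.
by rewrite -(kn_rhoM H tV tG) mulVg (kn_rho1 H) mulmx1.
Qed.

Lemma diff_slicemx ls (D : 'M[C]_(m, size ls)) x : differentiable (slicemx D : E -> 'M[C]_m) x.
Proof.
apply: differentiableZ; apply: diff_sum => s.
apply: diff_mulmx; last exact: differentiable_cst.
apply: diff_mx => a b; rewrite (_ : (fun _ => _) = fun v : E => (D *m wordmx ls (act2 (sg s) v)) b a); last first.
  by apply: funext => v; rewrite mxE.
apply: diff_entry; apply: diff_mulmx; first exact: differentiable_cst.
apply: diff_mx => c d; rewrite (_ : (fun _ => _) = fun v : E => word (nth [::] ls c) (act2 (sg s) v) d 0); last first.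
  by apply: funext => v; rewrite mxE.
by apply: diff_entry; apply: diff_word; apply: diff_act2; exact: diff_id.
Qed.

Definition slice ls (D : 'M[C]_(m, size ls)) (x : E) : E :=
  gauge2 (minv (slicemx D x)) (slicemx D x) x.

Lemma sliceE ls (D : 'M[C]_(m, size ls)) x : slicemx D x \in unitmx ->
  slice D x = gauge (invmx (slicemx D x)) x.
Proof. by move=> u; rewrite /slice -minvE // /gauge invmxK. Qed.

Lemma diff_slice ls (D : 'M[C]_(m, size ls)) x : slicemx D x \in unitmx ->
  differentiable (slice D : E -> E) x.
Proof.
move=> u; apply: diff_gauge2; last exact: diff_id; last exact: diff_slicemx.
by apply: diff_minv u _; exact: diff_slicemx.
Qed.

Lemma slice_gauge ls (D : 'M[C]_(m, size ls)) g x : g \in unitmx -> slicemx D x \in unitmx ->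
  slice D (gauge g x) = slice D x.
Proof.
move=> gu u; have u' : slicemx D (gauge g x) \in unitmx.
  by rewrite (slicemx_gauge D x gu) unitmx_mul gu.
have iu : invmx (slicemx D (gauge g x)) \in unitmx by rewrite unitmx_inv.
have e : invmx (slicemx D (gauge g x)) *m g = invmx (slicemx D x).
  by rewrite (slicemx_gauge D x gu) (invmx_mul gu u) (mulmxKV gu).
exact: etrans (sliceE u') (etrans (esym (gaugeM x iu gu))
  (etrans (congr1 (fun A => gauge A x) e) (esym (sliceE u)))).
Qed.

Lemma slice_act ls (D : 'M[C]_(m, size ls)) t x : t \in G -> slicemx D x \in unitmx ->
  gauge (rho t) (slice D (act2 (sg t) x)) = act2 (sg t) (slice D x).
Proof.
move=> tG u; have tu := rho_unit (kn_rhoM H) (kn_rho1 H) tG.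
have u' : slicemx D (act2 (sg t) x) \in unitmx.
  by rewrite (slicemx_act D x tG) unitmx_mul u.
have iu : invmx (slicemx D (act2 (sg t) x)) \in unitmx by rewrite unitmx_inv.
rewrite (sliceE u) (sliceE u') -(gaugeM _ tu iu) (slicemx_act D x tG) (invmx_mul u tu).
by rewrite mulmxA (mulmxV tu) mul1mx gauge_act2.
Qed.

(** Words spanning at [x0] have a left inverse [D]; since [x0] is fixed, each summand of the average
    is then [rho s *m rho s^-1 = 1]. *)
Lemma slice_exists (x0 : E) : fixlev x0 ->
  exists ls (D : 'M[C]_(m, size ls)), slicemx D x0 = 1%:M.
Proof.
move=> [x0f x0l]; have [ls /row_fullP[D DE]] := words_span (kn_tau H) x0l.
exists ls, D; rewrite /slicemx (eq_bigr (fun=> 1%:M)).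
  by rewrite sumr_const -[X in _ *: X]scaler_nat scalerA mulVf ?scale1r // pnatr_eq0 -lt0n cardG_gt0.
move=> s sG; rewrite -(x0f s sG).
have -> : wordmx ls (gauge (rho s) x0) = wordmx ls x0 *m (rho s)^T.
  apply/row_matrixP => k; rewrite row_mul !row_wordmx word_gauge ?trmx_mul //.
  exact: (rho_unit (kn_rhoM H) (kn_rho1 H) sG).
rewrite mulmxA DE mul1mx trmxK.
exact: (rhoV (kn_rhoM H) (kn_rho1 H) sG).
Qed.

(* At a point whose orbit is [Gamma]-fixed, [slice] takes its value in the
   [Gamma]-fixed subspace, because it is constant on that orbit. *)
Lemma slice_fixd ls (D : 'M[C]_(m, size ls)) x : slicemx D x \in unitmx ->
  (forall s, s \in G -> exists2 g, g \in unitmx & act2 (sg s) x = gauge g x) ->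
  fixd (slice D x).
Proof.
move=> u h s sG; have [g gu gE] := h s sG.
by rewrite -(slice_act sG u) gE slice_gauge.
Qed.

Lemma slice_level ls (D : 'M[C]_(m, size ls)) x : slicemx D x \in unitmx ->
  mu_C x = - tau%:M -> mu_C (slice D x) = - tau%:M.
Proof.
move=> u; rewrite -raddfN sliceE // => xl; apply: mu_C_gauge_scalar xl.
by rewrite unitmx_inv.
Qed.
End Slice.

(** * The isomorphism *)

Lemma rn_ball (R : realType) (V : normedModType (cplx R)) (y y0 : V) (d : R) : rn (y - y0) < d ->
  exists2 q : R, 0 < q & forall z, rn (z - y) < q -> rn (z - y0) < d.
Proof.
move=> yd; exists (d - rn (y - y0)); first by rewrite subr_gt0.
move=> z; rewrite ltrBrDr; apply: le_lt_trans.
by have := rnD (z - y) (y - y0); rewrite addrA subrK.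
Qed.

Lemma lt_min3P (R : realFieldType) (x a b c : R) : x < Num.min a (Num.min b c) ->
  [/\ x < a, x < b & x < c].
Proof. by rewrite !lt_min => /and3P. Qed.

Lemma hquot_hsubP (C : numFieldType) (T : normedModType C) (S : set T) (cl : T -> set T)
    (V : set (set T)) (f : set T -> C) :
  hholo (hquot (X := hsub (X := haffine T) S) cl) V f <->
  forall y : T, S y -> V (cl y) -> exists (N : set T) (F : T -> C), [/\ open N, N y,
    forall z, N z -> differentiable (F : T -> C^o) z
  & forall z, N z -> S z -> V (cl z) -> f (cl z) = F z].
Proof.
split=> h y.
  move=> yh Vy; case: (h y (conj (conj I yh) Vy)) => N [F [No Ny Fd FE]].
  by exists N, F; split=> // z Nz zh Vz; exact: (FE z Nz (conj (conj I zh) Vz)).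
case=> [[_ yh] Vy]; case: (h y yh Vy) => N [F [No Ny Fd FE]].
by exists N, F; split=> // z Nz [[_ zh] Vz]; exact: (FE z Nz zh Vz).
Qed.

Section Iso.
Context {R : realType} {gT : finGroupType} {G : {group gT}} {m : nat}.
Local Notation C := (cplx R).
Local Notation E := (qdata C m 1).
Context {rho : gT -> 'M[C]_m} {sg : gT -> 'M[C]_2} {tau : C} {Z : 'M[C]_m}.
Hypothesis H : kn_setting G rho sg tau Z.
Local Notation comm := (comms (fun s => s \in G) rho).
Local Notation fixd := (fixd (G := G) rho sg).
Local Notation fixlev := (fixlev (G := G) (rho := rho) (sg := sg) (tau := tau)).
Local Notation hklev := (hklev (G := G) (rho := rho) (sg := sg) (tau := tau) (Z := Z)).

Lemma diff_gauge g (x : E) : differentiable (gauge g : E -> E) x.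
Proof.
by apply: (diff_gauge2 (g := fun=> g) (h := fun=> invmx g) (f := id));
  [exact: differentiable_cst | exact: differentiable_cst | exact: diff_id].
Qed.

(** A constant element of the commutant transports the statement from [hklev], where
    [invariant_rdiff0] applies, to any point of [fixlev]. *)
Lemma invariant_rdiff (ft : E -> C^o) (F : E -> C^o) y g (d : R) :
  (forall y g, fixlev y -> g \in unitmx -> comm g -> ft (gauge g y) = ft y) ->
  fixlev y -> g \in unitmx -> comm g -> hklev (gauge g y) ->
  differentiable F (gauge g y) -> 0 < d ->
  (forall z, hklev z -> rn (z - gauge g y) < d -> ft z = F z) ->
  rdiff (fixlev : set E) ft y.
Proof.
move=> inv yf gu cg yh Fd d0 ftF.
have h0 := invariant_rdiff0 H inv yh Fd d0 ftF.
have h1 : rdiff fixlev (ft \o gauge g) y.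
  apply: (rdiff_comp ltr01 _ (diff_rdiff _ (diff_gauge g y)) h0) => u uf _.
  exact: (fixlev_gauge H gu cg uf).
apply: (rdiff_eq ltr01 _ _ h1) => [u uf _|]; exact: inv.
Qed.

Definition glorb (x : E) : set E := orbit_of [set g | g \in unitmx] x.
Definition ucomm : set 'M[C]_m :=
  [set u | u \is unitarymx /\ forall s, s \in G -> u *m rho s = rho s *m u].
Definition uorb (x : E) : set E := orbit_of ucomm x.

Lemma glorb_refl x : glorb x x.
Proof. by exists 1%:M; [exact: unitmx1 | exact: gauge1]. Qed.

Lemma glorb_gauge g x : g \in unitmx -> glorb (gauge g x) = glorb x.
Proof.
move=> gu; apply/seteqP; split=> y [h hu <-].
  have hgu : h *m g \in unitmx by rewrite unitmx_mul (hu : is_true (h \in unitmx)).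
  by exists (h *m g); [exact: hgu | exact: gaugeM].
have iu : invmx g \in unitmx by rewrite unitmx_inv.
have hgu : h *m invmx g \in unitmx by rewrite unitmx_mul (hu : is_true (h \in unitmx)).
by exists (h *m invmx g); [exact: hgu | rewrite (gaugeM _ hu iu) (gaugeK x gu)].
Qed.

Lemma glorb_eq x y : glorb x y -> glorb y = glorb x.
Proof. by move=> [g gu <-]; exact: glorb_gauge. Qed.

(** Both [g *m rho s] and [rho s *m g] carry [x] to the same point, so freeness makes them equal. *)
Lemma fixd_comm x g : free_at x -> g \in unitmx -> fixd x -> fixd (gauge g x) -> comm g.
Proof.
move=> fr gu xf yf s sG; have ru := rho_unit (kn_rhoM H) (kn_rho1 H) sG.
have := yf s sG; rewrite -gauge_act2 -(xf s sG) -(gaugeM x ru gu) -(gaugeM x gu ru) => h.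
by symmetry; apply: (gauge_inj fr _ _ h); rewrite unitmx_mul ?gu ?ru.
Qed.

Lemma glorb_hklev x : hklev x -> glorb x `&` hklev = uorb x.
Proof.
move=> xh; have [[xf xl] xZ] := xh; apply/seteqP; split=> y.
  move=> [[g gu <-] [[yf yl] yZ]].
  have cg := fixd_comm (level_free (kn_tau H) xl) gu xf yf.
  exists g => //; split; last exact: cg.
  exact: (kn_unique (kn_rhoU H) (kn_tau H) xl gu cg (fun h => kn_Z H (h := h)) xZ yZ).
move=> [u [uu cu] <-]; split; last exact: (hklev_gauge H uu cu xh).
by exists u => //; have [] := unitarymxE uu.
Qed.

Variable A : set (set E).
Hypothesis AP : forall x, mu_C x = - tau%:M ->
  (A (glorb x) <-> exists2 g, g \in unitmx & fixd (gauge g x)).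

(** The correspondence is intersection with the hyper-Kaehler level, so no representative is chosen.
    On the orbits in [A] the result is a single unitary orbit, by [A_hklev] and [glorb_hklev]. *)
Definition hkpart (p : set E) : set E := p `&` hklev.

Lemma A_hklev x : mu_C x = - tau%:M -> A (glorb x) -> exists2 y, hklev y & glorb x = glorb y.
Proof.
move=> xl /(AP xl)[g gu gf].
have gl : mu_C (gauge g x) = - tau%:M.
  by move: xl; rewrite -raddfN; exact: mu_C_gauge_scalar.
have [h [hu ch hZ]] := kn_meet H gf gl.
exists (gauge h (gauge g x)); last by rewrite !glorb_gauge.
by split; [exact: (fixlev_gauge H hu ch (conj gf gl)) | exact: hZ].
Qed.

Lemma hklev_A y : hklev y -> A (glorb y).
Proof. by move=> [[yf yl] _]; apply/(AP yl); exists 1%:M; rewrite ?unitmx1 // gauge1. Qed.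

Lemma hkpart_fixlev y g : g \in unitmx -> comm g -> hklev (gauge g y) ->
  hkpart (glorb y) = uorb (gauge g y).
Proof. by move=> gu cg yh; rewrite -(glorb_gauge y gu); exact: glorb_hklev. Qed.

Local Notation X := (hsub (X := calogero_moser m tau) A).
Local Notation Y := (hquot (X := hsub (X := haffine E) hklev) uorb).

Lemma openYP (V : set (set E)) : hopen Y V <->
  (V `<=` hcarrier Y /\ exists N : set E, open N /\ forall y, hklev y -> (V (uorb y) <-> N y)).
Proof.
split=> [[VY [N No NE]]|[VY [N [No NE]]]]; split=> //.
  exists N; split=> // y yh; split=> h.
    have : (hcarrier (hsub (X := haffine E) hklev) `&` uorb @^-1` V) y := conj (conj I yh) h.
    by rewrite NE => -[].
  by have : (N `&` hklev) y := conj h yh; rewrite -NE => -[].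
exists N => //; apply/seteqP; split=> y; first by move=> [[_ yh] /(NE y yh)].
by move=> [Ny yh]; split; [split | apply/NE].
Qed.

Lemma openCMP (V : set (set E)) : hopen (calogero_moser m tau) V <->
  (V `<=` hcarrier (calogero_moser m tau) /\ exists N : set E, open N /\
     forall x, mu_C x = - tau%:M -> (V (glorb x) <-> N x)).
Proof.
split=> [[VY [N No NE]]|[VY [N [No NE]]]]; split=> //.
  exists N; split=> // y yh; split=> h.
    have : (hcarrier (hsub (X := haffine E) [set x : E | mu_C x = - tau%:M]) `&`
      glorb @^-1` V) y := conj (conj I yh) h.
    by rewrite NE => -[].
  by have : (N `&` [set x : E | mu_C x = - tau%:M]) y := conj h yh; rewrite -NE => -[].
exists N => //; apply/seteqP; split=> y; first by move=> [[_ yh] /(NE y yh)].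
by move=> [Ny yh]; split; [split | apply/NE].
Qed.

Lemma carrierXP p : hcarrier X p <-> exists2 y, hklev y & p = glorb y.
Proof.
split.
  by move=> [[x [_ xl] <-] xA]; have [y yh xy] := A_hklev xl xA; exists y.
move=> [y yh ->]; split; last exact: hklev_A.
by exists y => //; split=> //; exact: yh.1.2.
Qed.

Lemma preim_hkpart V p : (hcarrier X `&` hkpart @^-1` V) p <->
  exists y, [/\ hklev y, p = glorb y & V (uorb y)].
Proof.
split=> [[/(iffLR (carrierXP p))[y yh pE] Vp]|[y [yh -> Vy]]].
  by exists y; split=> //; rewrite -(glorb_hklev yh) -pE.
split; first by apply: (iffRL (carrierXP _)); exists y.
exact: (eq_ind_r V Vy (glorb_hklev yh)).
Qed.

Lemma hkpart_bij : set_bij (hcarrier X) (hcarrier Y) hkpart.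
Proof.
split.
- by move=> p /carrierXP[y yh ->]; rewrite /hkpart glorb_hklev //; exists y.
- move=> p q /set_mem/carrierXP[y yh ->] /set_mem/carrierXP[z zh ->] e.
  have [yz _] : hkpart (glorb z) y by rewrite -e; split=> //; exact: glorb_refl.
  exact: glorb_eq.
- move=> q [y [_ yh] <-]; exists (glorb y); first by apply/carrierXP; exists y.
  exact: glorb_hklev.
Qed.

Lemma open_rn (N : set E) : (forall x, N x -> exists2 d : R, 0 < d & forall y, rn (y - x) < d -> N y) ->
  open N.
Proof. by move=> h; rewrite openE => x Nx; exact: (iffRL (near_rn x N) (h x Nx)). Qed.

Lemma open_ball (N : set E) x : open N -> N x -> exists2 d : R, 0 < d & forall y, rn (y - x) < d -> N y.
Proof. by move=> No Nx; apply/near_rn; exact: open_nbhs_nbhs. Qed.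

(* A neighbourhood in the level set which is saturated for [GL] and whose
   [Gamma]-fixed orbits all meet the fixed part of a small ball around [y0]. *)
Lemma slice_nbhd y0 (d : R) : hklev y0 -> 0 < d -> exists (N : set E) (s : E -> E),
  [/\ open N, N y0, forall g x, g \in unitmx -> N x -> N (gauge g x) /\ s (gauge g x) = s x,
      forall x, N x -> differentiable s x /\ rn (s x - y0) < d
    & forall x, N x -> mu_C x = - tau%:M ->
        glorb (s x) = glorb x /\ (A (glorb x) -> fixlev (s x))].
Proof.
move=> [y0f _] d0; have [ls [D D1]] := slice_exists H y0f.
pose S := slicemx (G := G) (rho := rho) (sg := sg) D.
pose s := slice (G := G) (rho := rho) (sg := sg) D.
have sE x : S x \in unitmx -> s x = gauge (invmx (S x)) x by exact: sliceE.
exists [set x | S x \in unitmx /\ rn (s x - y0) < d], s; split.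
- apply: open_rn => x [Su sx].
  have [d1 d10 h1] : exists2 d : R, 0 < d & forall y, rn (y - x) < d -> S y \in unitmx.
    by apply/near_rn; apply: near_unitmx Su _; exact: diff_slicemx.
  have [K [d2 [K0 d20 h2]]] := rdiff_lip (diff_rdiff setT (diff_slice (rho := rho) (sg := sg) (D := D) Su)).
  exists (Num.min d1 (Num.min d2 ((d - rn (s x - y0)) / K))).
    by rewrite !lt_min d10 d20 divr_gt0 // subr_gt0.
  move=> y /lt_min3P[y1 y2 y3]; split; first exact: (h1 y y1).
  have h := h2 y I y2; rewrite -/s in h.
  have := rnD (s y - s x) (s x - y0); rewrite addrA subrK => h3.
  apply: le_lt_trans h3 _; rewrite -ltrBrDr; apply: le_lt_trans h _.
  by rewrite mulrC -ltr_pdivlMr.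
- have S1 : S y0 = 1%:M by [].
  have u1 : S y0 \in unitmx by rewrite S1 unitmx1.
  by split=> //; rewrite sE // S1 invmx1 gauge1 subrr rn0.
- move=> g x gu [Su sx]; have e := slice_gauge (G := G) (rho := rho) (sg := sg) gu Su.
  have u' : S (gauge g x) \in unitmx by rewrite /S (slicemx_gauge D x gu) unitmx_mul gu.
  exact: (conj (conj u' (eq_ind_r (fun z : E => is_true (rn (z - y0) < d)) sx e)) e).
- by move=> x [Su sx]; split=> //; exact: diff_slice.
- move=> x [Su sx] xl; have iu : invmx (S x) \in unitmx by rewrite unitmx_inv.
  split; first by rewrite (sE x Su) glorb_gauge.
  move=> /(AP xl)[g gu gf]; split; last exact: slice_level.
  apply: (slice_fixd H Su) => t tG; have gi : invmx g \in unitmx by rewrite unitmx_inv.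
  have tu := rho_unit (kn_rhoM H) (kn_rho1 H) tG.
  exists (invmx g *m (rho t *m g)); first by rewrite !unitmx_mul gi tu.
  have tgu : rho t *m g \in unitmx by rewrite unitmx_mul tu.
  rewrite (gaugeM x gi tgu) (gaugeM x tu gu) (gf t tG) gauge_act2.
  by rewrite (gaugeK x gu).
Qed.

(** Continuity of the correspondence: the element [p] of [polar_lip] is close to 1, and the action
    is Lipschitz near [(1, y0)]. *)
Lemma hk_near y0 (d : R) : hklev y0 -> 0 < d -> exists2 d' : R, 0 < d' &
  forall y, fixlev y -> rn (y - y0) < d' ->
    exists p, [/\ p \in unitmx, comm p, hklev (gauge p y) & rn (gauge p y - y0) < d].
Proof.
move=> y0h d0; have [K [d1 [K0 d10 KP]]] := polar_lip H y0h.
have [L [d2 [L0 d20 LP]]] : exists L d : R, [/\ 0 < L, 0 < d &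
    forall v : ('M[C]_m * E)%type, setT v -> rn (v - (1%:M, y0)) < d ->
      rn (gauge2 v.1 (minv v.1) v.2 - gauge2 1%:M (minv 1%:M) y0) <= L * rn (v - (1%:M, y0))].
  apply: (rdiff_lip (f := fun v : ('M[C]_m * E)%type => gauge2 v.1 (minv v.1) v.2)).
  apply: diff_rdiff; have d1' : differentiable (fun v : ('M[C]_m * E)%type => v.1) ((1%:M, y0) : 'M[C]_m * E).
    by apply: diff_fst; exact: diff_id.
  apply: diff_gauge2; [exact: d1' | | by apply: diff_snd; exact: diff_id].
  by apply: diff_minv; [rewrite unitmx1 | exact: d1'].
have K1 : 0 < K + 1 by exact: addr_gt0.
exists (Num.min d1 (Num.min (d2 / (K + 1)) (d / L / (K + 1)))).
  by rewrite !lt_min d10 !divr_gt0.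
move=> y yf /lt_min3P[y1 y2 y3]; have [p [pu cp ph p1]] := KP y yf y1.
exists p; split=> //.
have v1 : rn ((p, y) - (1%:M, y0) : 'M[C]_m * E) <= (K + 1) * rn (y - y0).
  apply: rn_pair => /=.
    by apply: le_trans p1 _; rewrite ler_wpM2r ?rn_ge0 // lerDl.
  by rewrite ler_peMl ?rn_ge0 // lerDr ltW.
have v2 : rn ((p, y) - (1%:M, y0) : 'M[C]_m * E) < d2.
  by apply: le_lt_trans v1 _; rewrite mulrC -ltr_pdivlMr.
have := LP (p, y) I v2; rewrite /= -!gauge2E ?unitmx1 // gauge1 => h.
apply: le_lt_trans h _; apply: le_lt_trans (ler_wpM2l (ltW L0) v1) _.
by rewrite mulrC -ltr_pdivlMr // mulrC -ltr_pdivlMr.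
Qed.

Lemma openY_near (V : set (set E)) y0 : hopen Y V -> hklev y0 -> V (uorb y0) ->
  exists2 d : R, 0 < d & forall y, fixlev y -> rn (y - y0) < d -> V (hkpart (glorb y)).
Proof.
move=> /openYP[_ [N [No NV]]] y0h /(NV y0 y0h) Ny0.
have [d d0 dN] := open_ball No Ny0.
have [d' d'0 h] := hk_near y0h d0; exists d' => // y yf yd.
have [p [pu cp ph pd]] := h y yf yd.
by rewrite (hkpart_fixlev pu cp ph); apply/(NV _ ph); exact: dN.
Qed.

Lemma openCM_of (V : set (set E)) : hopen Y V -> exists2 V' : set (set E),
  hopen (calogero_moser m tau) V' &
  forall p, (V' p /\ A p) <-> exists y, [/\ hklev y, p = glorb y & V (uorb y)].
Proof.
move=> Vo.
(* An open subset of [X] must be cut out by an open set of the whole Calogero-Moser space. The union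
   of all saturated open sets whose orbits in [A] are sent into [V] is such a set; [slice_nbhd]
   provides enough of them. *)
pose good (N : set E) := [/\ open N, forall g y, g \in unitmx -> N y -> N (gauge g y)
    & forall y, N y -> mu_C y = - tau%:M -> A (glorb y) -> V (hkpart (glorb y))].
exists [set p | exists x, [/\ mu_C x = - tau%:M, p = glorb x & exists2 N, good N & N x]].
  apply/openCMP; split; first by move=> p [x [xl -> _]]; exists x.
  exists (\bigcup_(N in good) N); split; first by apply: bigcup_open => N [].
  move=> x xl; split=> [[y [yl xy [N Ng Ny]]]|[N Ng Nx]].
    exists N => //; have [g gu <-] : glorb y x by rewrite -xy; exact: glorb_refl.
    by have [_ Ns _] := Ng; exact: Ns.
  by exists x; split=> //; exists N.
move=> p; split=> [[[x [xl -> [N [_ _ NV] Nx]]] xA]|[y0 [y0h -> Vy0]]].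
  have [y yh xy] := A_hklev xl xA; exists y; split=> //.
  by rewrite -(glorb_hklev yh) -xy; exact: NV.
split; last exact: hklev_A.
have [d d0 dV] := openY_near Vo y0h Vy0.
have [N [s [No Ny0 Ns Nd Nl]]] := slice_nbhd y0h d0.
exists y0; split=> //; first exact: y0h.1.2.
exists N => //; split=> // [g y gu Ny|y Ny yl yA]; first by have [] := Ns g y gu Ny.
have [sy sf] := Nl y Ny yl; rewrite -sy; apply: dV; first exact: sf.
by have [] := Nd y Ny.
Qed.

Lemma openY_of (V V' : set (set E)) : V `<=` hcarrier Y -> hopen (calogero_moser m tau) V' ->
  (forall p, (V' p /\ A p) <-> exists y, [/\ hklev y, p = glorb y & V (uorb y)]) ->
  hopen Y V.
Proof.
move=> VY /openCMP[V'c [N [No NV]]] V'E; apply/openYP; split=> //; exists N; split=> // y yh.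
rewrite -(NV y yh.1.2); split=> [Vy|V'y].
  by have [] : V' (glorb y) /\ A (glorb y) by apply/V'E; exists y.
have /V'E[z [zh yz Vz]] := conj V'y (hklev_A yh).
by rewrite -(glorb_hklev yh) yz (glorb_hklev zh).
Qed.

Lemma hkpart_open V : V `<=` hcarrier Y ->
  (hopen Y V <-> hopen X (hcarrier X `&` hkpart @^-1` V)).
Proof.
move=> VY; split=> [/openCM_of[V' V'o V'E]|[V' V'o V'E]].
  exists V' => //; apply/seteqP; split=> p h; first exact: (iffRL (V'E p) (iffLR (preim_hkpart V p) h)).
  exact: (iffRL (preim_hkpart V p) (iffLR (V'E p) h)).
apply: (openY_of VY V'o) => p.
by split=> [h|/(iffRL (preim_hkpart V p))]; [apply: (iffLR (preim_hkpart V p)) |]; rewrite V'E.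
Qed.

Lemma uorb_open V y : hopen Y V -> hklev y -> V (uorb y) ->
  exists2 d : R, 0 < d & forall z, hklev z -> rn (z - y) < d -> V (uorb z).
Proof.
move=> /openYP[_ [N [No NV]]] yh /(NV y yh) Ny.
have [d d0 dN] := open_ball No Ny; exists d => // z zh zd.
by apply/(NV z zh); exact: dN.
Qed.

(* The holomorphic function [f] on the quiver variety, seen on the fixed part
   of the complex level set. *)
Let pull (f : set E -> C) (y : E) : C^o := f (hkpart (glorb y)).

Lemma pull_rdiff V (f : set E -> C) y : hopen Y V -> hholo Y V f -> fixlev y ->
  V (hkpart (glorb y)) -> rdiff (fixlev : set E) (pull f) y.
Proof.
move=> Vo fh yf Vy; have [g [gu cg gZ]] := kn_meet H yf.1 yf.2.
have yh : hklev (gauge g y) by split=> //; exact: (fixlev_gauge H gu cg yf).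
have Vy' : V (uorb (gauge g y)) by rewrite -(hkpart_fixlev gu cg yh).
have [N [F [No Ny Fd FE]]] := fh (gauge g y) (conj (conj I yh) Vy').
have [d1 d10 d1P] := uorb_open Vo yh Vy'.
have [d2 d20 d2P] := open_ball No Ny.
apply: (@invariant_rdiff _ F y g (Num.min d1 d2)) => //.
- by move=> z k _ ku _; rewrite /pull glorb_gauge.
- exact: Fd.
- by rewrite lt_min d10.
- move=> z zh; rewrite lt_min => /andP[z1 z2].
  have := FE z (d2P z z2) (conj (conj I zh) (d1P z zh z1)).
  by rewrite /= /pull /hkpart (glorb_hklev zh).
Qed.

(* The pulled back function is holomorphic on a whole neighbourhood once it is
   composed with the averaging projection and the retraction. *)
Lemma pull_extend V (f : set E -> C) y0 : hopen Y V -> hholo Y V f -> hklev y0 ->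
  V (uorb y0) -> exists d : R, exists2 F : E -> C^o, 0 < d &
  (forall y, rn (y - y0) < d -> differentiable F y) /\
  (forall y, fixlev y -> rn (y - y0) < d -> F y = pull f y).
Proof.
move=> Vo fh y0h Vy0; have [y0f y0Z] := y0h.
have [d1 [r d10 rP]] := retraction H y0f.
have [d2 d20 d2P] := openY_near Vo y0h Vy0.
have y0d : rn (y0 - y0) < d1 by rewrite subrr rn0.
have [_ rd r0] := rP y0 y0f.1 y0d.
have [K [d3 [K0 d30 KP]]] := rdiff_lip rd.
pose av := avgE (G := G) rho sg.
have avd : forall y, differentiable (av : E -> E) y.
  move=> y; apply: differentiableZ; apply: diff_sum => s.
  apply: differentiable_comp; first by apply: diff_act2; exact: diff_id.
  exact: diff_gauge.
have av0 : av y0 = y0 by exact: (avgE_id (kn_sgM H) (kn_sg1 H) y0f.1).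
have avf y : fixd (av y) by exact: (avgE_fixd (kn_rhoM H) (kn_rho1 H) (kn_sgM H) (kn_sg1 H)).
have [L [d4 [L0 d40 LP]]] := rdiff_lip (diff_rdiff setT (avd y0)).
have [d5 d50 d5P] : exists2 d5 : R, 0 < d5 & forall x, x < d5 -> [/\ x < d1, x < d3 & x < d2 / K].
  exists (Num.min d1 (Num.min d3 (d2 / K))); first by rewrite !lt_min d10 d30 divr_gt0.
  by move=> x /lt_min3P.
exists (Num.min d4 (Num.min d5 (d5 / L))), (pull f \o (r \o av)).
  by rewrite !lt_min d40 d50 divr_gt0.
have near y : rn (y - y0) < Num.min d4 (Num.min d5 (d5 / L)) -> rn (av y - y0) < d5.
  move=> /lt_min3P[y1 _ y3]; have := LP y I y1; rewrite av0 => h; apply: le_lt_trans h _.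
  by rewrite mulrC -ltr_pdivlMr.
have rnear z : fixd z -> rn (z - y0) < d5 -> [/\ fixlev (r z), rdiff (fixd : set E) r z,
    V (hkpart (glorb (r z))) & fixlev z -> r z = z].
  move=> zf /d5P[z1 z2 z3]; have [rf rdz rid] := rP z zf z1; split=> //.
  apply: d2P => //; have := KP z zf z2; rewrite (r0 y0f) => h; apply: le_lt_trans h _.
  by rewrite mulrC -ltr_pdivlMr.
split=> y yd; last first.
  move=> yd'; have avy : av y = y by exact: (avgE_id (kn_sgM H) (kn_sg1 H) yd.1).
  have := near y yd'; rewrite avy => h; have [_ _ _ rid] := rnear y yd.1 h.
  by rewrite /= avy rid.
have [rf rdz Vr _] := rnear (av y) (avf y) (near y yd).
have [q q0 qP] := rn_ball yd.
(* [pull f] is differentiable only along [fixlev], and [r] only along the fixed subspace. As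
   [r \o av] maps a full neighbourhood into [fixlev], the relative chain rule yields ordinary
   complex differentiability. *)
apply: (rdiff_diff (S := setT) q0) => //.
apply: (rdiff_comp (S' := fixlev) (f := r \o av) q0).
- by move=> z _ zq; have [] := rnear (av z) (avf z) (near z (qP z zq)).
- by apply: (rdiff_comp (S' := fixd) ltr01) => //; apply: diff_rdiff.
- exact: pull_rdiff Vo fh rf Vr.
Qed.

Lemma holo_extend V (f : set E -> C) y0 : hopen Y V -> hholo Y V f -> hklev y0 ->
  V (uorb y0) -> exists V' (g : set E -> C), [/\ hopen (calogero_moser m tau) V', V' (glorb y0),
    hholo (calogero_moser m tau) V' g & forall q, V' q -> A q -> f (hkpart q) = g q].
Proof.
move=> Vo fh y0h Vy0; have [d [F d0 [Fd FE]]] := pull_extend Vo fh y0h Vy0.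
have [N [s [No Ny0 Ns Nd Nl]]] := slice_nbhd y0h d0.
pose V' := [set p | exists x, [/\ mu_C x = - tau%:M, N x & p = glorb x]].
have V'N x : V' (glorb x) -> N x.
  move=> [z [_ Nz xz]]; have [g gu <-] : glorb z x by rewrite -xz; exact: glorb_refl.
  by have [] := Ns g z gu Nz.
(* Any representative gives the same value, since [s] is constant on the orbits in [N]; the default
   [y0] concerns only the empty set. *)
pose g (q : set E) : C := F (s (xget y0 q)).
have gE x : N x -> g (glorb x) = F (s x).
  move=> Nx; have [h hu hE] : glorb x (xget y0 (glorb x)).
    by apply: (xgetI y0 (P := glorb x) (x := x)); exact: glorb_refl.
  by rewrite /g -hE; have [_ ->] := Ns h x hu Nx.
exists V', g; split.
- apply/openCMP; split; first by move=> q [x [xl Nx ->]]; exists x.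
  exists N; split=> // x xl; split; first exact: V'N.
  by move=> Nx; exists x.
- by exists y0; split=> //; exact: y0h.1.2.
- move=> x [[_ xl] /V'N Nx]; exists N, (F \o s); split=> //.
    move=> z Nz; have [sd sz] := Nd z Nz; exact: (differentiable_comp sd (Fd _ sz)).
  by move=> z Nz _; exact: gE.
- move=> q [x [xl Nx ->]] xA; rewrite gE //.
  have [sx sf] := Nl x Nx xl; have [_ sn] := Nd x Nx.
  by rewrite (FE _ (sf xA) sn) /pull sx.
Qed.

(** The easy direction: [hklev] lies in the complex level set, so a local holomorphic extension from
    the latter serves the former too. *)
Lemma holo_restrict (V V' : set (set E)) (f g : set E -> C) y : hklev y -> V' (glorb y) ->
  hopen (calogero_moser m tau) V' -> hholo (calogero_moser m tau) V' g ->
  (forall z, hklev z -> V (uorb z) -> V' (glorb z) -> f (uorb z) = g (glorb z)) ->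
  exists N (F : E -> C), [/\ open N, N y, forall z, N z -> differentiable (F : E -> C^o) z
    & forall z, N z -> hklev z -> V (uorb z) -> f (uorb z) = F z].
Proof.
move=> yh V'y /openCMP[_ [N' [N'o N'V]]] gh gE.
have [N [F [No Ny Fd FE]]] := gh y (conj (conj I yh.1.2) V'y).
exists (N `&` N'), F; split.
- exact: openI.
- by split=> //; apply/(N'V y yh.1.2).
- by move=> z [Nz _]; exact: Fd.
- move=> z [Nz N'z] zh Vz; have V'z : V' (glorb z) by apply/(N'V z zh.1.2).
  by rewrite (gE z zh Vz V'z); exact: (FE z Nz (conj (conj I zh.1.2) V'z)).
Qed.

Lemma holoYP (V : set (set E)) (f : set E -> C) : hholo Y V f <->
  forall y : E, hklev y -> V (uorb y) -> exists N (F : E -> C), [/\ open N, N y,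
    forall z, N z -> differentiable (F : E -> C^o) z
  & forall z, N z -> hklev z -> V (uorb z) -> f (uorb z) = F z].
Proof. exact: hquot_hsubP. Qed.

Lemma holoXP (U : set (set E)) (f : set E -> C) : hholo X U f <->
  forall p : set E, U p -> exists (V' : set (set E)) (g : set E -> C),
    [/\ hopen (calogero_moser m tau) V', V' p, hholo (calogero_moser m tau) V' g
      & forall q, V' q -> U q -> f q = g q].
Proof.
split=> h p Up; case: (h p Up) => V' [g [V'o V'p gh gE]].
  by exists V', g; split; [exact: V'o | exact: V'p | exact: gh | move=> q; exact: gE].
by exists V', g; split; [exact: V'o | exact: V'p | exact: gh | move=> q; exact: gE].
Qed.

Lemma hkpart_holo (V : set (set E)) (f : set E -> C) : hopen Y V ->
  (hholo Y V f <-> hholo X (hcarrier X `&` hkpart @^-1` V) (f \o hkpart)).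
Proof.
move=> Vo; have UP := preim_hkpart V; move: (hcarrier X `&` hkpart @^-1` V) UP => U UP.
split=> [fh|].
  apply: (iffRL (holoXP _ _)) => p /UP[y0 [y0h -> Vy0]].
  have [V' [g [V'o V'y0 gh gE]]] := holo_extend Vo fh y0h Vy0.
  exists V', g; split=> // q V'q /UP[z [zh qz _]]; apply: gE => //.
  by rewrite qz; exact: hklev_A.
move=> /(iffLR (holoXP _ _)) fh; apply: (iffRL (holoYP V f)) => y yh Vy.
have Uy z : hklev z -> V (uorb z) -> U (glorb z) by move=> zh Vz; apply/UP; exists z.
have [V' [g [V'o V'y gh gE]]] := fh (glorb y) (Uy y yh Vy).
apply: (holo_restrict yh V'y V'o gh) => z zh Vz V'z.
by rewrite -(glorb_hklev zh); exact: gE V'z (Uy z zh Vz).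
Qed.

Theorem main_iso : hiso X Y.
Proof. by exists hkpart; split; [exact: hkpart_bij | exact: hkpart_open | exact: hkpart_holo]. Qed.
End Iso.

(** * Representations of the group *)

Lemma sum_mxtens (V : nmodType) p q (F : 'I_(p * q) -> V) :
  \sum_i F i = \sum_a \sum_b F (mxtens_index (a, b)).
Proof.
rewrite pair_bigA /= (reindex (@mxtens_index p q)); first by apply: eq_bigr => -[].
exists (@mxtens_unindex p q) => i _; [exact: mxtens_indexK | exact: mxtens_unindexK].
Qed.

Section Irreducibles.
Context {R : realType} {gT : finGroupType} {G : {group gT}} {d : nat}.
Local Notation C := (cplx R).
Context {irr : 'I_d.+1 -> representation C G}.
Hypothesis irr_all : irr_list irr.

Let sG : irrType C G := DecSocleType (regular_repr C G).
Let ic k : sG := irr_comp sG (irr k).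

Let pcharG : ([pchar C]^'.-group G)%g.
Proof. by apply/pgroupP => p _ _; rewrite inE /= pchar_num. Qed.

Let splitG : group_splitting_field C G.
Proof. exact: group_closure_closed_field. Qed.

Let irr_irr k : mx_irreducible (irr k). Proof. by case: irr_all. Qed.

Let ic_rsim k : mx_rsim (irr k) (irr_repr (ic k)).
Proof. exact: rsim_irr_comp_pchar. Qed.

Let ic_inj : injective ic.
Proof.
move=> k l e; have [_ h _ _ _] := irr_all; apply: h.
by apply: mx_rsim_trans (ic_rsim k) _; rewrite e; apply: mx_rsim_sym; exact: ic_rsim.
Qed.

Let ic_onto (i : sG) : exists k, ic k = i.
Proof.
have [_ _ h _ _] := irr_all.
have [k /mx_rsim_sym sim] := h (Representation (irr_repr i)) (socle_irr i).
exists k; rewrite -[RHS](irr_reprK_pchar pcharG i).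
exact: irr_comp_rsim_pchar sim.
Qed.

Lemma sum_rdegree_sqr : (\sum_k rdegree (irr k) ^ 2)%N = #|G|.
Proof.
rewrite -(sum_irr_degree_pchar sG pcharG splitG) (reindex ic).
  by apply: eq_bigr => k _; rewrite (mxrank_rsim (ic_rsim k)).
have /choice[ki kiP] := ic_onto; exists ki => i _; last exact: kiP.
by apply: ic_inj; exact: kiP.
Qed.

Lemma gring_op_sum n (rG : mx_representation C G n) A :
  gring_op rG A = \sum_(i < #|G|) gring_row A 0 i *: rG (enum_val i).
Proof.
rewrite gring_opE /gring_mx /= mulmx_sum_row linear_sum; apply: eq_bigr => i _.
by rewrite linearZ /= rowK mxvecK.
Qed.

(* The group algebra maps onto the product of the matrix algebras of the
   irreducible representations. *)
Lemma irr_onto (X : forall k, 'M[C]_(rdegree (irr k))) : exists u : 'rV[C]_#|G|,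
  forall k, \sum_i u 0 i *: irr k (enum_val i) = X k.
Proof.
have h k : exists u : 'rV[C]_#|G|, forall l,
    \sum_i u 0 i *: irr l (enum_val i) = if l == k then X l else 0.
  have /andP[_ full] := splitG (irr_irr k).
  have : (mxvec (X k) <= enveloping_algebra_mx (irr k))%MS by exact: submx_full.
  rewrite -(irr_comp_envelop_pchar sG pcharG (irr_irr k)) => /submxP[D XE].
  pose A := vec_mx (D *m Wedderburn_subring (ic k)).
  have AR : (A \in Wedderburn_subring (ic k))%MS by rewrite vec_mxK submxMl.
  exists (gring_row A) => l; rewrite -gring_op_sum; have [->|nlk] := eqVneq l k.
    apply: (can_inj mxvecK); rewrite XE mulmxA -/(ic k).
    by rewrite -[D *m _]vec_mxK mul_vec_lin.
  apply: (irr_comp'_op0_pchar pcharG (irr_irr l) _ AR).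
  by rewrite (inj_eq ic_inj) eq_sym.
have /choice[u uP] := h; exists (\sum_k u k) => l.
rewrite (eq_bigr (fun i => \sum_k u k 0 i *: irr l (enum_val i))); last first.
  by move=> i _; rewrite summxE scaler_suml.
rewrite exchange_big /= (bigD1 l) //= uP eqxx big1 ?addr0 // => k nkl.
by rewrite uP eq_sym (negPf nkl).
Qed.

(** Linear independence of matrix coefficients: by [irr_onto] some combination of group elements
    acts on every [irr k] as the adjoint of [c k], and the hypothesis makes the sum of the squared
    norms vanish. *)
Lemma irr_coef_free (c : forall k, 'M[C]_(rdegree (irr k))) :
  (forall s, s \in G -> \sum_k \tr (irr k s *m c k) = 0) -> forall k, c k = 0.
Proof.
move=> h; have [u uP] := irr_onto (fun k => (c k)^t*).
have : \sum_k \tr ((c k)^t* *m c k) = 0.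
  transitivity (\sum_i u 0 i * \sum_k \tr (irr k (enum_val i) *m c k)).
    rewrite (eq_bigr (fun k => \sum_i u 0 i * \tr (irr k (enum_val i) *m c k))).
      by rewrite exchange_big /=; apply: eq_bigr => i _; rewrite mulr_sumr.
    move=> k _; rewrite -(uP k) mulmx_suml raddf_sum /=; apply: eq_bigr => i _.
    by rewrite -scalemxAl mxtraceZ.
  by rewrite big1 // => i _; rewrite h ?mulr0 // enum_valP.
rewrite (eq_bigr (fun k => rc (fro ((c k)^t*)))); last first.
  by move=> k _; rewrite -mxtrace_fro adjmxK.
rewrite -rmorph_sum /= => /eqP; rewrite rc_eq0 psumr_eq0; last by move=> k _; exact: fro_ge0.
move=> /allP f0 k; have /eqP/fro_eq0 := f0 k (mem_index_enum k).
by move=> /(congr1 (fun A => A^t*)); rewrite adjmxK => ->; apply/matrixP => a b; rewrite !mxE conjC0.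
Qed.

Section ClassRep.
Variable v : 'I_d.+1 -> nat.
Local Notation rv := (class_rep irr v).

Lemma mul_mxdiag (p : 'I_d.+1 -> nat) (A B : forall k, 'M[C]_(p k)) :
  \mxdiag_k A k *m \mxdiag_k B k = \mxdiag_k (A k *m B k).
Proof.
rewrite [X in _ *m X]/mxdiag mul_mxdiag_mxblock; apply/eq_mxblock => i j.
by case: eqVneq => [<-|]; rewrite ?conform_mx_id ?mulmx0.
Qed.

Lemma conj_conform_mx0 p q p' q' (B : 'M[C]_(p', q')) i j :
  (conform_mx (0 : 'M_(p, q)) B i j)^* = conform_mx 0 (map_mx Num.conj B) i j.
Proof.
transitivity (map_mx Num.conj (conform_mx (0 : 'M_(p, q)) B) i j); first by rewrite mxE.
by rewrite map_conform_mx map_mx0.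
Qed.

Lemma adj_mxdiag (p : 'I_d.+1 -> nat) (A : forall k, 'M[C]_(p k)) :
  (\mxdiag_k A k)^t* = \mxdiag_k (A k)^t*.
Proof.
rewrite tr_mxdiag; apply/matrixP => i j; rewrite !mxE.
case: eqVneq => [e|_]; last by rewrite !mxE conjC0.
exact: conj_conform_mx0.
Qed.

Lemma scale_mxdiag (p : 'I_d.+1 -> nat) a (A : forall k, 'M[C]_(p k)) :
  a *: \mxdiag_k A k = \mxdiag_k (a *: A k).
Proof.
rewrite -mul_scalar_mx -mxdiagZ mul_mxdiag.
by apply/eq_mxdiag => k; rewrite mul_scalar_mx.
Qed.

Lemma tens11 a b (c : C) : (1%:M : 'M[C]_a) *t (c%:M : 'M[C]_b) = c%:M.
Proof.
apply/matrixP => i j; case: (mxtens_indexP i) => i0 i1; case: (mxtens_indexP j) => j0 j1.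
rewrite tensmxE !mxE (can_eq (@mxtens_indexK _ _)) xpair_eqE.
by case: eqVneq; rewrite ?mul1r ?mul0r.
Qed.

Lemma class_repM s t : s \in G -> t \in G -> rv (s * t)%g = rv s *m rv t.
Proof.
move=> gs gt; rewrite /class_rep mul_mxdiag; apply/eq_mxdiag => k.
by rewrite tensmx_mul mul1mx repr_mxM.
Qed.

Lemma class_rep1 : rv 1%g = 1%:M.
Proof.
rewrite /class_rep -mxdiagZ; apply/eq_mxdiag => k.
by rewrite repr_mx1 tens11.
Qed.

Lemma class_repU s : s \in G -> rv s \is unitarymx.
Proof.
move=> gs; apply/unitarymxP; rewrite adj_mxdiag mul_mxdiag -mxdiagZ; apply/eq_mxdiag => k.
have [_ _ _ U _] := irr_all.
have E : ((1%:M : 'M[C]_(v k)) *t irr k s)^t* = 1%:M *t (irr k s)^t*.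
  by rewrite trmx_tens map_mxT trmx1 map_mx1.
by rewrite E tensmx_mul mul1mx (unitarymxP (U k s gs)) tens11.
Qed.

Lemma class_scalar_cst a : class_scalar irr v (fun=> a) = a%:M.
Proof. exact: mxdiagZ. Qed.

Lemma class_scalar_comm z s : class_scalar irr v z *m rv s = rv s *m class_scalar irr v z.
Proof.
rewrite /class_scalar /class_rep !mul_mxdiag; apply/eq_mxdiag => k.
by rewrite scalar_mxC.
Qed.

Lemma class_scalarM y z :
  class_scalar irr v y *m class_scalar irr v z = class_scalar irr v (fun k => y k * z k).
Proof.
by rewrite /class_scalar mul_mxdiag; apply/eq_mxdiag => k; rewrite -scalar_mxM.
Qed.

Lemma class_scalar_adj z : (class_scalar irr v z)^t* = class_scalar irr v (fun k => (z k)^* ).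
Proof.
by rewrite adj_mxdiag; apply/eq_mxdiag => k; rewrite tr_scalar_mx map_scalar_mx.
Qed.

Lemma class_scalar_sum z : class_scalar irr v z =
  \sum_l z l *: class_scalar irr v (fun k => (k == l)%:R).
Proof.
rewrite (eq_bigr (fun l => \mxdiag_k (z l *: ((k == l)%:R)%:M))); last first.
  by move=> l _; rewrite scale_mxdiag.
rewrite -mxdiag_sum; apply/eq_mxdiag => k; rewrite (bigD1 k) //= eqxx scalemx1.
by rewrite big1 ?addr0 // => l nlk; rewrite eq_sym (negPf nlk) raddf0 scaler0.
Qed.

(* Schur: [class_scalar] lies in the algebra generated by the representation. *)
Lemma class_scalar_central z h : (forall s, s \in G -> h *m rv s = rv s *m h) ->
  h *m class_scalar irr v z = class_scalar irr v z *m h.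
Proof.
move=> ch; have [u uP] := irr_onto (fun k => (z k)%:M).
have -> : class_scalar irr v z = \sum_i u 0 i *: rv (enum_val i).
  rewrite (eq_bigr (fun i => \mxdiag_k (u 0 i *: (1%:M *t irr k (enum_val i))))); last first.
    by move=> i _; rewrite scale_mxdiag.
  rewrite -mxdiag_sum; apply/eq_mxdiag => k; rewrite -tens11 -(uP k).
  apply/matrixP => a b; case: (mxtens_indexP a) => a0 a1; case: (mxtens_indexP b) => b0 b1.
  rewrite tensmxE !summxE mulr_sumr; apply: eq_bigr => i _.
  by rewrite !mxE !mxtens_indexK /= mulrCA.
rewrite mulmx_sumr mulmx_suml; apply: eq_bigr => i _.
by rewrite -scalemxAr -scalemxAl ch // enum_valP.
Qed.

Lemma class_repP : mx_repr G rv.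
Proof. by split; [exact: class_rep1 | exact: class_repM]. Qed.

Definition class_repr := MxRepresentation class_repP.
End ClassRep.

Lemma muln_intertw (r : representation C G) M (rG : mx_representation C G M) n
    (q : 'I_n -> 'M[C]_(rdegree r, M)) :
  (forall i x, x \in G -> r x *m q i = q i *m rG x) ->
  exists2 Q : 'M[C]_(rdegree (muln_grepr r n), M),
    forall x, x \in G -> muln_grepr r n x *m Q = Q *m rG x
    & forall c : 'cV[C]_M, Q *m c = 0 -> forall i, q i *m c = 0.
Proof.
elim: n q => [|n IH] q hq.
  rewrite /muln_grepr big_ord0; exists 0 => [x _|c _ []//].
  by rewrite mul0mx mulmx0.
have [Q hQ Qc] := IH (fun i => q (lift ord0 i)) (fun i => hq (lift ord0 i)).
rewrite /muln_grepr big_ord_recl -/(muln_grepr r n).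
exists (col_mx (q ord0) Q) => [x Gx|c].
  by rewrite /= mul_block_col !mul0mx addr0 add0r mul_col_mx hq // hQ.
rewrite mul_col_mx -col_mx0 => /eq_col_mx[c0 c1] i.
by case: (unliftP ord0 i) => [j|] ->; [exact: Qc|].
Qed.

Lemma rdegree_muln (r : representation C G) n : rdegree (muln_grepr r n) = (n * rdegree r)%N.
Proof.
elim: n => [|n IH]; first by rewrite /muln_grepr big_ord0.
by rewrite /muln_grepr big_ord_recl -/(muln_grepr r n) /= IH mulSn.
Qed.

Lemma mx_rsim_muln (r : representation C G) M (rG : mx_representation C G M) n
    (q : 'I_n -> 'M[C]_(rdegree r, M)) : (n * rdegree r)%N = M ->
  (forall i x, x \in G -> r x *m q i = q i *m rG x) ->
  (forall c : 'cV[C]_M, (forall i, q i *m c = 0) -> c = 0) ->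
  mx_rsim (muln_grepr r n) rG.
Proof.
move=> EM hq qc; have [Q hQ Qc] := muln_intertw hq.
have Ed : rdegree (muln_grepr r n) = M by rewrite rdegree_muln.
exists Q => //; apply: (etrans (congr1 (fun p => \rank Q == p) Ed)).
rewrite -mxrank_tr; apply: inj_row_free => c cQ; apply: (can_inj trmxK).
rewrite trmx0; apply: qc; apply: Qc; apply: (can_inj trmxK).
by rewrite trmx_mul trmxK cQ trmx0.
Qed.

Variable n : nat.
Let v k := (n * rdegree (irr k))%N.

Lemma class_dim_regular : class_dim irr v = (n * #|G|)%N.
Proof.
rewrite -sum_rdegree_sqr big_distrr; apply: eq_bigr => k _.
by rewrite /v -mulnA mulnn.
Qed.

(** The Fourier transform of the group on the [i]-th copy of the regular representation. The
    multiplicity space of dimension [n * rdegree (irr k)] is indexed by pairs (copy, row index), and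
    the row of a group element lists the coefficients of [irr k] at that element. *)
Let qrow (i : 'I_n) k : 'M[C]_(#|G|, v k * rdegree (irr k)) := \matrix_(g, p)
  let ia := mxtens_unindex (mxtens_unindex p).1 in
  (ia.1 == i)%:R * irr k (enum_val g) ia.2 (mxtens_unindex p).2.

Let qrowE i k g j a b : qrow i k g (mxtens_index (mxtens_index (j, a), b)) =
  (j == i)%:R * irr k (enum_val g) a b.
Proof. by rewrite mxE !mxtens_indexK. Qed.

(** The transforms of the [n] copies are jointly injective by [irr_coef_free], and the dimensions
    agree because the squares of the degrees sum to the order of the group. *)
Lemma regular_class : mx_rsim (muln_grepr (Representation (regular_repr C G)) n) (class_repr v).
Proof.
apply: (@mx_rsim_muln (Representation (regular_repr C G)) _ (class_repr v) n (fun i => \mxrow_k qrow i k)).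
- exact: esym class_dim_regular.
- move=> i x Gx; rewrite mul_mxrow /= /class_rep mul_mxrow_mxdiag; apply/eq_mxrow => k.
  apply/row_matrixP => g; rewrite row_mul rowK -rowE.
  apply/rowP => p; rewrite !mxE.
  case: (mxtens_indexP p) => ia b; case: (mxtens_indexP ia) => j a {p ia}.
  rewrite !mxtens_indexK /= gring_indexK ?groupM ?enum_valP // repr_mxM ?enum_valP //.
  rewrite mxE mulr_sumr sum_mxtens [RHS](bigD1 (mxtens_index (j, a))) //= [X in _ = _ + X]big1 ?addr0.
    by apply: eq_bigr => b' _; rewrite qrowE tensmxE mxE eqxx mul1r mulrA.
  move=> ja nja; apply: big1 => b1 _; by rewrite tensmxE [X in _ * (X * _)]mxE (negPf nja) mul0r mulr0.
- move=> c hc; suff h k : submxcol c k = 0 by rewrite -(submxcolK c); apply/colP => p; rewrite mxE h !mxE.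
  apply/colP => p; case: (mxtens_indexP p) => ia b; case: (mxtens_indexP ia) => j a {p ia}.
  pose ck l : 'M[C]_(rdegree (irr l)) :=
    \matrix_(b, a) submxcol c l (mxtens_index (mxtens_index (j, a), b)) 0.
  suff /(_ k) /matrixP/(_ b a) : forall l, ck l = 0 by rewrite !mxE.
  apply: irr_coef_free => s Gs.
  have /matrixP/(_ (gring_index G s) 0) := hc j.
  rewrite -(submxcolK c) mul_mxrow_mxcol summxE => hs.
  rewrite [RHS](_ : 0 = (0 : 'cV[C]_#|G|) (gring_index G s) 0); last by rewrite mxE.
  rewrite -hs; apply: eq_bigr => l _.
  rewrite mxE sum_mxtens sum_mxtens (bigD1 j) //= [X in _ = _ + X]big1 ?addr0; last first.
    move=> j' nj; apply: big1 => a' _; apply: big1 => b' _.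
    by rewrite qrowE (negPf nj) mul0r mul0r.
  apply: eq_bigr => a' _; rewrite mxE; apply: eq_bigr => b' _.
  by rewrite qrowE eqxx mul1r gring_indexK // [in LHS]mxE.
Qed.

Local Notation w := (fun k : 'I_d.+1 => (k == ord0) : nat).

Lemma class_dim_trivial : class_dim irr w = 1%N.
Proof.
have [_ _ _ _ [d0 _]] := irr_all.
by rewrite /class_dim (bigD1 ord0) //= d0 big1 // => k /negPf ->.
Qed.

Lemma class_rep_trivial s : s \in G -> class_rep irr w s = 1%:M.
Proof.
move=> Gs; have [_ _ _ _ [_ irr0]] := irr_all.
rewrite /class_rep -mxdiagZ; apply/eq_mxdiag => k.
have [->|nk] := eqVneq k ord0; first by rewrite irr0 // tens11.
by apply/matrixP => i; have := ltn_ord i; rewrite [X in (_ < X)%N]mul0n ltn0.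
Qed.
End Irreducibles.

(** * Quiver varieties *)

Section Equivariance.
Context {C : numClosedFieldType} {m : nat}.
Implicit Type x : qdata C m 1.

Lemma Bat_mulmx (e s : 'M[C]_2) x (l : 'cV[C]_2) : e \in unitmx ->
  Bat e x (s *m l) = (invmx e *m l) 0 0 *: Bat e x (s *m col 0 e)
                   + (invmx e *m l) 1 0 *: Bat e x (s *m col 1 e).
Proof.
move=> eu; set c := invmx e *m l.
have lE : l = c 0 0 *: col 0 e + c 1 0 *: col 1 e.
  rewrite -[LHS](mulKVmx eu) -/c; move: (c) => u; apply/colP => i; rewrite !mxE sum_ord2.
  by congr (_ + _); exact: mulrC.
rewrite {1}lE [s *m _]mulmxDr -!scalemxAr.
rewrite /Bat mulmxDr -!scalemxAr; set p := invmx e *m _; set q := invmx e *m _.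
move: (c 0 0) (c 1 0) (p) (q) => a b {}p {}q; rewrite !mxE.
by rewrite !scalerDr !scalerDl !scalerA addrACA.
Qed.

Lemma Bat_col (e : 'M[C]_2) x : e \in unitmx -> Bat e x (col 0 e) = qB1 x /\ Bat e x (col 1 e) = qB2 x.
Proof.
by move=> eu; rewrite /Bat !colE !mulmxA mulVmx // !mul1mx !mxE /= !scale1r !scale0r addr0 add0r.
Qed.

Lemma equivariant_gauge (e s : 'M[C]_2) (r : 'M[C]_m) x : e \in unitmx -> r \in unitmx ->
  [/\ forall l, Bat e x (s *m l) *m r = r *m Bat e x l, qi x = r *m qi x & qj x *m r = qj x]
  <-> gauge r x = actL e s x.
Proof.
move=> eu ru; have [b1 b2] := Bat_col x eu; split=> [[hB hi hj]|E].
  apply: qdataP; rewrite /gauge /actL /qB1 /qB2 /qi /qj /=.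
  - by rewrite -/(qB1 x) -b1 -(hB (col 0 e)) -mulmxA mulmxV // mulmx1.
  - by rewrite -/(qB2 x) -b2 -(hB (col 1 e)) -mulmxA mulmxV // mulmx1.
  - exact: esym hi.
  - by rewrite -/(qj x) -{1}hj -mulmxA mulmxV // mulmx1.
have E1 : r *m qB1 x *m invmx r = Bat e x (s *m col 0 e) by exact: (congr1 qB1 E).
have E2 : r *m qB2 x *m invmx r = Bat e x (s *m col 1 e) by exact: (congr1 qB2 E).
have Ei : r *m qi x = qi x by exact: (congr1 qi E).
have Ej : qj x *m invmx r = qj x by exact: (congr1 qj E).
split=> [l||]; last 2 first.
- exact: esym Ei.
- by rewrite -{1}Ej -mulmxA mulVmx // mulmx1.
rewrite Bat_mulmx // -E1 -E2 /Bat mulmxDl mulmxDr -!scalemxAl -!scalemxAr.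
by rewrite -!mulmxA mulVmx // !mulmx1.
Qed.
End Equivariance.

Section UnitaryCoordinates.
Context {R : realType} {gT : finGroupType} {G : {group gT}}.
Local Notation C := (cplx R).
Context {L : mx_representation C G 2} {h e : 'M[C]_2}.
Hypothesis h_inv : invariant_hermitian L h.
Hypothesis e_basis : orthonormal_symplectic h e.

Definition conj_rep (s : gT) : 'M[C]_2 := invmx e *m L s *m e.

Lemma basis_unit : e \in unitmx.
Proof. by have [_ e1] := e_basis; rewrite unitmxE e1 unitr1. Qed.

Let eh : invmx e = e^t* *m h.
Proof.
have [E _] := e_basis.
by rewrite -[RHS]mulmx1 -(mulmxV basis_unit) mulmxA E mul1mx.
Qed.

Lemma conj_repM s t : s \in G -> t \in G -> conj_rep (s * t)%g = conj_rep s *m conj_rep t.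
Proof.
move=> Gs Gt; rewrite /conj_rep repr_mxM // !mulmxA; congr (_ *m _ *m _).
by rewrite -[in RHS](mulmxA _ e) mulmxV ?basis_unit // mulmx1.
Qed.

Lemma conj_rep1 : conj_rep 1%g = 1%:M.
Proof. by rewrite /conj_rep repr_mx1 mulmx1 mulVmx // basis_unit. Qed.

(** Orthonormality turns the invariant form [h] into the standard one in the coordinates given by
    [e]. *)
Lemma conj_repU s : s \in G -> conj_rep s \is unitarymx.
Proof.
move=> Gs; have [hH _ hL] := h_inv; have [E _] := e_basis.
apply/unitarymxP; apply: mulmx1C.
have -> : (conj_rep s)^t* = e^t* *m (L s)^t* *m h *m e.
  by rewrite /conj_rep eh !(trmx_mul, map_mxM) /= adjmxK hH !mulmxA.
rewrite /conj_rep !mulmxA -[_ *m e *m invmx e]mulmxA mulmxV ?basis_unit // mulmx1.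
by rewrite -[X in X *m e]mulmxA -[X in X *m e]mulmxA (mulmxA _ h) hL.
Qed.
End UnitaryCoordinates.

(** * The fixed locus in equivariant coordinates *)

Section FixedPoints.
Context {R : realType} {gT : finGroupType} {G : {group gT}} {m n : nat}.
Local Notation C := (cplx R).
Local Notation E := (qdata C m 1).
Context {L : mx_representation C G 2} {e : 'M[C]_2} {rv : mx_representation C G m}.
Local Notation sg := (conj_rep (L := L) (e := e)).
Hypothesis rv_regular : mx_rsim (muln_grepr (Representation (regular_repr C G)) n) rv.
Local Notation fixd := (fixd (G := G) rv sg).

(** An isomorphism between [rho] and [rv] is itself a change of coordinates turning a fixed point
    into an equivariant one for [rv]; conversely [rv] serves as [rho]. This is the condition that
    [main_iso] requires of its subset [A]. *)
Lemma fixed_regular_fixd (x : E) :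
  ((forall s, s \in G -> actL e (L s) @` glorb x = glorb x) /\
    exists (y : E) (rho : mx_representation C G m),
      [/\ glorb x y, forall s, s \in G -> gauge (rho s) y = actL e (L s) y
        & mx_rsim rho (muln_grepr (Representation (regular_repr C G)) n)])
  <-> exists2 g, g \in unitmx & fixd (gauge g x).
Proof.
have ru s : s \in G -> rv s \in unitmx by exact: repr_mx_unit.
split=> [[_ [y [rho [[g0 g0u <-] yfix sim]]]]|[g gu gf]].
  have [B _ Bf hB] := mx_rsim_trans sim rv_regular.
  have Bu : B \in unitmx by rewrite -row_free_unit.
  have Bi : invmx B \in unitmx by rewrite unitmx_inv.
  exists (invmx B *m g0) => [|s Gs]; first by rewrite unitmx_mul Bi.
  have rhou : rho s \in unitmx by exact: repr_mx_unit.
  rewrite (gaugeM x Bi g0u) -(gaugeM _ (ru s Gs) Bi).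
  have -> : rv s *m invmx B = invmx B *m rho s.
    by apply: (can_inj (mulKmx Bu)); rewrite mulKVmx // mulmxA -hB // mulmxK.
  by rewrite (gaugeM _ Bi rhou) (yfix s Gs) actLE gauge_act2.
set y := gauge g x in gf.
have yx : glorb x y by exists g.
have xy : x = gauge (invmx g) y by rewrite gaugeK.
split.
  move=> s Gs; have ri : invmx (rv s) \in unitmx by rewrite unitmx_inv ru.
  have orbP k : k \in unitmx -> glorb x (gauge k y).
    by move=> ku; exists (k *m g); [rewrite /= unitmx_mul ku | exact: (gaugeM x ku gu)].
  have orbI z : glorb x z -> exists2 k, k \in unitmx & z = gauge k y.
    move=> [k ku <-]; exists (k *m invmx g); first by rewrite unitmx_mul ku unitmx_inv.
    by rewrite xy (gaugeM y ku) ?unitmx_inv.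
  apply/seteqP; split=> [_ [z /orbI[k ku ->] <-]|z /orbI[k ku ->]].
    rewrite actLE -gauge_act2 -(gf s Gs) -(gaugeM y ku (ru s Gs)).
    by apply: orbP; rewrite unitmx_mul ku ru.
  exists (gauge (k *m invmx (rv s)) y); first by apply: orbP; rewrite unitmx_mul ku.
  rewrite actLE (gaugeM y ku ri) -gauge_act2 -gauge_act2 -(gf s Gs).
  exact: (congr1 (gauge k) (gaugeK y (ru s Gs))).
exists y, rv; split; [exact: yx | | exact: mx_rsim_sym].
by move=> s Gs; rewrite actLE; exact: gf.
Qed.

End FixedPoints.

Section QuiverSpace.
Context {R : realType} {gT : finGroupType} {G : {group gT}} {m w n : nat}.
Local Notation C := (cplx R).
Context {L : mx_representation C G 2} {e : 'M[C]_2} {rv : mx_representation C G m}.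
Context {rw : gT -> 'M[C]_w} {tau : C} {Z zC : 'M[C]_m}.

(* [quiver_variety] over arbitrary dimensions, so that [class_dim] of the
   trivial class can be replaced by [1]. *)
Definition quiver_level : set (qdata C m w) := [set x |
  [/\ forall s, s \in G ->
      [/\ forall l, Bat e x (L s *m l) *m rv s = rv s *m Bat e x l,
          qi x *m rw s = rv s *m qi x & qj x *m rv s = rw s *m qj x],
      mu_C x = zC & mu_R x = Z]].

Definition quiver_space : hspace C :=
  hquot (X := hsub (X := haffine (qdata C m w)) quiver_level)
    (orbit_of [set u | u \is unitarymx /\ forall s, s \in G -> u *m rv s = rv s *m u]).
End QuiverSpace.
Arguments quiver_space {R gT G m w} L e rv rw Z zC.

Lemma quiver_space_iso (R : realType) (gT : finGroupType) (G : {group gT}) (m w n : nat)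
    (L : mx_representation (cplx R) G 2) (e : 'M[cplx R]_2)
    (rv : mx_representation (cplx R) G m) (rw : gT -> 'M[cplx R]_w) tau (Z zC : 'M[cplx R]_m) :
  w = 1%N -> (forall s, s \in G -> rw s = 1%:M) -> zC = - tau%:M -> e \in unitmx ->
  kn_setting G rv (conj_rep (L := L) (e := e)) tau Z ->
  mx_rsim (muln_grepr (Representation (regular_repr (cplx R) G)) n) rv ->
  hiso (cm_fixed_regular L e m n tau) (quiver_space L e rv rw Z zC).
Proof.
move=> wE; case: _ / (esym wE) in rw *.
move=> rw1 -> eu H rv_regular.
have levE : quiver_level (L := L) (e := e) (rv := rv) (rw := rw) (Z := Z) (zC := - tau%:M)
    = hklev (G := G) (rho := rv) (sg := conj_rep (L := L) (e := e)) (tau := tau) (Z := Z).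
  apply/seteqP; split=> [x [xe xc xr]|x [[xf xc] xr]].
    split=> //; split=> // s Gs; rewrite -actLE; apply/equivariant_gauge => //.
      exact: repr_mx_unit.
    by have := xe s Gs; rewrite (rw1 s Gs) mulmx1 mul1mx.
  split=> // s Gs; rewrite (rw1 s Gs) mulmx1 mul1mx; apply/equivariant_gauge => //.
    exact: repr_mx_unit.
  by rewrite actLE; exact: xf.
rewrite /quiver_space levE; apply: (main_iso H) => x xl.
exact: (fixed_regular_fixd rv_regular).
Qed.

Section ClassSetting.
Context {R : realType} {gT : finGroupType} {G : {group gT}} {d : nat}.
Local Notation C := (cplx R).
Context {irr : 'I_d.+1 -> representation C G}.
Hypothesis irr_all : irr_list irr.
Context {L : mx_representation C G 2} {h e : 'M[C]_2}.
Hypothesis L_SL : forall s, s \in G -> \det (L s) = 1.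
Hypothesis h_inv : invariant_hermitian L h.
Hypothesis e_basis : orthonormal_symplectic h e.
Context {v : 'I_d.+1 -> nat} {tau : C} {zetaR : 'I_d.+1 -> R}.
Hypothesis tau_neq0 : tau != 0.

Lemma class_setting : kn_setting G (class_rep irr v) (conj_rep (L := L) (e := e)) tau
  (- class_scalar irr v (fun k => (zetaR k)%:C%C)).
Proof.
have rM : forall s t, s \in G -> t \in G ->
    class_rep irr v (s * t)%g = class_rep irr v s *m class_rep irr v t by exact: class_repM.
have r1 : class_rep irr v 1%g = 1%:M by exact: class_rep1.
have rU : forall s, s \in G -> class_rep irr v s \is unitarymx by exact: (class_repU irr_all).
have sM := @conj_repM _ _ _ L _ _ e_basis.
have s1 := @conj_rep1 _ _ _ L _ _ e_basis.
have sU := conj_repU h_inv e_basis.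
have sdet s : s \in G -> \det (conj_rep (L := L) (e := e) s) = 1.
  by move=> Gs; rewrite det_act_conj ?L_SL //; case: e_basis.
split=> //.
  by move=> k ck; rewrite mulmxN mulNmx (class_scalar_central irr_all _ ck).
move=> x xf xl.
(* The projections onto the isotypic blocks. They are Hermitian and central for the commutant, and
   [class_scalar] of [zetaR] is their combination, so [kn_exists] applies with one determinant term
   per irreducible representation. *)
pose p (k : 'I_d.+1) := class_scalar irr v (fun l => (l == k)%:R).
have pH k : (p k)^t* = p k.
  by rewrite class_scalar_adj; congr class_scalar; apply/funext => l; rewrite conjC_nat.
have pP k : p k *m p k = p k.
  by rewrite class_scalarM; congr class_scalar; apply/funext => l; rewrite -natrM mulnb andbb.
have pC k g : comms (fun s => s \in G) (class_rep irr v) g -> g *m p k = p k *m g.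
  by move=> cg; exact: (class_scalar_central irr_all _ cg).
have pc k : comms (fun s => s \in G) (class_rep irr v) (p k).
  by move=> s _; exact: class_scalar_comm.
rewrite (class_scalar_sum v (fun k => (zetaR k)%:C%C)).
apply: (kn_exists rU zetaR pH pP pC pc tau_neq0 xl) => g gu cg.
apply: (fixd_mu_R rU sU).
exact: (fixd_gauge rM r1 gu cg xf).
Qed.
End ClassSetting.

Theorem corollary18 (R : realType) (gT : finGroupType) (G : {group gT})
    (L : mx_representation (cplx R) G 2)
    (L_faithful : mx_faithful L)
    (L_SL : forall s, s \in G -> \det (L s) = 1)
    (h e : 'M[cplx R]_2)
    (h_inv : invariant_hermitian L h)
    (e_basis : orthonormal_symplectic h e)
    (d : nat) (irr : 'I_d.+1 -> representation (cplx R) G)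
    (irr_all : irr_list irr)
    (tau : cplx R) (tau_neq0 : tau != 0)
    (n : nat) (zetaR : 'I_d.+1 -> R) :
  hiso (cm_fixed_regular L e (n * #|G|) n tau)
       (quiver_variety irr L e
          (fun k => n * rdegree (irr k))%N (fun k => (k == ord0) : nat)
          (fun=> tau) zetaR).
Proof.
(* From here on the fixed points and the quiver data are matrices of the same formal size. *)
rewrite -(class_dim_regular irr_all n).
apply: (quiver_space_iso (rv := class_repr _) (class_dim_trivial irr_all)).
- exact: class_rep_trivial.
- by rewrite class_scalar_cst.
- exact: basis_unit e_basis.
- exact: (class_setting irr_all L_SL h_inv e_basis tau_neq0).
- exact: regular_class.
Qed.
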